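(* Let $\Gamma$ be a discrete countable $C^*$-simple group acting on a unital $C^*$-algebra $\mathcal{B}$. Then the following conditions are equivalent: (i) $C^*_\lambda(\Gamma) \subseteq \mathcal{B} \rtimes_{\mathrm{red}} \Gamma$ is $C^*$-irreducible, (ii) for each non-zero positive $a \in \mathcal{B}$ there exist $t_1,\dots,t_n \in \Gamma$ such that $\sum_{j=1}^n u_{t_j}^* a u_{t_j} \ge 1_{\mathcal{B}}$, (iii) each state $\phi$ on $\mathcal{B}$ is $\Gamma$-faithful, i.e., if $a \in \mathcal{B}$ is positive and $\phi(u_t^* a u_t) = 0$ for all $t \in \Gamma$, then $a = 0$, (iv) there exists $\mu \in \mathrm{Prob}(\Gamma)$ such that each $\mu$-stationary state $\phi$ on $\mathcal{B}$ is faithful.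
   Context: $C^*_\lambda(\Gamma)$ is the reduced group $C^*$-algebra of $\Gamma$, and $\Gamma$ is $C^*$-simple if $C^*_\lambda(\Gamma)$ is simple. $\mathcal{B}\rtimes_{\mathrm{red}}\Gamma$ is the reduced crossed product, $t\mapsto u_t$ denotes the canonical unitary representation of $\Gamma$ in it (implementing the action on $\mathcal{B}$ by conjugation, $b \mapsto u_t b u_t^*$), and $C^*_\lambda(\Gamma)\subseteq \mathcal{B}\rtimes_{\mathrm{red}}\Gamma$ is the sub-$C^*$-algebra generated by $\{u_t: t\in\Gamma\}$. A unital inclusion $\mathcal{C} \subseteq \mathcal{A}$ of $C^*$-algebras is $C^*$-irreducible if each intermediate $C^*$-algebra $\mathcal{C} \subseteq \mathcal{D} \subseteq \mathcal{A}$ (including $\mathcal{C}$ and $\mathcal{A}$) is simple. $\mathrm{Prob}(\Gamma)$ is the set of probability measures on $\Gamma$. For $\mu\in\mathrm{Prob}(\Gamma)$, a state $\phi$ on $\mathcal{B}$ is $\mu$-stationary if $\mu*\phi=\phi$, where $\mu*\phi=\sum_{t\in\Gamma}\mu(t)\, t.\phi$ and $(t.\phi)(a)=\phi(u_t^* a u_t)$ for $t\in\Gamma$, $a\in\mathcal{B}$. *)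

(* Defs.v *)
From HB Require Import structures.
From mathcomp Require Import all_boot all_order all_algebra.
From mathcomp Require Import finmap complex.
From mathcomp Require Import all_classical all_reals all_analysis.
From mathcomp.analysis.showcase Require summability.

Set Implicit Arguments.
Unset Strict Implicit.
Unset Printing Implicit Defensive.
Import Order.TTheory GRing.Theory Num.Theory.
Import numFieldNormedType.Exports.

Local Open Scope classical_set_scope.
Local Open Scope ring_scope.
Local Open Scope complex_scope.

Declare Scope cstar_scope.
Delimit Scope cstar_scope with cstar.
Reserved Notation "x ** y" (at level 40, left associativity).

(* Unital non-zero C*-algebras.  The ring operations are fields of the mixin
   because Hierarchy Builder has no join of the library's normed modules with
   its rings, the structure Num.NumDomain standing in the way. *)
HB.mixin Record isCStar (R : realType) A of CompleteNormedModule R[i] A := {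
  cmul : A -> A -> A ;
  cone : A ;
  star : A -> A ;
  cmulA : associative cmul ;
  cmul1 : left_id cone cmul ;
  cmulr1 : right_id cone cmul ;
  cmulDl : left_distributive cmul +%R ;
  cmulDr : right_distributive cmul +%R ;
  cmulZl : forall (c : R[i]) x y, cmul (c *: x) y = c *: cmul x y ;
  cmulZr : forall (c : R[i]) x y, cmul x (c *: y) = c *: cmul x y ;
  cone_neq0 : cone != 0 ;
  starK : involutive star ;
  starD : {morph star : x y / x + y} ;
  starZ : forall (c : R[i]) x, star (c *: x) = c^* *: star x ;
  starM : forall x y, star (cmul x y) = cmul (star y) (star x) ;
  cnormM : forall x y, `|cmul x y| <= `|x| * `|y| ;
  cnorm_star : forall x, `|cmul (star x) x| = `|x| ^+ 2
}.
#[short(type="cstarType")]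
HB.structure Definition CStar (R : realType) :=
  {A of isCStar R A & CompleteNormedModule R[i] A}.

Notation "x ** y" := (cmul x y) : cstar_scope.
Notation "1" := (@cone _ _) : cstar_scope.
Local Open Scope cstar_scope.

(* The inner product is linear in its first argument. *)
HB.mixin Record isHilbert (R : realType) H of CompleteNormedModule R[i] H := {
  dot : H -> H -> R[i] ;
  dotPl : forall (c : R[i]) x y z, dot (c *: x + y) z = c * dot x z + dot y z ;
  dotC : forall x y, dot x y = (dot y x)^* ;
  dot_norm : forall x, dot x x = `|x| ^+ 2
}.
#[short(type="hilbertType")]
HB.structure Definition Hilbert (R : realType) :=
  {H of isHilbert R H & CompleteNormedModule R[i] H}.

(* The library's norm takes its values in R[i]. *)
Definition rnorm (R : realType) (V : normedModType R[i]) (x : V) : R :=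
  complex.Re `|x|.

Section CStarTheory.
Variables (R : realType) (A B : cstarType R).

Definition cpos (a : A) : Prop := exists x : A, a = star x ** x.

Definition cle (a b : A) : Prop := cpos (b - a).

Record state (phi : A -> R[i]) : Prop := {
  state_linear : scalar phi ;
  state_pos : forall a, cpos a -> 0 <= phi a ;
  state_one : phi 1%cstar = 1%R
}.

Definition faithful (phi : A -> R[i]) : Prop :=
  forall a, cpos a -> phi a = 0 -> a = 0.

Record star_hom (f : A -> B) : Prop := {
  star_hom_linear : linear f ;
  star_homM : forall x y, f (x ** y) = f x ** f y ;
  star_hom1 : f 1 = 1 ;
  star_hom_star : forall x, f (star x) = star (f x)
}.

Record sub_cstar (D : set A) : Prop := {
  sub_cstar0 : D 0 ;
  sub_cstarD : forall x y, D x -> D y -> D (x + y) ;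
  sub_cstarZ : forall (c : R[i]) x, D x -> D (c *: x) ;
  sub_cstarM : forall x y, D x -> D y -> D (x ** y) ;
  sub_cstar_star : forall x, D x -> D (star x) ;
  sub_cstar_closed : closed D
}.

Record closed_ideal (D I : set A) : Prop := {
  closed_ideal_sub : I `<=` D ;
  closed_ideal0 : I 0 ;
  closed_idealD : forall x y, I x -> I y -> I (x + y) ;
  closed_idealZ : forall (c : R[i]) x, I x -> I (c *: x) ;
  closed_idealMl : forall d x, D d -> I x -> I (d ** x) ;
  closed_idealMr : forall x d, I x -> D d -> I (x ** d) ;
  closed_ideal_closed : closed I
}.

Definition simple (D : set A) : Prop :=
  D <> [set 0] /\ forall I, closed_ideal D I -> I = [set 0] \/ I = D.

Definition cstar_irreducible (C : set A) : Prop :=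
  [/\ sub_cstar C, C 1 &
      forall D, sub_cstar D -> C `<=` D -> simple D].

End CStarTheory.

Section Ell2.
Variables (R : realType) (G : groupType) (V : normedModType R[i]).

(* The norm of l^2(G, V), which is +oo on the families outside l^2(G, V). *)
Definition l2norm (xi : G -> V) : \bar R :=
  sqrte (\esum_(s in [set: G]) (rnorm (xi s) ^+ 2)%:E)%E.

Definition l2opnorm (T : (G -> V) -> (G -> V)) : \bar R :=
  ereal_sup [set l2norm (T xi) | xi in [set xi | (l2norm xi <= 1)%E]].

Definition left_translation (t : G) (xi : G -> V) : G -> V :=
  fun s => xi (t^-1 * s)%g.

End Ell2.

Record unitary_rep (R : realType) (G : groupType) (A : cstarType R)
    (u : G -> A) : Prop := {
  unitary_rep1 : u 1%g = 1 ;
  unitary_repM : forall s t, u (s * t)%g = u s ** u t ;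
  unitary_repV : forall t, u (t^-1)%g = star (u t)
}.

Section ReducedGroupAlgebra.
Variables (R : realType) (G : groupType).

(* (L, lam) is the completion of the group algebra of G in the norm of its left
   regular representation on l^2(G); the finitely supported functions are given
   by a function c and a finite set F containing its support. *)
Record reduced_group_algebra (L : cstarType R) (lam : G -> L) : Prop := {
  rga_unitary : unitary_rep lam ;
  rga_norm : forall (F : {fset G}) (c : G -> R[i]),
    (rnorm (\sum_(t <- F) c t *: lam t))%:E =
    l2opnorm (fun (xi : G -> R[i]^o) s =>
                \sum_(t <- F) c t *: left_translation t xi s) ;
  rga_dense : closure [set x | exists (F : {fset G}) (c : G -> R[i]),
                         x = \sum_(t <- F) c t *: lam t] = [set: L]
}.

Definition cstar_simple : Prop :=
  exists (L : cstarType R) (lam : G -> L),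
    reduced_group_algebra lam /\ simple [set: L].

End ReducedGroupAlgebra.

Section CrossedProduct.
Variables (R : realType) (G : groupType) (B A : cstarType R).

Record action (alpha : G -> B -> B) : Prop := {
  action_star_hom : forall t, star_hom (alpha t) ;
  action1 : forall b, alpha 1%g b = b ;
  actionM : forall s t b, alpha (s * t)%g b = alpha s (alpha t b)
}.

Record faithful_rep (H : hilbertType R) (pi : B -> H -> H) : Prop := {
  rep_linear : forall b, linear (pi b) ;
  rep_continuous : forall b, continuous (pi b) ;
  repP : forall (c : R[i]) a b x, pi (c *: a + b) x = c *: pi a x + pi b x ;
  repM : forall a b x, pi (a ** b) x = pi a (pi b x) ;
  rep1 : forall x, pi 1 x = x ;
  rep_star : forall b x y, dot (pi (star b) x) y = dot x (pi b y) ;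
  rep_faithful : forall b, (forall x, pi b x = 0) -> b = 0
}.

(* The representation of B on l^2(G, H) which, with left_translation, is the
   regular covariant representation attached to pi. *)
Definition induced_rep (alpha : G -> B -> B) (H : hilbertType R)
    (pi : B -> H -> H) (b : B) (xi : G -> H) : G -> H :=
  fun s => pi (alpha (s^-1)%g b) (xi s).

(* (A, iota, u) is the completion of C_c(G, B) in the norm of the regular
   representation on l^2(G, H), for a faithful representation of B on a
   Hilbert space H; this norm does not depend on the choice of the latter. *)
Record reduced_crossed_product (alpha : G -> B -> B)
    (iota : B -> A) (u : G -> A) : Prop := {
  rcp_iota : star_hom iota ;
  rcp_unitary : unitary_rep u ;
  rcp_covariant : forall t b, iota (alpha t b) = u t ** iota b ** star (u t) ;
  rcp_norm : exists (H : hilbertType R) (pi : B -> H -> H),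
    faithful_rep pi /\
    forall (F : {fset G}) (f : G -> B),
      (rnorm (\sum_(t <- F) iota (f t) ** u t))%:E =
      l2opnorm (fun (xi : G -> H) s =>
        \sum_(t <- F) induced_rep alpha pi (f t) (left_translation t xi) s) ;
  rcp_dense : closure [set x | exists (F : {fset G}) (f : G -> B),
                         x = \sum_(t <- F) iota (f t) ** u t] = [set: A]
}.

(* Hence alpha t^-1 a is the element u_t^* a u_t of B. *)
Lemma rcp_conj alpha iota u (AP : reduced_crossed_product alpha iota u) t a :
  iota (alpha (t^-1)%g a) = star (u t) ** iota a ** u t.
Proof.
by rewrite (rcp_covariant AP) (unitary_repV (rcp_unitary AP)) starK.
Qed.

Definition group_subalgebra (u : G -> A) : set A :=
  smallest (@sub_cstar R A) (range u).

End CrossedProduct.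

(* The discrete group G with the sigma-algebra of all its subsets. *)
Definition discr (G : groupType) : Type := G.

HB.instance Definition _ (G : groupType) := Choice.on (discr G).
HB.instance Definition _ (G : groupType) := isPointed.Build (discr G) (1%g : G).
HB.instance Definition _ (G : groupType) :=
  @isMeasurable.Build default_measure_display (discr G)
    discrete_measurable discrete_measurable0
    discrete_measurableC discrete_measurableU.

Section Stationary.
Variables (R : realType) (G : groupType) (B : cstarType R).

Definition act_functional (alpha : G -> B -> B) (t : G) (phi : B -> R[i]) :
    B -> R[i] :=
  fun a => phi (alpha (t^-1)%g a).

(* The sum over G converges unconditionally: the limit is taken along the
   finite subsets of G ordered by inclusion. *)
Definition stationary (alpha : G -> B -> B) (mu : probability (discr G) R)
    (phi : B -> R[i]) : Prop :=
  forall a,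
    summability.partial_sum
      (fun t : G => (fine (mu [set t]))%:C * act_functional alpha t phi a
                    : R[i]^o)
      @ summability.totally --> (phi a : R[i]^o).

Definition group_faithful (alpha : G -> B -> B) (phi : B -> R[i]) : Prop :=
  forall a, cpos a ->
    (forall t, act_functional alpha t phi a = 0) -> a = 0.

End Stationary.

(* Main.v *)
(* C*-simplicity enters through Powers' averaging property.  A minimal invariant
   sublinear functional on the bounded functions on G plays the role of the
   Furstenberg boundary: its extreme means form a space Y on which simplicity of
   C*_lambda(G), via the weak containment of l^2 of an orbit in l^2(G), forces any
   finitely many t <> 1 to move a common point, and an extreme mean has variance
   0 under each mean on Y representing it.  Hence convex combinations of the
   u_s u_t u_s^* are small for t <> 1.

   (ii) => (i): let I be a nonzero ideal of an intermediate algebra, and E the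
   faithful conditional expectation onto B.  By (ii), conjugates of a positive
   element of I sum to some x with E x >= 1; averaging x by Powers kills its
   coefficients off the unit, up to a small norm, so I contains an invertible
   element.

   (i) => (ii): let N be the left ideal of the x such that x^* x is at most a sum
   of conjugates of a, up to every epsilon > 0.  Then N^* /\ N is an ideal of its
   idealizer, an intermediate algebra, and so contains 1 as this algebra is simple.

   (ii) <=> (iii) is a minimax argument over the vector states.  For (iii) => (iv)
   take mu of full support; for (iv) => (iii) average the orbit of a state by a
   mu-stationary mean on G. *)

Require Import Defs.
From HB Require Import structures.
From mathcomp Require Import all_boot all_order all_algebra.
From mathcomp Require Import finmap complex.
From mathcomp Require Import all_classical all_reals all_analysis.
From mathcomp Require Import ring lra.
From mathcomp.analysis.showcase Require summability.

Set Implicit Arguments.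
Unset Strict Implicit.
Unset Printing Implicit Defensive.
Import Order.TTheory GRing.Theory Num.Theory.
Import numFieldNormedType.Exports.

Local Open Scope classical_set_scope.
Local Open Scope ring_scope.

(** Compactness is replaced by Hahn-Banach throughout. A compact convex set of means is represented
    by its support functional, so that extreme points and minimal invariant sets both come from
    Zorn's lemma for the pointwise order, and a passage to a limit of states becomes the
    construction of a mean that is nonnegative on a cone; [minimax] is the dual form of this.
    Likewise a state of an algebra acting on l^2(Y) is a mean on the unit vectors of finite support,
    so that l^2(Y) is never completed. A common moved point exists because the stabilizer of a mean
    is amenable: l^2 of its orbit then carries a representation of C*_lambda(G), faithful by
    simplicity, whose vector states control the trace of C*_lambda(G). If some t <> 1 fixed an open
    set pointwise, translating such a state into this set would turn its value at t into 1. The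
    definition of positivity as a = x^* x gives neither sums nor limits directly. It is replaced by
    a condition on norms, and the two are shown to agree by means of square roots alone, without
    spectra. *)

Local Notation "x ** y" := (cmul x y).
Local Notation "1c" := (1%cstar).

(* A decision procedure for identities in abelian groups: [zmod] reifies both
   sides and compares the integer coefficients of the atoms. *)
Inductive zexp := ZVar of nat | ZAdd of zexp & zexp | ZOpp of zexp | ZZero.

Fixpoint zeval (V : zmodType) (env : seq V) (e : zexp) : V :=
  match e with
  | ZVar n => nth 0 env n
  | ZAdd a b => zeval env a + zeval env b
  | ZOpp a => - zeval env a
  | ZZero => 0
  end.

Fixpoint zcoef (e : zexp) (k : nat) : int :=
  match e with
  | ZVar n => (n == k)%:R
  | ZAdd a b => zcoef a k + zcoef b k
  | ZOpp a => - zcoef a k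
  | ZZero => 0
  end.

Lemma zevalE (V : zmodType) (env : seq V) (e : zexp) :
  zeval env e = \sum_(k < size env) nth 0 env k *~ zcoef e k.
Proof.
elim: e => [n|a IHa b IHb|a IHa|] /=.
- have [ns|sn] := ltnP n (size env); last first.
    rewrite nth_default// big1// => k _; case: eqP => // nk.
    by have := ltn_ord k; rewrite -nk ltnNge sn.
  rewrite (bigD1 (Ordinal ns))//= eqxx big1 ?addr0// => k.
  by rewrite -val_eqE/= eq_sym => /negPf->.
- by rewrite IHa IHb -big_split; apply: eq_bigr => k _; rewrite mulrzDr.
- by rewrite IHa -sumrN; apply: eq_bigr => k _; rewrite mulrNz.
- by rewrite big1.
Qed.

Lemma zmod_eq (V : zmodType) (env : seq V) (e f : zexp) :
  all (fun k => zcoef e k == zcoef f k) (iota 0 (size env)) ->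
  zeval env e = zeval env f.
Proof.
move=> /allP H; rewrite !zevalE; apply: eq_bigr => k _.
by rewrite (eqP (H _ _))// mem_iota ltn_ord.
Qed.

Ltac zmod_mem x env :=
  lazymatch env with
  | nil => constr:(false)
  | x :: _ => constr:(true)
  | _ :: ?t => zmod_mem x t
  end.

Ltac zmod_atoms env e :=
  lazymatch e with
  | (?a + ?b)%R => let env := zmod_atoms env a in zmod_atoms env b
  | (- ?a)%R => zmod_atoms env a
  | 0%R => env
  | _ => lazymatch zmod_mem e env with
         | true => env
         | false => constr:(e :: env)
         end
  end.

Ltac zmod_index x env :=
  lazymatch env with
  | x :: _ => constr:(0%N)
  | _ :: ?t => let n := zmod_index x t in constr:(S n)
  end.

Ltac zmod_reify env e :=
  lazymatch e with
  | (?a + ?b)%R =>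
      let a := zmod_reify env a in let b := zmod_reify env b in
      constr:(ZAdd a b)
  | (- ?a)%R => let a := zmod_reify env a in constr:(ZOpp a)
  | 0%R => constr:(ZZero)
  | _ => let n := zmod_index e env in constr:(ZVar n)
  end.

Ltac zmod :=
  lazymatch goal with
  | |- ?l = ?r :> ?V =>
      let env := zmod_atoms (@nil V) l in
      let env := zmod_atoms env r in
      let e := zmod_reify env l in
      let f := zmod_reify env r in
      exact: (@zmod_eq _ env e f isT)
  end.

(** * Means on bounded functions *)

Section Means.
Variables (R : realType) (S : Type).
Implicit Types (f g h : S -> R) (p q w : (S -> R) -> R) (K : set (S -> R)).

Definition bnd f := exists M : R, forall s, `|f s| <= M.

Lemma bnd_cst c : bnd (fun=> c). Proof. by exists `|c|. Qed.

Lemma bndD f g : bnd f -> bnd g -> bnd (fun s => f s + g s).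
Proof.
move=> [M fM] [N gN]; exists (M + N) => s.
by rewrite (le_trans (ler_normD _ _))// lerD.
Qed.

Lemma bndN f : bnd f -> bnd (fun s => - f s).
Proof. by move=> [M fM]; exists M => s; rewrite normrN. Qed.

Lemma bndB f g : bnd f -> bnd g -> bnd (fun s => f s - g s).
Proof. by move=> bf bg; apply: bndD => //; exact: bndN. Qed.

Lemma bndM f g : bnd f -> bnd g -> bnd (fun s => f s * g s).
Proof.
move=> [M fM] [N gN]; exists (M * N) => s.
by rewrite normrM ler_pM.
Qed.

Lemma bndZ c f : bnd f -> bnd (fun s => c * f s).
Proof. by move=> bf; apply: bndM => //; exact: bnd_cst. Qed.

Lemma bnd_sum (I : Type) (r : seq I) (F : I -> S -> R) :
  (forall i, bnd (F i)) -> bnd (fun s => \sum_(i <- r) F i s).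
Proof.
move=> bF; elim: r => [|i r IH].
  by under eq_fun do rewrite big_nil; exact: bnd_cst.
by under eq_fun do rewrite big_cons; exact: bndD.
Qed.

(** By Hahn-Banach such a [p] is the support functional of the convex set of means that it
    dominates. Nothing is required on unbounded functions, so functionals are only compared on
    bounded ones. *)
Record sublin p : Prop := {
  sublinD : forall f g, bnd f -> bnd g -> p (fun s => f s + g s) <= p f + p g ;
  sublinZ : forall c f, 0 <= c -> bnd f -> p (fun s => c * f s) = c * p f ;
  sublin_le : forall f c, bnd f -> (forall s, f s <= c) -> p f <= c }.

Record mean w : Prop := {
  mean_sublin :> sublin w ;
  meanN : forall f, bnd f -> w (fun s => - f s) = - w f }.

Definition dominated p q := forall f, bnd f -> p f <= q f.

Section Sublinear.
Variables (p : (S -> R) -> R) (ps : sublin p).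

Lemma sublin_ge f c : bnd f -> (forall s, c <= f s) -> c <= p f.
Proof.
move=> bf cf.
have p0 : p (fun=> 0) = 0.
  have := sublinZ ps (lexx 0) bf; rewrite mul0r => {2}<-.
  by congr p; apply/funext => s; rewrite mul0r.
have := sublinD ps bf (bndN bf).
have -> : (fun s => f s - f s) = fun=> 0.
  by apply/funext => s; rewrite subrr.
have := sublin_le ps (c := - c) (bndN bf) _.
move=> /(_ (fun s => _)); rewrite p0.
have H s : - f s <= - c by rewrite lerN2.
by move=> /(_ H) ? ?; lra.
Qed.

Lemma sublin_cst c : p (fun=> c) = c.
Proof.
apply/eqP; rewrite eq_le; apply/andP; split.
  by apply: (sublin_le ps) => //; exact: bnd_cst.
by apply: sublin_ge => //; exact: bnd_cst.
Qed.

Lemma sublinN f : bnd f -> - p f <= p (fun s => - f s).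
Proof.
move=> bf; have := sublinD ps bf (bndN bf).
have -> : (fun s => f s - f s) = fun=> 0.
  by apply/funext => s; rewrite subrr.
by rewrite sublin_cst => ?; lra.
Qed.

Lemma sublin_mono f g : bnd f -> bnd g -> (forall s, f s <= g s) -> p f <= p g.
Proof.
move=> bf bg fg.
have -> : f = fun s => g s + (f s - g s).
  by apply/funext => s; rewrite addrC subrK.
apply: (le_trans (sublinD ps bg (bndB bf bg))).
rewrite gerDl; apply: (sublin_le ps); first exact: bndB.
by move=> s; rewrite subr_le0.
Qed.

Lemma sublinDcst f c : bnd f -> p (fun s => f s + c) = p f + c.
Proof.
move=> bf; apply/eqP; rewrite eq_le; apply/andP; split.
  have := sublinD ps bf (bnd_cst c).
  by rewrite sublin_cst.
have := sublinD ps (bndD bf (bnd_cst c)) (bnd_cst (- c)).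
rewrite sublin_cst.
have -> : (fun s => f s + c + - c) = f by apply/funext => s; rewrite addrK.
by move=> ?; lra.
Qed.

End Sublinear.

Section MeanTheory.
Variables (w : (S -> R) -> R) (wm : mean w).

Lemma meanD f g : bnd f -> bnd g -> w (fun s => f s + g s) = w f + w g.
Proof.
move=> bf bg; apply/eqP; rewrite eq_le (sublinD wm)//=.
have := sublinD wm (bndN bf) (bndN bg).
have -> : (fun s => - f s - g s) = (fun s => - (f s + g s)).
  by apply/funext => s; rewrite opprD.
rewrite !(meanN wm)//; last exact: bndD.
by move=> ?; lra.
Qed.

Lemma meanB f g : bnd f -> bnd g -> w (fun s => f s - g s) = w f - w g.
Proof.
move=> bf bg; rewrite meanD ?(meanN wm)//.
exact: bndN.
Qed.

Lemma meanZ c f : bnd f -> w (fun s => c * f s) = c * w f.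
Proof.
move=> bf; have [c0|c0] := leP 0 c; first exact: (sublinZ wm).
have -> : (fun s => c * f s) = (fun s => - (- c * f s)).
  by apply/funext => s; rewrite mulNr opprK.
rewrite (meanN wm); last exact: bndZ.
by rewrite (sublinZ wm)// ?mulNr ?opprK// oppr_ge0 ltW.
Qed.

Lemma mean_cst c : w (fun=> c) = c. Proof. exact: (sublin_cst wm). Qed.

Lemma mean_sum (I : Type) (r : seq I) (F : I -> S -> R) :
  (forall i, bnd (F i)) ->
  w (fun s => \sum_(i <- r) F i s) = \sum_(i <- r) w (F i).
Proof.
move=> bF; elim: r => [|i r IH].
  by under eq_fun do rewrite big_nil; rewrite big_nil mean_cst.
under eq_fun do rewrite big_cons.
by rewrite big_cons meanD ?IH//; exact: bnd_sum.
Qed.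

End MeanTheory.

Definition chain_inf (C : set ((S -> R) -> R)) f := inf [set p f | p in C].

Lemma chain_inf_lb (C : set ((S -> R) -> R)) p f : C `<=` sublin -> C p ->
  bnd f -> chain_inf C f <= p f.
Proof.
move=> Csub Cp bf; have [M fM] := bf.
apply: ge_inf; last by exists p.
exists (- M) => _ [q Cq <-]; apply: sublin_ge => //; first exact: Csub.
by move=> s; have := fM s; rewrite ler_norml => /andP[].
Qed.

Lemma chain_inf_lt (C : set ((S -> R) -> R)) f e : C `<=` sublin -> C !=set0 ->
  bnd f -> 0 < e -> exists2 p, C p & p f < chain_inf C f + e.
Proof.
move=> Csub [p0 Cp0] [M fM] e0.
have hi : has_inf [set p f | p in C].
  split; first by exists (p0 f), p0.
  exists (- M) => _ [q Cq <-]; apply: sublin_ge; first exact: Csub.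
    by exists M.
  by move=> s; have := fM s; rewrite ler_norml => /andP[].
by have [_ [p Cp <-] pe] := inf_adherent e0 hi; exists p.
Qed.

Lemma chain_inf_ge (C : set ((S -> R) -> R)) f c : C !=set0 ->
  (forall p, C p -> c <= p f) -> c <= chain_inf C f.
Proof.
move=> [p0 Cp0] cC; apply: lb_le_inf; first by exists (p0 f), p0.
by move=> _ [q Cq <-]; exact: cC.
Qed.

Lemma sublin_chain_inf (C : set ((S -> R) -> R)) : C `<=` sublin -> C !=set0 ->
  (forall p q, C p -> C q -> dominated p q \/ dominated q p) ->
  sublin (chain_inf C).
Proof.
move=> Csub C0 Ctot; have [p0 Cp0] := C0; split.
- move=> f g bf bg; apply/ler_addgt0Pl => e e0.
  have [p Cp pe] := chain_inf_lt Csub C0 bf (divr_gt0 e0 (ltr0n _ 2)).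
  have [q Cq qe] := chain_inf_lt Csub C0 bg (divr_gt0 e0 (ltr0n _ 2)).
  have bfg := bndD bf bg.
  wlog pq : f g p q bf bg bfg Cp Cq pe qe / dominated p q.
    move=> W; have [pq|qp] := Ctot _ _ Cp Cq; first exact: (W f g p q).
    have := W g f q p bg bf (bndD bg bf) Cq Cp qe pe qp.
    rewrite [chain_inf C g + _]addrC.
    by under eq_fun do rewrite addrC.
  have := chain_inf_lb Csub Cp bfg.
  have := sublinD (Csub _ Cp) bf bg.
  have := pq _ bg => ? ? ?; lra.
- move=> c f; rewrite le_eqVlt => /predU1P[<- bf|c0 bf].
    rewrite mul0r; under eq_fun do rewrite mul0r.
    apply/eqP; rewrite eq_le; apply/andP; split.
      have := chain_inf_lb Csub Cp0 (bnd_cst 0).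
      by rewrite (sublin_cst (Csub _ Cp0)).
    by apply: chain_inf_ge => // p Cp; rewrite (sublin_cst (Csub _ Cp)).
  apply/eqP; rewrite eq_le; apply/andP; split.
    rewrite -ler_pdivrMl//; apply: chain_inf_ge => // p Cp.
    rewrite ler_pdivrMl// -(sublinZ (Csub _ Cp))//; last exact: ltW.
    by apply: chain_inf_lb => //; exact: bndZ.
  apply: chain_inf_ge => // p Cp.
  rewrite (sublinZ (Csub _ Cp))//; last exact: ltW.
  by rewrite ler_pM2l//; exact: chain_inf_lb.
- move=> f c bf fc; apply: (le_trans (chain_inf_lb Csub Cp0 bf)).
  by apply: sublin_le => //; exact: Csub.
Qed.

(** Zorn's lemma for the pointwise order. The class C has to be stable under the infima of its
    subsets only where these are sublinear, which holds for chains. *)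
Lemma min_sublin (C : set ((S -> R) -> R)) p0 : C `<=` sublin -> C p0 ->
  (forall A : set ((S -> R) -> R), A `<=` C -> A !=set0 ->
    sublin (chain_inf A) -> C (chain_inf A)) ->
  exists q, [/\ C q, dominated q p0 &
    forall r, C r -> dominated r q -> dominated q r].
Proof.
move=> Csub Cp0 Cinf.
pose T := {q | C q /\ dominated q p0}.
have t0 : T by exists p0; split.
(* The order is reversed, since Zorn's lemma yields maximal elements. *)
pose le (a b : T) := `[< dominated (sval b) (sval a) >].
have [| | |t tmax] := ZL_preorder t0 (R := le).
- by move=> t; apply/asboolP => f.
- move=> r s t /asboolP rs /asboolP st; apply/asboolP => f bf.
  exact: le_trans (st _ bf) (rs _ bf).
- move=> A Atot; have [->|/set0P A0] := eqVneq A set0; first by exists t0.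
  pose A' := [set sval t | t in A].
  have A'C : A' `<=` C by move=> _ [[a [Ca ap]] At <-].
  have A'0 : A' !=set0 by have [a Aa] := A0; exists (sval a), a.
  have A's : A' `<=` sublin by move=> a /A'C/Csub.
  have A't p q : A' p -> A' q -> dominated p q \/ dominated q p.
    move=> [a Aa <-] [b Ab <-].
    by have [/asboolP|/asboolP] := Atot a b Aa Ab; [right|left].
  have Ci := Cinf _ A'C A'0 (sublin_chain_inf A's A'0 A't).
  have ip0 : dominated (chain_inf A') p0.
    have [_ [a Aa _]] := A'0 => f bf; have [_ ap] := svalP a.
    apply: le_trans (ap _ bf); apply: chain_inf_lb => //; by exists a.
  exists (exist _ (chain_inf A') (conj Ci ip0)) => a Aa.
  apply/asboolP => f bf; apply: chain_inf_lb => //; by exists a.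
- have [Ct tp] := svalP t; exists (sval t); split => // r Cr rt.
  have rp : dominated r p0 by move=> f bf; exact: le_trans (rt _ bf) (tp _ bf).
  have := tmax (exist _ r (conj Cr rp)) => /(_ _)/asboolP; apply.
  exact/asboolP.
Qed.

(** The support functional of the means dominated by [p] and nonnegative on the cone [K]: for such a
    mean w one has w h <= w (h + k) <= p (h + k). *)
Definition cone_inf p K h := inf [set p (fun s => h s + k s) | k in K].

Definition is_cone K := [/\ K `<=` bnd, K (fun=> 0),
  forall f g, K f -> K g -> K (fun s => f s + g s) &
  forall c f, 0 <= c -> K f -> K (fun s => c * f s)].

Section ConeInf.
Variables (p : (S -> R) -> R) (K : set (S -> R)).
Hypotheses (ps : sublin p) (Kcone : is_cone K) (pK : forall k, K k -> 0 <= p k).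

Let Kb k : K k -> bnd k. Proof. by move: k; case: Kcone. Qed.

Lemma cone_inf_has h : bnd h -> has_inf [set p (fun s => h s + k s) | k in K].
Proof.
move=> bh; have [_ K0 _ _] := Kcone; split.
  by exists (p (fun s => h s + 0)), (fun=> 0).
exists (- p (fun s => - h s)) => _ [k Kk <-].
have := sublinD ps (bndD bh (Kb Kk)) (bndN bh).
have -> : (fun s => h s + k s - h s) = k.
  by apply/funext => s; rewrite addrC addKr.
have := pK Kk => ? ?; lra.
Qed.

Lemma cone_inf_lb h k : bnd h -> K k -> cone_inf p K h <= p (fun s => h s + k s).
Proof. by move=> bh Kk; apply: ge_inf; [case: (cone_inf_has bh)|exists k]. Qed.

Lemma cone_inf_le h : bnd h -> cone_inf p K h <= p h.
Proof.
move=> bh; have [_ K0 _ _] := Kcone; have := cone_inf_lb bh K0.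
by under eq_fun do rewrite addr0.
Qed.

Lemma cone_inf_N k : K k -> cone_inf p K (fun s => - k s) <= 0.
Proof.
move=> Kk; have := cone_inf_lb (bndN (Kb Kk)) Kk.
have -> : (fun s => - k s + k s) = fun=> 0.
  by apply/funext => s; rewrite addNr.
by rewrite (sublin_cst ps).
Qed.

Lemma cone_inf_ge h c : bnd h ->
  (forall k, K k -> c <= p (fun s => h s + k s)) -> c <= cone_inf p K h.
Proof.
move=> bh cp; apply: lb_le_inf; first by case: (cone_inf_has bh).
by move=> _ [k Kk <-]; exact: cp.
Qed.

Lemma sublin_cone_inf : sublin (cone_inf p K).
Proof.
have [_ K0 KD KZ] := Kcone; split.
- move=> f g bf bg; apply/ler_addgt0Pl => e e0.
  have [_ [k Kk <-] ke] :=
    inf_adherent (divr_gt0 e0 (ltr0n _ 2)) (cone_inf_has bf).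
  have [_ [l Kl <-] le] :=
    inf_adherent (divr_gt0 e0 (ltr0n _ 2)) (cone_inf_has bg).
  have := cone_inf_lb (bndD bf bg) (KD _ _ Kk Kl).
  have := sublinD ps (bndD bf (Kb Kk)) (bndD bg (Kb Kl)).
  have -> : (fun s => f s + g s + (k s + l s)) =
      fun s => f s + k s + (g s + l s).
    by apply/funext => s; rewrite addrACA.
  rewrite -/(cone_inf p K f) in ke; rewrite -/(cone_inf p K g) in le.
  by move=> ? ?; lra.
- move=> c f; rewrite le_eqVlt => /predU1P[<- bf|c0 bf].
    rewrite mul0r; under eq_fun do rewrite mul0r.
    apply/eqP; rewrite eq_le; apply/andP; split.
      by rewrite -[leRHS](sublin_cst ps 0); apply: cone_inf_le; exact: bnd_cst.
    apply: cone_inf_ge; first exact: bnd_cst.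
    by move=> k Kk; under eq_fun do rewrite add0r; exact: pK.
  apply/eqP; rewrite eq_le; apply/andP; split.
    rewrite -ler_pdivrMl//; apply: cone_inf_ge => // k Kk.
    rewrite ler_pdivrMl//.
    have := cone_inf_lb (bndZ c bf) (KZ _ _ (ltW c0) Kk).
    have -> : (fun s => c * f s + c * k s) = fun s => c * (f s + k s).
      by apply/funext => s; rewrite mulrDr.
    by rewrite (sublinZ ps (ltW c0))//; apply: bndD => //; exact: Kb.
  apply: cone_inf_ge; first exact: bndZ.
  move=> k Kk; rewrite -ler_pdivlMl// -(sublinZ ps); last 2 first.
  - by rewrite invr_ge0 ltW.
  - by apply: bndD; [exact: bndZ|exact: Kb].
  have -> : (fun s => c^-1 * (c * f s + k s)) = fun s => f s + c^-1 * k s.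
    by apply/funext => s; rewrite mulrDr mulKf ?gt_eqF.
  by apply: cone_inf_lb => //; apply: KZ => //; rewrite invr_ge0 ltW.
- move=> f c bf fc; apply: (le_trans (cone_inf_le bf)).
  exact: sublin_le.
Qed.

End ConeInf.

Definition extreme_mean p w := [/\ mean w, dominated w p &
  forall a b, mean a -> mean b -> dominated a p -> dominated b p ->
    (forall f, bnd f -> a f + b f = 2 * w f) -> forall f, bnd f -> a f = w f].

Lemma dominated_mean_eq a b : mean a -> mean b -> dominated a b ->
  forall f, bnd f -> a f = b f.
Proof.
move=> am bm ab f bf; apply/eqP; rewrite eq_le ab//=.
by have := ab _ (bndN bf); rewrite !meanN// lerN2.
Qed.

(* A face of the set of means dominated by p is encoded by the sublinear
   functional whose dominated means form the face; a minimal one is a point. *)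
Lemma extreme_mean_exists p : sublin p -> exists w, extreme_mean p w.
Proof.
move=> ps.
pose C := [set q | [/\ sublin q, dominated q p &
  forall a b, mean a -> mean b -> dominated a p -> dominated b p ->
    (forall f, bnd f -> a f + b f <= 2 * q f) ->
    dominated a q /\ dominated b q]].
have Cp : C p by split.
have [//||q [[qs qp qface] _ qmin]] := min_sublin _ Cp; first by move=> q [].
  move=> A AC A0 infs; have As : A `<=` sublin by move=> q /AC[].
  split=> //.
    move=> f bf; have [q Aq] := A0; have [_ qp _] := AC _ Aq.
    exact: le_trans (chain_inf_lb As Aq bf) (qp _ bf).
  move=> a b am bm ap bp abi.
  suff H q : A q -> dominated a q /\ dominated b q.
    by split=> f bf; apply: chain_inf_ge => // q /H[aq bq]; [exact: aq|exact: bq].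
  move=> Aq; have [_ _] := AC _ Aq; apply=> // f bf.
  apply: (le_trans (abi _ bf)); rewrite ler_pM2l//; exact: chain_inf_lb.
have qm : mean q.
  split=> // f bf; apply/eqP; rewrite eq_le sublinN// andbT.
  (* The cone is the ray of f - q f: the means below [cone_inf q K] are those below [q] whose value
     at f is the maximum q f. They form a smaller face, and minimality bounds q (- f) by - q f. *)
  pose K := [set k | exists2 s, 0 <= s & k = (fun t => s * (f t - q f))].
  have bfq : bnd (fun t => f t - q f) by apply: bndD => //; exact: bnd_cst.
  have pKE s : 0 <= s -> q (fun t => s * (f t - q f)) = 0.
    by move=> s0; rewrite (sublinZ qs)// (sublinDcst qs)// subrr mulr0.
  have Kc : is_cone K.
    split.
    - by move=> _ [s s0 ->]; exact: bndZ.
    - by exists 0 => //; apply/funext => s; rewrite mul0r.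
    - move=> _ _ [s s0 ->] [t t0 ->]; exists (s + t); first exact: addr_ge0.
      by apply/funext => z; rewrite mulrDl.
    - move=> c _ c0 [s s0 ->]; exists (c * s); first exact: mulr_ge0.
      by apply/funext => z; rewrite mulrA.
  have qK k : K k -> 0 <= q k by move=> [s s0 ->]; rewrite pKE.
  have q's := sublin_cone_inf qs Kc qK.
  have q'q := cone_inf_le qs Kc qK.
  have q'f : cone_inf q K (fun t => - f t) <= - q f.
    have Kk : K (fun t => 1 * (f t - q f)) by exists 1.
    have := cone_inf_lb qs Kc qK (bndN bf) Kk.
    have -> : (fun t => - f t + 1 * (f t - q f)) = fun=> - q f.
      by apply/funext => t; rewrite mul1r addKr.
    by rewrite (sublin_cst qs).
  have Cq' : C (cone_inf q K).
    split=> //.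
      by move=> h bh; exact: le_trans (q'q _ bh) (qp _ bh).
    move=> a b am bm ap bp abq.
    have [aq bq] : dominated a q /\ dominated b q.
      apply: qface => // h bh; apply: (le_trans (abq _ bh)).
      by rewrite ler_pM2l// q'q.
    have abf := abq _ (bndN bf); rewrite (meanN am bf) (meanN bm bf) in abf.
    have af := aq _ bf; have bbf := bq _ bf.
    have aE : a f = q f by lra.
    have bE : b f = q f by lra.
    have key w : mean w -> dominated w q -> w f = q f ->
        dominated w (cone_inf q K).
      move=> wm wq wE h bh; apply: cone_inf_ge => // _ [s s0 ->].
      apply: le_trans (wq _ _); last by apply: bndD => //; exact: bndZ.
      rewrite meanD//; last exact: bndZ.
      by rewrite meanZ// meanB// ?mean_cst ?wE ?subrr ?mulr0 ?addr0//; exact: bnd_cst.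
    by split; exact: key.
  apply: le_trans q'f; apply: qmin => //; exact: bndN.
exists q; split=> // a b am bm ap bp abq.
apply: dominated_mean_eq => //.
have [f bf|//] := qface a b am bm ap bp.
by rewrite abq.
Qed.

(** The form in which Hahn-Banach is used: any mean below [cone_inf p K] will do, and an extreme one
    is already at hand. *)
Lemma cone_mean p K : sublin p -> is_cone K -> (forall k, K k -> 0 <= p k) ->
  exists w, [/\ mean w, dominated w p & forall k, K k -> 0 <= w k].
Proof.
move=> ps Kc pK.
have [w [wm wq _]] := extreme_mean_exists (sublin_cone_inf ps Kc pK).
exists w; split=> //.
  by move=> f bf; apply: le_trans (wq _ bf) _; exact: cone_inf_le.
move=> k Kk; have [Kb _ _ _] := Kc.
have := wq _ (bndN (Kb _ Kk)); have := cone_inf_N ps Kc pK Kk.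
by rewrite (meanN wm (Kb _ Kk)) => ? ?; lra.
Qed.

Lemma sup_has f : S -> bnd f -> has_sup (range f).
Proof.
move=> s0 [M fM]; split; first by exists (f s0), s0.
by exists M => _ [s _ <-]; rewrite (le_trans (ler_norm _)).
Qed.

Lemma sup_sublin : S -> sublin (fun f => sup (range f)).
Proof.
move=> s0.
have ub f s : bnd f -> f s <= sup (range f).
  by move=> bf; apply: ub_le_sup; [case: (sup_has s0 bf)|exists s].
have leub f c : (forall s, f s <= c) -> sup (range f) <= c.
  by move=> fc; apply: ge_sup; [exists (f s0), s0|move=> _ [s _ <-]].
split=> [f g bf bg|c f|f c _]; last exact: leub.
  by apply: leub => s; rewrite lerD// ub.
rewrite le_eqVlt => /predU1P[<- bf|c0 bf].
  rewrite mul0r; apply/eqP; rewrite eq_le leub/= => [|s]; last by rewrite mul0r.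
  have -> : (fun s => 0 * f s) = fun=> 0.
    by apply/funext => s; rewrite mul0r.
  exact: (ub _ s0 (bnd_cst 0)).
apply/eqP; rewrite eq_le leub/= => [|s]; last by rewrite ler_pM2l// ub.
rewrite -ler_pdivlMl//; apply: leub => s.
by rewrite ler_pdivlMl//; exact: (ub _ s (bndZ c bf)).
Qed.

Lemma sup_cone_mean K : S -> is_cone K ->
  (forall k e, K k -> 0 < e -> exists s, - e < k s) ->
  exists2 w, mean w & forall k, K k -> 0 <= w k.
Proof.
move=> s0 Kc Ksup; have [k Kk|w [wm _ wK]] := cone_mean (sup_sublin s0) Kc.
  rewrite leNgt; apply/negP => k0.
  have [|s] := Ksup k (- sup (range k)) Kk; first by rewrite oppr_gt0.
  rewrite opprK ltNge => /negP; apply; apply: ub_le_sup; last by exists s.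
  by have [Kb _ _ _] := Kc; case: (sup_has s0 (Kb _ Kk)).
by exists w.
Qed.

Lemma weight_ge0 (I : Type) (ws : seq (R * I)) :
  all (fun x => 0 <= x.1) ws -> 0 <= \sum_(x <- ws) x.1.
Proof.
elim: ws => [_|x ws IH /= /andP[x0 /IH ?]]; first by rewrite big_nil.
by rewrite big_cons addr_ge0.
Qed.

Lemma wsum_ge0 (I : Type) (ws : seq (R * I)) (F : I -> R) :
  all (fun x => 0 <= x.1) ws -> (forall i, 0 <= F i) ->
  0 <= \sum_(x <- ws) x.1 * F x.2.
Proof.
move=> ws0 F0; elim: ws ws0 => [_|x ws IH /= /andP[x0 /IH]].
  by rewrite big_nil.
by move=> ?; rewrite big_cons addr_ge0// mulr_ge0.
Qed.

Lemma wsum_eq0 (I : Type) (ws : seq (R * I)) (F : I -> R) :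
  all (fun x => 0 <= x.1) ws -> \sum_(x <- ws) x.1 = 0 ->
  \sum_(x <- ws) x.1 * F x.2 = 0.
Proof.
elim: ws => [_ _|x ws IH /= /andP[x0 ws0]]; first by rewrite big_nil.
have := weight_ge0 ws0.
rewrite !big_cons => W0 W; have xE : x.1 = 0 by lra.
by rewrite IH// ?xE ?mul0r ?addr0//; lra.
Qed.

(** If no positive combination of the v i is uniformly negative, then every element of the cone that
    they span has supremum at least 0, and [sup_cone_mean] gives a mean that is nonnegative on each
    v i. *)
Lemma minimax (I : Type) (v : I -> S -> R) : S -> (forall i, bnd (v i)) ->
  (forall w, mean w -> exists i, w (v i) < 0) ->
  exists ws : seq (R * I), exists2 d, 0 < d &
    [/\ all (fun x => 0 <= x.1) ws, \sum_(x <- ws) x.1 = 1 &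
      forall s, \sum_(x <- ws) x.1 * v x.2 s <= - d].
Proof.
move=> s0 bv wv.
pose comb (ws : seq (R * I)) s := \sum_(x <- ws) x.1 * v x.2 s.
pose K := [set k | exists2 ws : seq (R * I), all (fun x => 0 <= x.1) ws &
  k = comb ws].
have bcomb ws : bnd (comb ws).
  by apply: bnd_sum => x; exact: bndZ.
have Kc : is_cone K.
  split.
  - by move=> _ [ws _ ->].
  - by exists [::] => //; apply/funext => s; rewrite /comb big_nil.
  - move=> _ _ [ws ws0 ->] [vs vs0 ->]; exists (ws ++ vs).
      by rewrite all_cat ws0.
    by apply/funext => s; rewrite /comb big_cat.
  - move=> c _ c0 [ws ws0 ->]; exists [seq (c * x.1, x.2) | x <- ws].
      rewrite all_map; apply: sub_all ws0 => x /= x0; exact: mulr_ge0.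
    apply/funext => s; rewrite /comb big_map mulr_sumr.
    by apply: eq_bigr => x _; rewrite mulrA.
have [[ws [ws0 [d d0 wsd]]]|H] := pselect (exists ws : seq (R * I),
    all (fun x => 0 <= x.1) ws /\
    exists2 d, 0 < d & forall s, comb ws s <= - d).
  have W0 : 0 < \sum_(x <- ws) x.1.
    have := weight_ge0 ws0.
    rewrite le_eqVlt => /predU1P[/esym W0|//].
    have := wsd s0; rewrite /comb (wsum_eq0 (fun i => v i s0) ws0 W0).
    by rewrite oppr_ge0 leNgt d0.
  set W := \sum_(x <- ws) x.1 in W0.
  exists [seq (W^-1 * x.1, x.2) | x <- ws]; exists (W^-1 * d).
    by rewrite mulr_gt0 ?invr_gt0.
  split.
  - rewrite all_map; apply: sub_all ws0 => x /= x0.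
    by rewrite mulr_ge0// invr_ge0 ltW.
  - by rewrite big_map -mulr_sumr mulVf// gt_eqF.
  - move=> s; rewrite big_map -mulrN; under eq_bigr do rewrite -mulrA.
    by rewrite -mulr_sumr ler_pM2l ?invr_gt0//; exact: wsd.
have [k e [ws ws0 ->] e0|w wm wK] := sup_cone_mean s0 Kc.
  apply: contrapT => /forallNP Hs; apply: H; exists ws; split=> //.
  by exists e => // s; rewrite leNgt; apply/negP; exact: Hs.
have [j] := wv w wm; rewrite ltNge => /negP[]; apply: wK.
exists [:: (1, j)]; first by rewrite /= ler01.
by apply/funext => s; rewrite /comb big_seq1 mul1r.
Qed.

End Means.
Arguments bnd_cst {R S} c.

(** * Minimal invariant sublinear functionals *)

Section MeanOperations.
Variables (R : realType) (S T : Type).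

Lemma mean_intro (w : (S -> R) -> R) :
  (forall f g, bnd f -> bnd g -> w (fun s => f s + g s) = w f + w g) ->
  (forall c f, bnd f -> w (fun s => c * f s) = c * w f) ->
  (forall f c, bnd f -> (forall s, f s <= c) -> w f <= c) ->
  mean w.
Proof.
move=> wD wZ wle; split.
  by split=> [f g bf bg|c f _ bf|]; [rewrite wD|rewrite wZ|].
move=> f bf; rewrite -mulN1r -wZ//; congr w.
by apply/funext => s; rewrite mulN1r.
Qed.

Lemma mean_bnd (w : (S -> R) -> R) f M : mean w -> (forall s, `|f s| <= M) ->
  `|w f| <= M.
Proof.
move=> wm fM; have bf : bnd f by exists M.
rewrite ler_norml; apply/andP; split.
  apply: (sublin_ge wm) => // s.
  by have := fM s; rewrite ler_norml => /andP[].
by apply: (sublin_le wm) => // s; rewrite (le_trans (ler_norm _)).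
Qed.

(** A kernel that attaches a mean on S to each point of T; composition with it pushes functionals on
    T forward to S. *)
Variable k : T -> (S -> R) -> R.
Hypothesis km : forall t, mean (k t).

Lemma bnd_bind f : bnd f -> bnd (fun t => k t f).
Proof. by move=> [M fM]; exists M => t; exact: mean_bnd. Qed.

Lemma bind_le f c : bnd f -> (forall s, f s <= c) -> forall t, k t f <= c.
Proof. by move=> bf fc t; exact: (sublin_le (km t)). Qed.

Lemma sublin_bind p : sublin p -> sublin (fun f => p (fun t => k t f)).
Proof.
move=> ps; split.
- move=> f g bf bg.
  have -> : (fun t => k t (fun s => f s + g s)) = fun t => k t f + k t g.
    by apply/funext => t; rewrite (meanD (km t)).
  by apply: (sublinD ps); exact: bnd_bind.
- move=> c f c0 bf.
  have -> : (fun t => k t (fun s => c * f s)) = fun t => c * k t f.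
    by apply/funext => t; rewrite (meanZ (km t)).
  by apply: (sublinZ ps) => //; exact: bnd_bind.
- move=> f c bf fc; apply: (sublin_le ps); first exact: bnd_bind.
  exact: bind_le.
Qed.

Lemma mean_bind w : mean w -> mean (fun f => w (fun t => k t f)).
Proof.
move=> wm; split; first exact: (sublin_bind wm).
move=> f bf; rewrite -(meanN wm); last exact: bnd_bind.
by congr w; apply/funext => t; rewrite (meanN (km t)).
Qed.

End MeanOperations.

Lemma mean_eval (R : realType) (S : Type) (s : S) : mean (fun f : S -> R => f s).
Proof. by apply: mean_intro => // f c _; apply. Qed.

Lemma mean_comp (R : realType) (S T : Type) (h : T -> S) (w : (T -> R) -> R) :
  mean w -> mean (fun f => w (fun t => f (h t))).
Proof. by apply: mean_bind => t; exact: mean_eval. Qed.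

Section MinimalInvariant.
Variables (R : realType) (G : groupType).
Implicit Types (p q w z : (G -> R) -> R) (f : G -> R).

Definition translate (g : G) f : G -> R := fun s => f (g * s)%g.

Lemma bnd_translate g f : bnd f -> bnd (translate g f).
Proof. by move=> [M fM]; exists M => s; exact: fM. Qed.

Lemma translateM g h f : translate g (translate h f) = translate (h * g)%g f.
Proof. by apply/funext => s; rewrite /translate mulgA. Qed.

Lemma translate1 f : translate 1%g f = f.
Proof. by apply/funext => s; rewrite /translate mul1g. Qed.

Definition invariant p := forall g f, bnd f -> p (translate g f) = p f.

(** The means dominated by such a [p] form a minimal compact convex invariant set, that is, an
    irreducible affine action of G. *)
Definition minimal_invariant p := [/\ sublin p, invariant p &
  forall q, sublin q -> invariant q -> dominated q p -> dominated p q].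

Lemma minimal_invariant_exists : exists p, minimal_invariant p.
Proof.
pose C := [set q | sublin q /\ invariant q].
have Csup : C (fun f => sup (range f)).
  split; first exact: (sup_sublin _ 1%g).
  move=> g f bf; congr sup; apply/seteqP; split=> _ [s _ <-].
    by exists (g * s)%g.
  by exists (g^-1 * s)%g => //; rewrite /translate mulVKg.
have [q []//|A AC A0 As|p [[ps pinv] _ pmin]] := min_sublin _ Csup.
  split=> // g f bf; congr inf; apply/seteqP; split=> _ [q Aq <-].
    by exists q => //; have [_ ->] := AC _ Aq.
  by exists q => //; have [_ ->] := AC _ Aq.
by exists p; split=> // q qs qinv; exact: pmin.
Qed.

Section Transport.
Variables (p : (G -> R) -> R) (pmin : minimal_invariant p).
Variables (S : Type) (sg : G -> S -> S) (k : S -> (G -> R) -> R).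
Hypotheses (km : forall s, mean (k s)) (kp : forall s, dominated (k s) p).
Hypothesis kE : forall g s f, k (sg g s) f = k s (translate g f).

(** The support functional of the closed convex hull of the orbit of w. *)
Definition orbit_sup (w : (S -> R) -> R) (f : S -> R) :=
  sup (range (fun g => w (fun s => f (sg g s)))).

Lemma orbit_sup_sublin (w : (S -> R) -> R) : mean w -> sublin (orbit_sup w).
Proof.
move=> wm; 
pose k' (g : G) (f : S -> R) := w (fun s => f (sg g s)).
have k'm g : mean (k' g) by exact: mean_comp.
exact: (sublin_bind k'm (sup_sublin _ 1%g)).
Qed.

(* Minimality makes the orbit of w, restricted along k, dense in the means
   dominated by p, so that y lifts to a limit of translates of w. *)
Lemma transport (w : (S -> R) -> R) y : mean w -> mean y -> dominated y p ->
  exists w' : (S -> R) -> R, [/\ mean w', dominated w' (orbit_sup w) &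
    forall f, bnd f -> w' (fun s => k s f) = y f].
Proof.
move=> wm ym yp; have [ps pinv pm] := pmin.
have Qs := orbit_sup_sublin wm.
pose q f := orbit_sup w (fun s => k s f).
have qs : sublin q by exact: (sublin_bind km Qs).
have qE f : q f = sup (range (fun g => w (fun s => k s (translate g f)))).
  congr sup; apply/seteqP; split=> _ [g _ <-]; exists g => //; congr w;
    by apply/funext => s; rewrite kE.
have qinv : invariant q.
  move=> g f bf; rewrite !qE; congr sup; apply/seteqP; split=> _ [h _ <-].
    by exists (g * h)%g => //; rewrite translateM.
  by exists (g^-1 * h)%g => //; rewrite translateM mulVKg.
have qp : dominated q p.
  move=> f bf; rewrite qE; apply: ge_sup.
    by eexists; exists 1%g.
  move=> _ [g _ <-]; apply: (sublin_le wm).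
    by apply: bnd_bind => //; exact: bnd_translate.
  by move=> s; rewrite -(pinv g f bf); apply: kp; exact: bnd_translate.
have pq := pm _ qs qinv qp.
(* [K] is a linear space, so a mean that is nonnegative on it vanishes on it, which is the lifting
   condition. Minimality enters through y <= p <= q, which makes [orbit_sup w] nonnegative on
   [K]. *)
pose K := [set h : S -> R | exists2 f, bnd f & h = fun s => k s f - y f].
have bk f : bnd f -> bnd (fun s => k s f) by exact: bnd_bind.
have Kc : is_cone K.
  split.
  - by move=> _ [f bf ->]; apply: bndB; [exact: bk|exact: bnd_cst].
  - exists (fun=> 0); first exact: bnd_cst.
    by apply/funext => s; rewrite (mean_cst (km s)) (mean_cst ym) subrr.
  - move=> _ _ [f bf ->] [g bg ->]; exists (fun s => f s + g s); first exact: bndD.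
    by apply/funext => s; rewrite (meanD (km s))// (meanD ym)// addrACA opprD.
  - move=> c _ _ [f bf ->]; exists (fun s => c * f s); first exact: bndZ.
    by apply/funext => s; rewrite (meanZ (km s))// (meanZ ym)// mulrBr.
have [|w' [w'm w'Q w'K]] := cone_mean Qs Kc.
  move=> _ [f bf ->]; rewrite (sublinDcst Qs); last exact: bk.
  by rewrite subr_ge0 (le_trans (yp _ bf))//; exact: pq.
exists w'; split=> // f bf.
have wK g : bnd g -> y g <= w' (fun s => k s g).
  move=> bg; rewrite -subr_ge0 -{1}(mean_cst w'm (y g)) -(meanB w'm).
  - by apply: w'K; exists g.
  - exact: bk.
  - exact: bnd_cst.
apply/eqP; rewrite eq_le wK// andbT.
have := wK _ (bndN bf); rewrite (meanN ym)//.
have -> : (fun s => k s (fun t => - f t)) = fun s => - k s f.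
  by apply/funext => s; rewrite (meanN (km s)).
by rewrite (meanN w'm) ?lerN2//; exact: bk.
Qed.

End Transport.

(* A mean on Y that represents an extreme point y is multiplicative on the
   functions coming from z. *)
Lemma extreme_variance (Y : Type) (z : Y -> (G -> R) -> R) p y m :
  extreme_mean p y -> (forall t, mean (z t)) -> (forall t, dominated (z t) p) ->
  mean m -> (forall f, bnd f -> m (fun t => z t f) = y f) ->
  forall f, bnd f -> m (fun t => (z t f - y f) ^+ 2) = 0.
Proof.
move=> [ym yp yext] zm zp mm mz f bf.
have bz g : bnd g -> bnd (fun t => z t g) by exact: bnd_bind.
(* m reweighted by a density k and completed by y to total mass 1. The means for k and 1 - k have
   midpoint y, so extremality makes both equal to y, which says that m (k * z f) = m k * y f. *)
pose a (k : Y -> R) g := m (fun t => k t * z t g) + (1 - m k) * y g.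
have aP (k : Y -> R) : (forall t, 0 <= k t <= 1) ->
    [/\ bnd k, mean (a k) & dominated (a k) p].
  move=> k01; have bk : bnd k.
    by exists 1 => t; have /andP[k0 k1] := k01 t; rewrite ger0_norm.
  have bkz g : bnd g -> bnd (fun t => k t * z t g).
    by move=> bg; apply: bndM => //; exact: bz.
  have mk1 : m k <= 1 by apply: (sublin_le mm) => // t; case/andP: (k01 t).
  have key g c : bnd g -> (forall t, z t g <= c) -> y g <= c -> a k g <= c.
    move=> bg zc yc.
    have : m (fun t => k t * z t g) <= m (fun t => c * k t).
      apply: (sublin_mono mm); [exact: bkz|exact: bndZ|move=> t].
      by rewrite mulrC ler_wpM2r//; case/andP: (k01 t).
    rewrite (meanZ mm)// /a => H.
    have : (1 - m k) * y g <= (1 - m k) * c by rewrite ler_wpM2l// subr_ge0.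
    by move=> ?; lra.
  split=> //; last first.
    by move=> g bg; apply: key => // [t|]; [exact: zp|exact: yp].
  apply: mean_intro.
  - move=> g h bg bh; rewrite /a (meanD ym)//.
    have -> : (fun t => k t * z t (fun s => g s + h s)) =
        fun t => k t * z t g + k t * z t h.
      by apply/funext => t; rewrite (meanD (zm t))// mulrDr.
    by rewrite (meanD mm); [ring|exact: bkz|exact: bkz].
  - move=> c g bg; rewrite /a (meanZ ym)//.
    have -> : (fun t => k t * z t (fun s => c * g s)) =
        fun t => c * (k t * z t g).
      by apply/funext => t; rewrite (meanZ (zm t))//; ring.
    by rewrite (meanZ mm); [ring|exact: bkz].
  - move=> g c bg gc; apply: key => //; last exact: (sublin_le ym).
    by move=> t; exact: (sublin_le (zm t)).
have mult (k : Y -> R) : (forall t, 0 <= k t <= 1) ->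
    m (fun t => k t * z t f) = m k * y f.
  move=> k01; have k'01 t : 0 <= 1 - k t <= 1 by have := k01 t; lra.
  have [bk am ap] := aP _ k01; have [bk' am' ap'] := aP _ k'01.
  suff /(_ _ bf) : forall g, bnd g -> a k g = y g by rewrite /a => ?; lra.
  apply: (yext _ _ am am' ap ap') => g bg; rewrite /a.
  have -> : (fun t => (1 - k t) * z t g) = fun t => z t g - k t * z t g.
    by apply/funext => t; ring.
  have -> : m (fun t => 1 - k t) = 1 - m k.
    by rewrite (meanB mm) ?(mean_cst mm)//; exact: bnd_cst.
  rewrite (meanB mm) ?mz//; [ring|exact: bz|].
  by apply: bndM => //; exact: bz.
have [M fM] := bf; pose N := `|M| + 1.
have N0 : 0 < N by rewrite /N ltr_wpDl.
have zN t : - N <= z t f <= N.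
  rewrite -ler_norml; apply: mean_bnd => // s.
  rewrite (le_trans (fM s))// (le_trans (ler_norm _))//.
  by rewrite /N lerDl.
(* z f itself, rescaled to take its values in [0, 1], serves as density. *)
pose k t := (2 * N)^-1 * (z t f + N).
have N20 : 0 < 2 * N by rewrite mulr_gt0.
have k01 t : 0 <= k t <= 1.
  rewrite /k ler_pdivrMl// mulr1 mulr_ge0 ?invr_ge0 ?(ltW N20)//=.
    by have := zN t; lra.
  by have := zN t; lra.
have := mult k k01.
have bzz : bnd (fun t => z t f * z t f) by apply: bndM; exact: bz.
have -> : m k = (2 * N)^-1 * (y f + N).
  rewrite /k (meanZ mm _ (bndD (bz _ bf) (bnd_cst N))).
  by rewrite (meanD mm (bz _ bf) (bnd_cst N)) (mean_cst mm) mz.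
have -> : (fun t => k t * z t f) =
    fun t => (2 * N)^-1 * (z t f * z t f + N * z t f).
  by apply/funext => t; rewrite /k; ring.
have bNz : bnd (fun t => N * z t f) by apply: bndZ; exact: bz.
rewrite (meanZ mm _ (bndD bzz bNz)) (meanD mm bzz bNz).
rewrite (meanZ mm N (bz _ bf)) mz// => E.
have {}E : m (fun t => z t f * z t f) = y f * y f.
  have H : (2 * N)^-1 != 0 by rewrite invr_eq0 gt_eqF.
  by move: E; rewrite -mulrA => /(mulfI H) ?; lra.
have -> : (fun t => (z t f - y f) ^+ 2) =
    fun t => z t f * z t f - (2 * y f * z t f - y f * y f).
  by apply/funext => t; ring.
have b2 : bnd (fun t => 2 * y f * z t f) by apply: bndZ; exact: bz.
rewrite (meanB mm bzz (bndB b2 (bnd_cst _))) (meanB mm b2 (bnd_cst _)).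
by rewrite (mean_cst mm) (meanZ mm _ (bz _ bf)) mz// E; ring.
Qed.

End MinimalInvariant.

(** * Finitely supported functions *)

Definition fsupp (K : numDomainType) (Y : choiceType) (f : Y -> K) :=
  finite_set [set y | f y != 0].

Lemma fsupp_sub (K : numDomainType) (Y : choiceType) (f : Y -> K) (P : set Y) :
  finite_set P -> (forall y, ~ P y -> f y = 0) -> fsupp f.
Proof.
move=> fP f0; apply: sub_finite_set fP => y /= fy.
by apply: contrapT => /f0 H; rewrite H eqxx in fy.
Qed.

Lemma fsuppW (K K' : numDomainType) (Y : choiceType) (f : Y -> K) (g : Y -> K') :
  fsupp f -> (forall y, f y = 0 -> g y = 0) -> fsupp g.
Proof.
move=> ff fg; apply: (fsupp_sub ff) => y /= fy; apply: fg.
by apply/eqP; apply: contrapT => /negP.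
Qed.

Section FiniteSupport.
Variables (K : numDomainType) (Y : choiceType).
Implicit Types (f g : Y -> K) (P : set Y).

(** A function of infinite support has sum 0 by convention, whence the support conditions below. *)
Definition fsum f := \sum_(y \in [set: Y]) f y.

Lemma fsuppD f g : fsupp f -> fsupp g -> fsupp (fun y => f y + g y).
Proof.
move=> ff fg; apply: (@fsupp_sub _ _ _ ([set y | f y != 0] `|` [set y | g y != 0])).
  by rewrite finite_setU.
move=> y /not_orP[/= /negP/negPn/eqP-> /negP/negPn/eqP->]; exact: addr0.
Qed.

Lemma fsuppMr f g : fsupp f -> fsupp (fun y => g y * f y).
Proof. by move=> ff; apply: (fsuppW ff) => y ->; rewrite mulr0. Qed.

Lemma fsupp0 : fsupp (fun _ : Y => 0 : K).
Proof. exact: (@fsupp_sub _ _ _ set0). Qed.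

Lemma fsupp_sum (I : Type) (r : seq I) (F : I -> Y -> K) :
  (forall i, fsupp (F i)) -> fsupp (fun y => \sum_(i <- r) F i y).
Proof.
move=> fF; elim: r => [|i r IH].
  by under eq_fun do rewrite big_nil; exact: fsupp0.
by under eq_fun do rewrite big_cons; exact: fsuppD.
Qed.

Lemma fsupp_comp (Z : choiceType) (h : Z -> Y) f :
  injective h -> fsupp f -> finite_set [set z | f (h z) != 0].
Proof.
move=> hi ff; apply: (finite_preimage (f := h) (B := [set y | f y != 0])) => //.
by move=> x y _ _; exact: hi.
Qed.

Lemma fsumE f P : finite_set P -> (forall y, ~ P y -> f y = 0) ->
  fsum f = \sum_(y \in P) f y.
Proof. by move=> _ f0; apply/esym/fsbig_widen => // y [_ /f0]. Qed.

Lemma eq_fsum f g : (forall y, f y = g y) -> fsum f = fsum g.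
Proof. by move=> fg; congr fsum; apply/funext. Qed.

Lemma fsumD f g : fsupp f -> fsupp g ->
  fsum (fun y => f y + g y) = fsum f + fsum g.
Proof.
move=> ff fg; pose P := [set y | f y != 0] `|` [set y | g y != 0].
have fP : finite_set P by rewrite finite_setU.
have H y : ~ P y -> f y = 0 /\ g y = 0.
  by move=> /not_orP[/= /negP/negPn/eqP-> /negP/negPn/eqP->].
rewrite !(fsumE fP); last 3 first.
- by move=> y /H[].
- by move=> y /H[].
- by move=> y /H[-> ->]; rewrite addr0.
exact: fsbig_split.
Qed.

Lemma fsumZ c f : fsum (fun y => c * f y) = c * fsum f.
Proof. by rewrite /fsum -mulr_fsumr. Qed.

Lemma fsumN f : fsum (fun y => - f y) = - fsum f.
Proof. by rewrite -mulN1r -fsumZ; apply: eq_fsum => y; rewrite mulN1r. Qed.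

Lemma fsumB f g : fsupp f -> fsupp g ->
  fsum (fun y => f y - g y) = fsum f - fsum g.
Proof.
move=> ff fg; rewrite fsumD ?fsumN//.
by apply: (fsuppW fg) => y ->; rewrite oppr0.
Qed.

Lemma fsum0 : fsum (fun=> 0) = 0. Proof. exact: fsbig1. Qed.

Lemma fsum_sum (I : Type) (r : seq I) (F : I -> Y -> K) :
  (forall i, fsupp (F i)) ->
  fsum (fun y => \sum_(i <- r) F i y) = \sum_(i <- r) fsum (F i).
Proof.
move=> fF; elim: r => [|i r IH].
  by rewrite big_nil (eq_fsum (g := fun=> 0)) ?fsum0// => y; rewrite big_nil.
rewrite big_cons -IH -fsumD//; last exact: fsupp_sum.
by apply: eq_fsum => y; rewrite big_cons.
Qed.

Lemma fsum_ge0 f : (forall y, 0 <= f y) -> 0 <= fsum f.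
Proof. by move=> f0; apply: fsumr_ge0. Qed.

Lemma fsum_le f g : fsupp f -> fsupp g -> (forall y, f y <= g y) ->
  fsum f <= fsum g.
Proof.
move=> ff fg fgle; rewrite -subr_ge0 -fsumB//.
by apply: fsum_ge0 => y; rewrite subr_ge0.
Qed.

Lemma fsum_delta f y0 : (forall y, y != y0 -> f y = 0) -> fsum f = f y0.
Proof.
move=> f0; rewrite (@fsumE _ [set y0])// ?fsbig_set1// => y /= /eqP.
exact: f0.
Qed.

Lemma le_fsum f y0 : fsupp f -> (forall y, 0 <= f y) -> f y0 <= fsum f.
Proof.
move=> ff f0; pose g y := if y == y0 then f y else 0.
have -> : f y0 = fsum g.
  by rewrite (fsum_delta (y0 := y0)) /g ?eqxx// => y /negPf->.
apply: fsum_le => // [|y]; last by rewrite /g; case: ifP.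
by apply: (fsuppW ff) => y; rewrite /g => ->; case: ifP.
Qed.

Lemma fsum_seq f (s : seq Y) : uniq s -> (forall y, y \notin s -> f y = 0) ->
  fsum f = \sum_(y <- s) f y.
Proof.
move=> us f0; rewrite (@fsumE _ [set` s])//; last by move=> y /= /negP; exact: f0.
by rewrite -fsbig_seq.
Qed.

End FiniteSupport.

Lemma fsum_reindex (K : numDomainType) (Y Z : choiceType) (h : Z -> Y)
  (f : Y -> K) : bijective h -> fsum f = fsum (fun z => f (h z)).
Proof. exact: reindex_fsbigT. Qed.

Lemma fsum_exchange (K : numDomainType) (Y Z : choiceType) (F : Y -> Z -> K)
  (P : set Y) (Q : set Z) : finite_set P -> finite_set Q ->
  (forall y z, ~ (P y /\ Q z) -> F y z = 0) ->
  fsum (fun y => fsum (F y)) = fsum (fun z => fsum (F^~ z)).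
Proof.
move=> fP fQ F0.
rewrite (fsumE fP) => [|y Py]; last first.
  by rewrite (eq_fsum (g := fun=> 0)) ?fsum0// => z; apply: F0 => -[].
rewrite (fsumE fQ) => [|z Qz]; last first.
  by rewrite (eq_fsum (g := fun=> 0)) ?fsum0// => y; apply: F0 => -[].
transitivity (\sum_(y \in P) \sum_(z \in Q) F y z).
  by apply: eq_fsbigr => y _; rewrite (fsumE fQ)// => z Qz; apply: F0 => -[].
rewrite exchange_fsbig//; apply: eq_fsbigr => z _.
by rewrite (fsumE fP)// => y Py; apply: F0 => -[].
Qed.

(** * Unit vectors of l^2(Y) and their matrix coefficients *)

Section Sphere.
Variables (R : realType) (G : groupType) (Y : choiceType) (a : G -> Y -> Y).

Record gact : Prop := {
  gact1 : forall y, a 1%g y = y ;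
  gactM : forall g h y, a (g * h)%g y = a g (a h y) }.

Hypothesis aP : gact.

Lemma gactK g : cancel (a g) (a g^-1).
Proof. by move=> y; rewrite -(gactM aP) mulVg (gact1 aP). Qed.

Lemma gactKV g : cancel (a g^-1) (a g).
Proof. by move=> y; rewrite -(gactM aP) mulgV (gact1 aP). Qed.

Lemma gact_bij g : bijective (a g).
Proof. by exists (a g^-1); [exact: gactK|exact: gactKV]. Qed.

Lemma fsupp_act (K : numDomainType) g (f : Y -> K) :
  fsupp f -> fsupp (fun y => f (a g y)).
Proof. exact: (fsupp_comp (bij_inj (gact_bij g))). Qed.

Lemma fsum_act (K : numDomainType) g (f : Y -> K) :
  fsum (fun y => f (a g y)) = fsum f.
Proof. by rewrite -(fsum_reindex f (gact_bij g)). Qed.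

(** Real vectors suffice: a form with real coefficients takes on a complex vector the sum of its
    values on the real and imaginary parts, see [rip_complexify]. *)
Definition sphere := {xi : Y -> R | fsupp xi /\ fsum (fun y => xi y ^+ 2) = 1}.

Definition vec (xi : sphere) : Y -> R := sval xi.

Lemma vec_supp xi : fsupp (vec xi). Proof. by case: (svalP xi). Qed.

Lemma vec_sq_supp (xi : sphere) : fsupp (fun y => vec xi y ^+ 2).
Proof. by apply: fsuppW (vec_supp xi) _ => y ->; rewrite expr0n. Qed.

Lemma vec_norm (xi : sphere) : fsum (fun y => vec xi y ^+ 2) = 1.
Proof. by case: (svalP xi). Qed.

(** The vector state of the multiplication by h and, in [coeff], of the permutation operator of t. A
    mean on [sphere] applied to these stands for a state on the algebra that the operators
    generate. *)
Definition diag (h : Y -> R) (xi : sphere) := fsum (fun y => h y * vec xi y ^+ 2).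

Definition coeff (t : G) (xi : sphere) :=
  fsum (fun y => vec xi (a t^-1 y) * vec xi y).

Lemma diag_supp h (xi : sphere) : fsupp (fun y => h y * vec xi y ^+ 2).
Proof. by apply: fsuppMr; exact: vec_sq_supp. Qed.

Lemma diag_mean xi : mean (fun h => diag h xi).
Proof.
apply: mean_intro.
- move=> f g _ _; rewrite /diag -fsumD; [|exact: diag_supp|exact: diag_supp].
  by apply: eq_fsum => y; rewrite mulrDl.
- by move=> c f _; rewrite /diag -fsumZ; apply: eq_fsum => y; rewrite -mulrA.
- move=> f c _ fc; rewrite -[leRHS]mulr1 -(vec_norm xi) -fsumZ.
  apply: fsum_le => [||y]; [exact: diag_supp| |].
    by apply: fsuppMr; exact: vec_sq_supp.
  by rewrite ler_wpM2r// sqr_ge0.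
Qed.

Lemma coeff_supp t (xi : sphere) : fsupp (fun y => vec xi (a t^-1 y) * vec xi y).
Proof. by apply: fsuppMr; exact: vec_supp. Qed.

Lemma vec_norm_act t (xi : sphere) : fsum (fun y => vec xi (a t y) ^+ 2) = 1.
Proof. by rewrite (fsum_act t (fun y => vec xi y ^+ 2)) vec_norm. Qed.

Lemma vec_act_supp t (xi : sphere) : fsupp (fun y => vec xi (a t y) ^+ 2).
Proof. exact: (fsupp_act t (vec_sq_supp xi)). Qed.

(** Cauchy-Schwarz as a weighted inequality between arithmetic and geometric means: the bound is
    affine in [diag], so a mean can be applied to it before d tends to 0. *)
Lemma cross_le (A : Y -> R) t (xi : sphere) d : 0 < d ->
  fsum (fun y => A y * (vec xi (a t y) * vec xi y)) <=
  d / 2 + (2 * d)^-1 * diag (fun y => A y ^+ 2) xi.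
Proof.
move=> d0; have -> : d / 2 = fsum (fun y => d / 2 * vec xi (a t y) ^+ 2).
  by rewrite fsumZ vec_norm_act mulr1.
rewrite /diag -fsumZ -fsumD; last 2 first.
- by apply: fsuppMr; exact: vec_act_supp.
- by apply: fsuppMr; exact: diag_supp.
apply: fsum_le => [||y].
- by apply: fsuppMr; apply: fsuppMr; exact: vec_supp.
- apply: fsuppD; first by apply: fsuppMr; exact: vec_act_supp.
  by apply: fsuppMr; exact: diag_supp.
rewrite -subr_ge0.
have -> : d / 2 * vec xi (a t y) ^+ 2 +
    (2 * d)^-1 * (A y ^+ 2 * vec xi y ^+ 2) -
    A y * (vec xi (a t y) * vec xi y) =
    (2 * d)^-1 * (d * vec xi (a t y) - A y * vec xi y) ^+ 2.
  by field; rewrite gt_eqF.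
by rewrite mulr_ge0 ?sqr_ge0// invr_ge0 mulr_ge0// ltW.
Qed.

Lemma coeff_bnd t : bnd (coeff t).
Proof.
exists 1 => xi; rewrite ler_norml; apply/andP; split.
  have := cross_le (fun=> -1) t^-1 xi ltr01.
  rewrite fsumZ -/(coeff t xi) (_ : diag _ xi = 1); first by move=> ?; lra.
  by rewrite -[RHS](vec_norm xi); apply: eq_fsum => y; rewrite sqrrN expr1n mul1r.
have := cross_le (fun=> 1) t^-1 xi ltr01.
rewrite fsumZ -/(coeff t xi) (_ : diag _ xi = 1); first by move=> ?; lra.
by rewrite -[RHS](vec_norm xi); apply: eq_fsum => y; rewrite expr1n mul1r.
Qed.

Lemma diag_bnd h : bnd h -> bnd (diag h).
Proof. exact: (bnd_bind diag_mean). Qed.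

Lemma sphere_act_subproof g (xi : sphere) :
  fsupp (fun y => vec xi (a g^-1 y)) /\
  fsum (fun y => vec xi (a g^-1 y) ^+ 2) = 1.
Proof. by split; [apply: fsupp_act; exact: vec_supp|exact: vec_norm_act]. Qed.

Definition sphere_act (g : G) (xi : sphere) : sphere :=
  exist _ (fun y => vec xi (a g^-1 y)) (sphere_act_subproof g xi).

Lemma diag_act g h xi : diag h (sphere_act g xi) = diag (fun y => h (a g y)) xi.
Proof.
rewrite /diag -(fsum_act g).
by apply: eq_fsum => y; rewrite /vec/= gactK.
Qed.

Lemma coeff_act g t xi :
  coeff t (sphere_act g xi) = coeff (g^-1 * t * g)%g xi.
Proof.
rewrite /coeff -(fsum_act g); apply: eq_fsum => y; rewrite /vec/= gactK.
by rewrite !invgM invgK !(gactM aP).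
Qed.

Lemma sphere_delta (y0 : Y) : sphere.
Proof.
exists (fun y => (y == y0)%:R); split.
  by apply: (@fsupp_sub _ _ _ [set y0]) => // y /= /eqP/negPf->.
rewrite (fsum_delta (y0 := y0)) ?eqxx ?expr1n// => y /negPf->.
by rewrite expr0n.
Defined.

Section Dynamics.
Variables (p : (G -> R) -> R) (z : Y -> (G -> R) -> R).
Hypotheses (pmin : minimal_invariant p).
Hypothesis zext : forall y, extreme_mean p (z y).
Hypothesis zE : forall g y f, z (a g y) f = z y (translate g f).

Let zm y : mean (z y). Proof. by case: (zext y). Qed.
Let zp y : dominated (z y) p. Proof. by case: (zext y). Qed.

(** The barycentre of the means z y for the weights xi y ^+ 2. *)
Definition lift_mean (xi : sphere) (f : G -> R) := diag (fun y => z y f) xi.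

Definition represents (w : (sphere -> R) -> R) (y : (G -> R) -> R) :=
  forall f, bnd f -> w (fun xi => lift_mean xi f) = y f.

Lemma sphere_transport w y : mean w -> extreme_mean p y ->
  exists w', [/\ mean w', dominated w' (orbit_sup sphere_act w) &
    represents w' y].
Proof.
move=> wm [ym yp _].
have := @transport _ _ _ pmin _ sphere_act lift_mean _ _ _ w y wm ym yp; apply.
- by move=> xi; exact: (mean_bind zm (diag_mean xi)).
- move=> xi f bf; apply: (sublin_le (diag_mean xi)).
    exact: (bnd_bind zm).
  by move=> t; exact: zp.
- move=> g xi f; rewrite /lift_mean diag_act.
  by congr diag; apply/funext => t; rewrite zE.
Qed.

Lemma represents_variance w y f : mean w -> extreme_mean p y ->
  represents w y -> bnd f ->
  w (fun xi => diag (fun t => (z t f - y f) ^+ 2) xi) = 0.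
Proof.
move=> wm yext wy bf.
exact: (extreme_variance yext zm zp (mean_bind diag_mean wm) wy).
Qed.

(** As w has variance 0 over y, it treats f and its translate as the scalars y f and y (translate t
    f). Moving f through the operator of t multiplies w (coeff t) by either scalar with the same
    result, and the two scalars differ. *)
Lemma represents_coeff w y t f : mean w -> extreme_mean p y ->
  represents w y -> bnd f -> y (translate t f) != y f -> w (coeff t) = 0.
Proof.
move=> wm yext wy bf yt; set f2 := translate t f.
have bf2 : bnd f2 by exact: bnd_translate.
pose A u := z u f - y f; pose B u := z u f2 - y f2.
have VA : w (fun xi => diag (fun u => A u ^+ 2) xi) = 0.
  exact: (represents_variance wm yext wy bf).
have VB : w (fun xi => diag (fun u => B u ^+ 2) xi) = 0.
  exact: (represents_variance wm yext wy bf2).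
have bz h : bnd h -> bnd (fun u => z u h) by move=> bh; exact: (bnd_bind zm).
have bA : bnd (fun xi => diag (fun u => A u ^+ 2) xi).
  apply: diag_bnd; under eq_fun do rewrite expr2.
  by apply: bndM; apply: bndB; [exact: bz|exact: bnd_cst|exact: bz|exact: bnd_cst].
have bB : bnd (fun xi => diag (fun u => B u ^+ 2) xi).
  apply: diag_bnd; under eq_fun do rewrite expr2.
  by apply: bndM; apply: bndB; [exact: bz|exact: bnd_cst|exact: bz|exact: bnd_cst].
have key c xi d : 0 < d -> c ^+ 2 = 1 ->
    c * ((y f2 - y f) * coeff t xi) <=
    d + (2 * d)^-1 * (diag (fun u => A u ^+ 2) xi + diag (fun u => B u ^+ 2) xi).
  move=> d0 c1.
  (* After the change of variables by t^-1 the two terms z u f cancel and only the constant y f2 - y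
     f remains. The sign c serves to bound the absolute value. *)
  have -> : c * ((y f2 - y f) * coeff t xi) =
      fsum (fun u => c * A u * (vec xi (a t^-1 u) * vec xi u)) +
      fsum (fun u => - c * B u * (vec xi (a t u) * vec xi u)).
    rewrite -(fsum_act t^-1 (fun u => - c * B u * _)) -fsumD.
    - rewrite mulrA /coeff -fsumZ; apply: eq_fsum => u.
      rewrite gactKV /B zE /f2 translateM mulgV translate1 /A.
      by rewrite -/f2; ring.
    - by apply: fsuppMr; exact: coeff_supp.
    - by apply: fsuppMr; apply: fsuppMr; apply: fsupp_act; exact: vec_supp.
  have := cross_le (fun u => c * A u) t^-1 xi d0.
  have := cross_le (fun u => - c * B u) t xi d0.
  have -> : diag (fun u => (- c * B u) ^+ 2) xi = diag (fun u => B u ^+ 2) xi.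
    by apply: eq_fsum => u; rewrite exprMn sqrrN c1 mul1r.
  have -> : diag (fun u => (c * A u) ^+ 2) xi = diag (fun u => A u ^+ 2) xi.
    by apply: eq_fsum => u; rewrite exprMn c1 mul1r.
  by move=> ? ?; lra.
have wle c d : 0 < d -> c ^+ 2 = 1 -> c * ((y f2 - y f) * w (coeff t)) <= d.
  move=> d0 c1.
  have bt := coeff_bnd t.
  rewrite -(meanZ wm _ bt) -(meanZ wm _ (bndZ _ bt)).
  have b1 := bndZ (2 * d)^-1 (bndD bA bB).
  have /= := sublin_mono wm (bndZ c (bndZ _ (coeff_bnd t)))
    (bndD (bnd_cst d) b1) (fun xi => key c xi d d0 c1).
  rewrite (meanD wm (bnd_cst d) b1) (mean_cst wm) (meanZ wm _ (bndD bA bB)).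
  by rewrite (meanD wm bA bB) VA VB addr0 mulr0 addr0.
have E : (y f2 - y f) * w (coeff t) = 0.
  apply/eqP; rewrite eq_le; apply/andP; split; apply/ler_addgt0Pl => d d0.
    by rewrite addr0; have := wle 1 d d0 (expr1n _ _); rewrite mul1r.
  have c1 : (-1) ^+ 2 = 1 :> R by rewrite sqrrN expr1n.
  by have := wle (-1) d d0 c1 => ?; lra.
move/eqP: E; rewrite mulf_eq0 subr_eq0 (negPf yt)/=.
by move/eqP.
Qed.

End Dynamics.

End Sphere.
Arguments coeff_bnd {R G Y a} aP t.

(** * Free points and Powers' averaging *)

Section FreePoint.
Variables (R : realType) (G : groupType) (Y : choiceType) (a : G -> Y -> Y).
Hypothesis aP : gact a.
Variables (p : (G -> R) -> R) (z : Y -> (G -> R) -> R).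
Hypotheses (pmin : minimal_invariant p).
Hypothesis zext : forall y, extreme_mean p (z y).
Hypothesis zE : forall g y f, z (a g y) f = z y (translate g f).
Hypothesis zsep : forall y y', y <> y' -> exists2 f, bnd f & z y f != z y' f.

Let zm y : mean (z y). Proof. by case: (zext y). Qed.
Let zp y : dominated (z y) p. Proof. by case: (zext y). Qed.

(* V is a neighbourhood of y as far as means representing the extreme point
   z y can tell: they do not charge the complement of V. *)
Definition mean_nbhs (y : Y) (V : set Y) := exists q : Y -> R,
  [/\ bnd q, forall t, 0 <= q t, forall t, ~ V t -> 1 <= q t &
    forall m, mean m -> (forall f, bnd f -> m (fun t => z t f) = z y f) ->
      m q <= 0].

Definition mean_open V := forall y, V y -> mean_nbhs y V.

Lemma mean_nbhsI y V W : mean_nbhs y V -> mean_nbhs y W -> mean_nbhs y (V `&` W).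
Proof.
move=> [q [bq q0 q1 mq]] [r [br r0 r1 mr]]; exists (fun t => q t + r t); split.
- exact: bndD.
- by move=> t; rewrite addr_ge0.
- move=> t VW; have [Vt|/q1 Vt] := pselect (V t); last by rewrite ler_wpDr.
  by rewrite ler_wpDl// r1// => Wt; exact: VW.
- move=> m mm mz; rewrite (meanD mm)//.
  by have := mq m mm mz; have := mr m mm mz => ? ?; lra.
Qed.

Lemma mean_nbhsS y V W : V `<=` W -> mean_nbhs y V -> mean_nbhs y W.
Proof.
by move=> VW [q [bq q0 q1 mq]]; exists q; split=> // t nW; apply: q1 => /VW.
Qed.

Lemma mean_openI V W : mean_open V -> mean_open W -> mean_open (V `&` W).
Proof. by move=> oV oW y [/oV Vy /oW Wy]; exact: mean_nbhsI. Qed.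

(** The witness is the squared deviation of z f from its value at y, normalized to be 1 where z f
    vanishes; it has mean 0 by [extreme_variance]. *)
Lemma mean_nbhs_neq0 y f : bnd f -> z y f != 0 ->
  mean_nbhs y [set t | z t f != 0].
Proof.
move=> bf y0; have c0 : 0 < z y f ^+ 2 by rewrite lt0r sqrf_eq0 y0 sqr_ge0.
have bzf : bnd (fun t => z t f - z y f).
  by apply: bndB; [exact: (bnd_bind zm)|exact: bnd_cst].
have bz2 : bnd (fun t => (z t f - z y f) ^+ 2).
  by under eq_fun do rewrite expr2; exact: bndM.
exists (fun t => (z y f ^+ 2)^-1 * (z t f - z y f) ^+ 2); split.
- exact: bndZ.
- by move=> t; rewrite mulr_ge0 ?sqr_ge0// invr_ge0 ltW.
- move=> t /negP/negPn/eqP->; rewrite sub0r sqrrN mulVf//.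
  by rewrite gt_eqF.
- move=> m mm mz; rewrite (meanZ mm)//.
  by rewrite (extreme_variance (zext y) zm zp mm mz bf) mulr0.
Qed.

(** That t moves y is witnessed by a bounded f such that z y takes different values on f and on its
    translate; this inequality defines a neighbourhood by [mean_nbhs_neq0]. *)
Lemma mean_open_moved t : mean_open [set y | a t y <> y].
Proof.
move=> y /nesym/zsep[f bf]; rewrite zE => yf.
have bft : bnd (fun s => f s - translate t f s).
  by apply: bndB => //; exact: bnd_translate.
have zft u : z u (fun s => f s - translate t f s) = z u f - z (a t u) f.
  by rewrite (meanB (zm u)) ?zE//; exact: bnd_translate.
apply: mean_nbhsS (mean_nbhs_neq0 bft _); last by rewrite zft zE subr_eq0.
by move=> u /=; rewrite zft => /eqP u0 tu; apply: u0; rewrite tu subrr.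
Qed.

(** V is cut down to the open set of points moved by the first element, as long as this is nonempty;
    otherwise that element fixes V pointwise. Finiteness of T replaces a Baire argument. *)
Lemma mean_open_fixed (T : seq G) V : mean_open V -> V !=set0 ->
  (forall y, V y -> exists2 t, t \in T & a t y = y) ->
  exists W t, [/\ mean_open W, W !=set0, t \in T & forall y, W y -> a t y = y].
Proof.
elim: T V => [|t T IH] V oV V0 VT.
  by have [y /VT[]] := V0.
have [V'0|V'0] := pselect ((V `&` [set y | a t y <> y]) !=set0).
  have [||W [s [oW W0 sT Ws]]] := IH _ _ V'0.
  - by apply: mean_openI => //; exact: mean_open_moved.
  - move=> y [/VT[s]]; rewrite inE => /predU1P[->//|sT sy _].
    by exists s.
  - by exists W, s; split=> //; rewrite inE sT orbT.
exists V, t; split=> //; first by rewrite inE eqxx.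
by move=> y Vy; apply: contrapT => ty; apply: V'0; exists y.
Qed.

(** 1 - coeff t xi is half the squared distance from xi to its translate, to which only the points
    moved by t contribute. These form a set stable under t, on which both vectors have the same
    mass. *)
Lemma coeff_fixed_le t (q : Y -> R) (xi : sphere R Y) : bnd q ->
  (forall y, 0 <= q y) -> (forall y, a t y <> y -> 1 <= q y) ->
  1 - coeff a t xi <= 2 * diag q xi.
Proof.
move=> bq q0 q1; pose n y : R := (a t y != y)%:R.
have nq y : n y <= q y by rewrite /n; case: eqP => [_|/q1].
have nE y : n (a t^-1 y) = n y.
  rewrite /n (gactKV aP) eq_sym; congr ((~~ _)%:R).
  by rewrite -(inj_eq (bij_inj (gact_bij aP t))) (gactKV aP).
have n2 : diag n xi = fsum (fun y => n y * vec xi (a t^-1 y) ^+ 2).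
  rewrite /diag -(fsum_act aP t^-1 (fun y => n y * vec xi y ^+ 2)).
  by apply: eq_fsum => y; rewrite nE.
have sv := vec_supp xi; have s2 := vec_sq_supp xi.
have st := vec_act_supp aP t^-1 xi.
have H : 1 - coeff a t xi = fsum (fun y => 2^-1 * vec xi y ^+ 2 +
    2^-1 * vec xi (a t^-1 y) ^+ 2 - vec xi (a t^-1 y) * vec xi y).
  rewrite fsumB; last 2 first.
  - by apply: fsuppD; apply: fsuppMr.
  - exact: coeff_supp.
  rewrite fsumD; [|exact: fsuppMr|exact: fsuppMr].
  by rewrite !fsumZ vec_norm (vec_norm_act aP) mulr1 -/(coeff a t xi); lra.
have : 2 * diag n xi <= 2 * diag q xi.
  rewrite ler_pM2l//; apply: fsum_le => [||y]; [exact: diag_supp..|].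
  by rewrite ler_wpM2r// sqr_ge0.
apply: le_trans; rewrite mulr_natl mulr2n {2}n2 /diag -fsumD; last 2 first.
- exact: fsuppMr.
- exact: fsuppMr.
rewrite H; apply: fsum_le => [||y].
- apply: fsuppD; first by apply: fsuppD; apply: fsuppMr.
  by apply: (fsuppW (fsuppMr (fun y => vec xi (a t^-1 y)) sv)) => y ->; rewrite oppr0.
- by apply: fsuppD; exact: fsuppMr.
set u := vec xi y; set v := vec xi _.
rewrite /n; case: (eqVneq (a t y) y) => [ty|ty] /=.
  have -> : v = u by rewrite /v -{1}ty (gactK aP).
  by rewrite !mul0r; lra.
rewrite !mul1r; by have := sqr_ge0 (u + v); have := sqr_ge0 u; have := sqr_ge0 v => ? ? ?; lra.
Qed.

(** Otherwise some t in T fixes a nonempty open W pointwise. Translates of w accumulate at a mean w'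
    over a point of W, which does not charge the complement of W, so that w' (coeff t) >= 1; but
    translating w only replaces t by its conjugates, where w is at most 0. *)
Lemma free_point (w : (sphere R Y -> R) -> R) (T : seq G) : Y ->
  mean w -> (forall t, t != 1%g -> w (coeff a t) <= 0) ->
  all (fun t => t != 1%g) T -> exists y, forall t, t \in T -> a t y <> y.
Proof.
move=> y0 wm w0 T1; apply: contrapT => /forallNP H.
have oT : mean_open [set: Y].
  move=> y _; exists (fun=> 0); split=> //; first exact: bnd_cst.
    by move=> t /(_ I).
  by move=> m mm _; rewrite (mean_cst mm).
have [||W [t [oW [y Wy] tT Wt]]] := mean_open_fixed (T := T) oT.
- by exists y0.
- move=> y _; apply: contrapT => Hy; apply: (H y) => t tT ty.
  by apply: Hy; exists t.
have [q [bq q0 q1 mq]] := oW y Wy.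
have [w' [w'm w'Q w'y]] := sphere_transport aP pmin zext zE wm (zext y).
have wq : w' (diag q) <= 0.
  by apply: (mq _ (mean_bind (@diag_mean _ _) w'm)).
have q1' u : a t u <> u -> 1 <= q u by move=> tu; apply: q1 => /Wt.
have w't : w' (coeff a t) <= 0.
  apply: (le_trans (w'Q _ (coeff_bnd aP t))); apply: ge_sup.
    by eexists; exists 1%g.
  move=> _ [g _ <-]; under eq_fun do rewrite coeff_act//.
  apply: w0; apply: contra (allP T1 t tT) => /eqP gt.
  have -> : t = (g * (g^-1 * t * g) * g^-1)%g.
    by rewrite !mulgA mulgV mul1g mulgK.
  by rewrite gt mulg1 mulgV.
have := sublin_mono w'm (bndB (bnd_cst 1) (coeff_bnd aP t))
  (bndZ 2 (diag_bnd bq)) (fun xi => coeff_fixed_le xi bq q0 q1').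
rewrite (meanB w'm (bnd_cst 1) (coeff_bnd aP t)) (mean_cst w'm).
by rewrite (meanZ w'm _ (diag_bnd bq)) => ?; lra.
Qed.

End FreePoint.

Section Powers.
Variables (R : realType) (G : groupType) (p : (G -> R) -> R).
Hypotheses (pmin : minimal_invariant p).

Definition act_mean (g : G) (x : (G -> R) -> R) : (G -> R) -> R :=
  fun f => x (translate g f).

Lemma extreme_act g x : extreme_mean p x -> extreme_mean p (act_mean g x).
Proof.
move=> [xm xp xe]; have [ps pinv _] := pmin.
have mact h b : mean b -> mean (act_mean h b) by exact: mean_comp.
have dact h b : dominated b p -> dominated (act_mean h b) p.
  move=> bp f bf; rewrite -(pinv h f bf); apply: bp; exact: bnd_translate.
split; [exact: mact|exact: dact|].
move=> b c bm cm bp cp bc f bf.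
have := xe _ _ (mact g^-1%g _ bm) (mact g^-1%g _ cm) (dact g^-1%g _ bp)
  (dact g^-1%g _ cp).
move=> /(_ _ (translate g f) (bnd_translate _ bf)).
rewrite /act_mean translateM mulgV translate1; apply.
move=> h bh; rewrite bc; last exact: bnd_translate.
by rewrite /act_mean translateM mulVg translate1.
Qed.

(** If no convex combination stays below e, minimax gives a mean w on the unit vectors that is at
    least e on all conjugates of the sum over T. A limit of its translates over x vanishes on this
    sum, as x is moved by each t. *)
Lemma powers_averaging x (T : seq G) e : 0 < e -> extreme_mean p x ->
  (forall t, t \in T -> exists2 f, bnd f & x (translate t f) != x f) ->
  exists ws : seq (R * G), [/\ all (fun v => 0 <= v.1) ws,
    \sum_(v <- ws) v.1 = 1 &
    forall xi : sphere R G, \sum_(v <- ws)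
      v.1 * (\sum_(t <- T) coeff (fun g h => (g * h)%g) (v.2^-1 * t * v.2)%g xi)
      <= e].
Proof.
move=> e0 xext xT; pose a (g h : G) := (g * h)%g.
have aP : gact a by split=> [y|g h y]; rewrite /a ?mul1g ?mulgA.
(* The orbit of x is parametrized by G, possibly with repetitions, so that the unit vectors lie in
   l^2(G). *)
pose z (y : G) := act_mean y x.
have zext y : extreme_mean p (z y) by exact: extreme_act.
have zE g y f : z (a g y) f = z y (translate g f).
  by rewrite /z /act_mean translateM.
pose v g (xi : sphere R G) := \sum_(t <- T) coeff a (g^-1 * t * g)%g xi - e.
have bs g : bnd (fun xi : sphere R G => \sum_(t <- T) coeff a (g^-1 * t * g)%g xi).
  by apply: bnd_sum => t; exact: coeff_bnd.
have bv g : bnd (v g) by apply: bndB => //; exact: bnd_cst.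
have [w wm|ws [d d0 [ws0 ws1 wsd]]] := minimax (sphere_delta R (1%g : G)) bv.
  apply: contrapT => /forallNP H.
  have [w' [w'm w'Q w'x]] := sphere_transport aP pmin zext zE wm xext.
  have w'0 : w' (fun xi => \sum_(t <- T) coeff a t xi) = 0.
    rewrite (mean_sum w'm) => [|t]; last exact: coeff_bnd.
    rewrite big_seq big1// => t /xT[f bf xf].
    exact: (represents_coeff aP zext zE w'm xext w'x bf).
  have bT : bnd (fun xi : sphere R G => \sum_(t <- T) coeff a t xi).
    by apply: bnd_sum => t; exact: coeff_bnd.
  have := w'Q _ (bndN bT); rewrite (meanN w'm bT) w'0 oppr0 leNgt => /negP; apply.
  apply: le_lt_trans (_ : - e < 0); last by rewrite oppr_lt0.
  apply: ge_sup; first by eexists; exists 1%g.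
  move=> _ [g _ <-]; have /negP := H g; rewrite -leNgt /v.
  rewrite (meanB wm (bs g) (bnd_cst e)) (mean_cst wm) => ge.
  under eq_fun do under eq_bigr do rewrite coeff_act//.
  by rewrite (meanN wm (bs g)); lra.
exists ws; split=> // xi; have := wsd xi; rewrite /v.
under eq_bigr do rewrite mulrBr.
rewrite sumrB -mulr_suml ws1 mul1r => ?; lra.
Qed.

End Powers.

(** * Weak containment of quasi-regular representations *)

Section Reiter.
Variables (R : realType) (G : groupType).

(** Day's argument. The l^1 distances are maxima over sign patterns, to which minimax is applied:
    averaging over g by x excludes a mean on the patterns that is bad for every g, so one convex
    combination q of points is good for all patterns at once. *)
Lemma invariant_mean_l1 (x : (G -> R) -> R) (E : seq G) e : 0 < e -> mean x ->
  (forall h f, h \in E -> bnd f -> x (translate h f) = x f) ->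
  exists q : G -> R, [/\ fsupp q, forall g, 0 <= q g, fsum q = 1 &
    forall h, h \in E -> fsum (fun g => `|q (h^-1 * g)%g - q g|) <= e].
Proof.
move=> e0 xm xE; pose sg (b : bool) : R := (-1) ^+ b.
have sg1 b : `|sg b| <= 1 by rewrite /sg normr_sign.
pose v g (f : G -> G -> bool) :=
  \sum_(h <- E) (sg (f h (h * g)%g) - sg (f h g)) - e.
have bsg h g : bnd (fun f : G -> G -> bool => sg (f h g)) by exists 1.
have bsum g : bnd (fun f : G -> G -> bool =>
    \sum_(h <- E) (sg (f h (h * g)%g) - sg (f h g))).
  by apply: bnd_sum => h; exact: bndB.
have bv g : bnd (v g) by apply: bndB => //; exact: bnd_cst.
have [m mm|ws [d d0 [ws0 ws1 wsd]]] := minimax (fun _ _ => false) bv.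
  apply: contrapT => /forallNP H.
  pose F h g := m (fun f => sg (f h g)).
  have bF h : bnd (F h) by exists 1 => g; apply: mean_bnd => //.
  have Fe g : e <= \sum_(h <- E) (F h (h * g)%g - F h g).
    have /negP := H g; rewrite -leNgt /v.
    rewrite (meanB mm (bsum g) (bnd_cst e)) (mean_cst mm) (mean_sum mm).
      under eq_bigr do rewrite (meanB mm (bsg _ _) (bsg _ _)).
      by rewrite subr_ge0.
    by move=> h; exact: bndB.
  have bFE h : bnd (fun g => F h (h * g)%g - F h g).
    by apply: bndB => //; exact: (bnd_translate h (bF h)).
  have := sublin_ge xm (bnd_sum E bFE) Fe.
  rewrite (mean_sum xm)// big_seq big1 ?leNgt ?e0// => h hE.
  rewrite (meanB xm (bnd_translate h (bF h)) (bF h)).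
  by rewrite (xE h (F h) hE (bF h)) subrr.
pose q g : R := \sum_(v <- ws) v.1 * (g == v.2)%:R.
have fdelta (u : R * G) (F : G -> R) :
    fsupp (fun g => F g * (u.1 * (g == u.2)%:R)).
  apply: (@fsupp_sub _ _ _ [set u.2]) => // g /= /eqP/negPf->.
  by rewrite !mulr0.
have qE (F : G -> R) : fsum (fun g => F g * q g) = \sum_(v <- ws) v.1 * F v.2.
  rewrite (eq_fsum (g := fun g => \sum_(v <- ws) F g * (v.1 * (g == v.2)%:R))).
    rewrite fsum_sum => [|u]; last exact: fdelta.
    apply: eq_bigr => u _; rewrite (fsum_delta (y0 := u.2)).
      by rewrite eqxx mulr1 mulrC.
    by move=> g /negPf->; rewrite !mulr0.
  by move=> g; rewrite /q mulr_sumr.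
have qs : fsupp q.
  apply: fsupp_sum => u; have := fdelta u (fun=> 1).
  by under eq_fun do rewrite mul1r.
have q0 g : 0 <= q g by apply: (wsum_ge0 (F := fun k => (g == k)%:R) ws0) => k; exact: ler0n.
exists q; split=> //.
  have := qE (fun=> 1); rewrite (eq_fsum (g := q)) => [->|g].
    by rewrite -[RHS]ws1; apply: eq_bigr => u _; rewrite mulr1.
  by rewrite mul1r.
have mulg_bij (h : G) : bijective (fun g => h * g)%g.
  by exists (fun g => h^-1 * g)%g => g; rewrite (mulKg, mulVKg).
(* The sign pattern that attains all these l^1 norms at once. *)
pose f h g := (q (h^-1 * g)%g - q g < 0).
have fE h : fsum (fun g => `|q (h^-1 * g)%g - q g|) =
    \sum_(v <- ws) v.1 * (sg (f h (h * v.2)%g) - sg (f h v.2)).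
  have qh : fsupp (fun g => q (h^-1 * g)%g).
    exact: (fsupp_comp (bij_inj (mulg_bij h^-1%g)) qs).
  rewrite (eq_fsum (g := fun g => sg (f h g) * q (h^-1 * g)%g -
      sg (f h g) * q g)) => [|g]; last first.
    rewrite -mulrBr /sg /f; case: ltP => [lt0|ge0]; first by rewrite expr1 mulN1r ltr0_norm.
    by rewrite expr0 mul1r ger0_norm.
  rewrite fsumB; [|exact: fsuppMr|exact: fsuppMr].
  rewrite (fsum_reindex _ (mulg_bij h)).
  under eq_fsum do rewrite mulKg.
  rewrite (qE (fun g => sg (f h (h * g)%g))) (qE (fun g => sg (f h g))) -sumrB.
  by apply: eq_bigr => u _; rewrite mulrBr.
move=> h hE.
have tot : \sum_(h <- E) fsum (fun g => `|q (h^-1 * g)%g - q g|) <= e.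
  under eq_bigr do rewrite fE.
  rewrite exchange_big/=; have := wsd f.
  have -> : \sum_(u <- ws) u.1 * v u.2 f = \sum_(u <- ws)
      (\sum_(h <- E) u.1 * (sg (f h (h * u.2)%g) - sg (f h u.2)) - u.1 * e).
    by apply: eq_bigr => u _; rewrite /v mulrBr mulr_sumr.
  by rewrite sumrB -mulr_suml ws1 mul1r => ?; lra.
apply: le_trans tot; rewrite (big_rem h)//= lerDl sumr_ge0// => k _.
exact: fsum_ge0.
Qed.

Lemma sqrt_dist (s t : R) : 0 <= s -> 0 <= t ->
  (Num.sqrt s - Num.sqrt t) ^+ 2 <= `|s - t|.
Proof.
wlog st : s t / s <= t => [W s0 t0|s0 t0].
  have [st|/ltW ts] := leP s t; first exact: W.
  by rewrite -sqrrN opprB distrC; exact: W.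
rewrite distrC ger0_norm ?subr_ge0//.
rewrite -{2}(sqr_sqrtr t0) -{2}(sqr_sqrtr s0).
have a0 := sqrtr_ge0 s; have ab : Num.sqrt s <= Num.sqrt t by rewrite ler_sqrt.
rewrite -subr_ge0.
have -> : Num.sqrt t ^+ 2 - Num.sqrt s ^+ 2 - (Num.sqrt s - Num.sqrt t) ^+ 2 =
    2 * Num.sqrt s * (Num.sqrt t - Num.sqrt s) by ring.
by rewrite !mulr_ge0// subr_ge0.
Qed.

(** The square root of the l^1 function of [invariant_mean_l1]; [sqrt_dist] turns the l^1 estimate
    into one in l^2. *)
Lemma reiter (x : (G -> R) -> R) (E : seq G) e : 0 < e -> mean x ->
  (forall h f, h \in E -> bnd f -> x (translate h f) = x f) ->
  exists r : G -> R, [/\ fsupp r, fsum (fun g => r g ^+ 2) = 1 &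
    forall h, h \in E -> fsum (fun g => (r (h^-1 * g)%g - r g) ^+ 2) <= e].
Proof.
move=> e0 xm xE; have [q [qs q0 q1 qe]] := invariant_mean_l1 e0 xm xE.
exists (fun g => Num.sqrt (q g)).
have rs : fsupp (fun g => Num.sqrt (q g)).
  by apply: (fsuppW qs) => g ->; rewrite sqrtr0.
split=> //.
  by rewrite -q1; apply: eq_fsum => g; rewrite sqr_sqrtr.
move=> h hE; apply: le_trans (qe h hE).
have hi : injective (fun g => h^-1 * g)%g by exact: mulgI.
have rh := fsupp_comp hi rs; have qh := fsupp_comp hi qs.
have sB (u v : G -> R) : fsupp u -> fsupp v -> fsupp (fun g => u g - v g).
  by move=> us vs; apply: fsuppD => //; apply: (fsuppW vs) => g ->; rewrite oppr0.
apply: fsum_le => [||g].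
- by apply: (fsuppW (sB _ _ rh rs)) => g ->; rewrite expr0n.
- by apply: (fsuppW (sB _ _ qh qs)) => g ->; rewrite normr0.
- exact: sqrt_dist.
Qed.

End Reiter.

Section SquareModulus.
Variable R : realType.
Implicit Types z w : R[i].

Definition sqmod z : R := complex.Re z ^+ 2 + complex.Im z ^+ 2.

Lemma sqmod0 : sqmod 0 = 0.
Proof. by rewrite /sqmod /= expr0n addr0. Qed.

Lemma sqmod_ge0 z : 0 <= sqmod z.
Proof. by rewrite addr_ge0// sqr_ge0. Qed.

Lemma sqmodM z w : sqmod (z * w) = sqmod z * sqmod w.
Proof. by case: z w => [a b] [c d]; rewrite /sqmod /=; ring. Qed.

Lemma sqmod_real (x : R) : sqmod x%:C%C = x ^+ 2.
Proof. by rewrite /sqmod /= expr0n addr0. Qed.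

Lemma sqmodD_le e z w : 0 < e ->
  sqmod (z + w) <= (1 + e) * sqmod z + (1 + e^-1) * sqmod w.
Proof.
move=> e0; rewrite /sqmod; case: z w => [a b] [c d] /=.
rewrite -subr_ge0.
have -> : (1 + e) * (a ^+ 2 + b ^+ 2) + (1 + e^-1) * (c ^+ 2 + d ^+ 2) -
    ((a + c) ^+ 2 + (b + d) ^+ 2) =
    e^-1 * ((e * a - c) ^+ 2 + (e * b - d) ^+ 2).
  by field; rewrite gt_eqF.
by rewrite mulr_ge0 ?invr_ge0 ?(ltW e0)// addr_ge0// sqr_ge0.
Qed.

(** The crude constant does no harm: it depends on the number of terms alone and gets multiplied by
    an arbitrarily small error. *)
Lemma sqmod_sum (I : Type) (r : seq I) (F : I -> R[i]) :
  sqmod (\sum_(k <- r) F k) <= 2 ^+ size r * \sum_(k <- r) sqmod (F k).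
Proof.
elim: r => [|k r IH]; first by rewrite !big_nil sqmod0 mulr0.
rewrite !big_cons; have := sqmodD_le (F k) (\sum_(j <- r) F j) ltr01.
move=> /le_trans; apply; rewrite invr1 /= exprS.
have := sqmod_ge0 (F k); have p1 : 1 <= 2 ^+ size r :> R by rewrite exprn_ege1// ler1n.
have := ler_peMl (sqmod_ge0 (F k)) p1.
move: IH; set u := sqmod (F k); set P := 2 ^+ size r; set b := sqmod _.
by set c := \sum_(_ <- _) _ => *; lra.
Qed.

End SquareModulus.

Lemma finite_translates (G : groupType) (Y : choiceType) (a : G -> Y -> Y)
  (ts : seq G) (P : set Y) : gact a -> finite_set P ->
  finite_set [set y | exists2 t, t \in ts & P (a t^-1%g y)].
Proof.
move=> aP fP.
have -> : [set y | exists2 t, t \in ts & P (a t^-1%g y)] =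
    \bigcup_(t in [set` ts]) (a t @` P).
  apply/seteqP; split=> y [t tts Pt]; exists t => //.
    by exists (a t^-1%g y) => //; rewrite (gactKV aP).
  by case: Pt => z Pz <-; rewrite (gactK aP).
by apply: bigcup_finite => // t _; exact: finite_image.
Qed.

Section GroupAlgebraAction.
Variables (R : realType) (G : groupType) (Y : choiceType) (a : G -> Y -> Y).

(* A list of pairs stands for the element of the group algebra it sums to. *)
Definition gop (s : seq (R[i] * G)) (xi : Y -> R[i]) (y : Y) : R[i] :=
  \sum_(v <- s) v.1 * xi (a v.2^-1%g y).

Hypothesis aP : gact a.

Lemma gop_supp s (xi : Y -> R[i]) : fsupp xi -> fsupp (gop s xi).
Proof.
move=> sxi; apply: fsupp_sum => v; apply: fsuppMr.
exact: (fsupp_act aP v.2^-1%g sxi).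
Qed.

End GroupAlgebraAction.

Lemma fsupp_sqmod (R : realType) (Y : choiceType) (xi : Y -> R[i]) :
  fsupp xi -> fsupp (fun y => sqmod (xi y)).
Proof. by move=> sxi; apply: (fsuppW sxi) => y ->; exact: sqmod0. Qed.

Section WeakContainment.
Variables (R : realType) (G : groupType) (Y : choiceType) (a : G -> Y -> Y).
Hypothesis aP : gact a.
Variables (y0 : Y) (sec : Y -> G) (x : (G -> R) -> R).
Hypotheses (secE : forall y, a (sec y) y0 = y) (xm : mean x).
Hypothesis xstab : forall h f, a h y0 = y0 -> bnd f -> x (translate h f) = x f.

Let lmul (g h : G) := (g * h)%g.
Let lmulP : gact lmul.
Proof. by split=> [g|g h k]; rewrite /lmul ?mul1g ?mulgA. Qed.

(* Fell absorption: on G x Y the diagonal action is a multiple of the left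
   regular one, and xi \otimes (translates of an almost invariant r) is an
   approximate copy of xi in it. *)
Lemma weak_containment_approx (s : seq (R[i] * G)) (C : R) (xi : Y -> R[i]) (e d : R) :
  (forall zeta : G -> R[i], fsupp zeta ->
     fsum (fun g => sqmod (gop lmul s zeta g)) <=
     C * fsum (fun g => sqmod (zeta g))) ->
  fsupp xi -> 0 < e -> 0 < d ->
  fsum (fun y => sqmod (gop a s xi y)) <=
  (1 + d) * (C * fsum (fun y => sqmod (xi y))) +
  (1 + d^-1) * (2 ^+ size s * (\sum_(v <- s) sqmod v.1 * (e *
    fsum (fun y => sqmod (xi y))))).
Proof.
move=> HC sxi e0 d0.
pose N := [set y | xi y != 0]; have fN : finite_set N by [].
have xi0 y : ~ N y -> xi y = 0 by move=> /negP/negPn/eqP.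
pose ts := [seq v.2 | v <- s].
have [ys ysE] := (finite_seqP N).1 fN.
(* The cocycle of the section [sec], with values in the stabilizer of y0: r has to be almost
   invariant under finitely many of its values. *)
pose E := [seq ((sec (a t y))^-1 * t * sec y)%g | t <- ts, y <- ys].
have [|r [rs r1 rE]] := reiter (E := E) e0 xm.
  move=> h f /allpairsP[[t y] /= [tt _ ->]] bf; apply: xstab => //.
  by rewrite !(gactM aP) secE -{2}(secE (a t y)) (gactK aP).
have {}rE t y : t \in ts -> N y ->
    fsum (fun g => (r ((sec y)^-1 * t^-1 * sec (a t y) * g)%g - r g) ^+ 2) <= e.
  move=> tt Ny; have h : ((sec (a t y))^-1 * t * sec y)%g \in E.
    by apply/allpairsP; exists (t, y); split=> //=; move: Ny; rewrite ysE.
  apply: le_trans (rE _ h); rewrite le_eqVlt; apply/orP; left; apply/eqP.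
  by apply: eq_fsum => g; rewrite !invgM invgK !mulgA.
pose Rs := [set g | r g != 0]; have fRs : finite_set Rs by [].
pose PG := (fun v : Y * G => sec v.1 * v.2)%g @` (N `*` Rs).
have fPG : finite_set PG by apply: finite_image; exact: finite_setX.
pose W g y : R[i] := (r ((sec y)^-1 * g)%g)%:C%C * xi y.
have W0 g y : ~ (PG g /\ N y) -> W g y = 0.
  move=> H; have [Ny|/xi0 y0'] := pselect (N y); last by rewrite /W y0' mulr0.
  have [rg|/negP/negPn/eqP rg] := pselect (Rs ((sec y)^-1 * g)%g).
    by case: H; split=> //; exists (y, (sec y)^-1 * g)%g => //=; rewrite mulVKg.
  by rewrite /W rg rmorph0 mul0r.
pose V g y : R[i] := \sum_(v <- s) v.1 * W (v.2^-1 * g)%g (a v.2^-1%g y).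
pose PG' := [set g | exists2 t, t \in ts & PG (lmul t^-1%g g)].
pose N' := [set y | exists2 t, t \in ts & N (a t^-1%g y)].
have fPG' : finite_set PG' by exact: finite_translates.
have fN' : finite_set N' by exact: finite_translates.
have V0 g y : ~ (PG' g /\ N' y) -> V g y = 0.
  move=> H; rewrite /V big_seq big1// => v vs.
  rewrite W0 ?mulr0// => -[Pg Ny]; apply: H.
  by split; exists v.2 => //; apply/mapP; exists v.
(* The diagonal orbits of G x Y are the sets of pairs (g, a g w), each a copy of G on which the
   action is left translation; the bound for l^2(G) applies to each of them. *)
pose zeta w g := W g (a g w).
have zetaE w g : gop lmul s (zeta w) g = V g (a g w).
  by apply: eq_bigr => v _; rewrite /zeta /lmul (gactM aP).
have zs w : fsupp (zeta w).
  by apply: (fsupp_sub fPG) => g Pg; apply: W0 => -[].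
have fimg P Q : finite_set P -> finite_set Q ->
    finite_set [set w | exists2 g : G, P g & Q (a g w)].
  move=> fP fQ.
  apply: (sub_finite_set _ (finite_image (fun v => a v.1^-1%g v.2) (finite_setX fP fQ))).
  by move=> w [g Pg Qw]; exists (g, a g w) => //=; rewrite (gactK aP).
have swap (F : G -> Y -> R) P Q : finite_set P -> finite_set Q ->
    (forall g y, ~ (P g /\ Q y) -> F g y = 0) ->
    fsum (fun w => fsum (fun g => F g (a g w))) =
    fsum (fun y => fsum (fun g => F g y)).
  move=> fP fQ F0.
  rewrite (@fsum_exchange _ _ _ (fun w g => F g (a g w))
    [set w | exists2 g : G, P g & Q (a g w)] P)//; last 2 first.
  - exact: fimg.
  - by move=> w g H; apply: F0 => -[Pg Qw]; apply: H; split=> //; exists g.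
  under eq_fsum do rewrite (fsum_act aP _ (F _)).
  by apply: (fsum_exchange fP fQ) => g y; exact: F0.
have sup1 (F : G -> Y -> R) P Q : finite_set P -> finite_set Q ->
    (forall g y, ~ (P g /\ Q y) -> F g y = 0) ->
    fsupp (fun y => fsum (fun g => F g y)).
  move=> fP fQ F0; apply: (fsupp_sub fQ) => y Qy.
  by rewrite (eq_fsum (g := fun=> 0)) ?fsum0// => g; apply: F0 => -[].
have sup2 (F : G -> Y -> R) P Q : finite_set P -> finite_set Q ->
    (forall g y, ~ (P g /\ Q y) -> F g y = 0) ->
    fsupp (fun w => fsum (fun g => F g (a g w))).
  move=> fP fQ F0; apply: (fsupp_sub (fimg _ _ fP fQ)) => w Hw.
  rewrite (eq_fsum (g := fun=> 0)) ?fsum0// => g; apply: F0 => -[Pg Qw].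
  by apply: Hw; exists g.
have sqW0 g y : ~ (PG g /\ N y) -> sqmod (W g y) = 0.
  by move=> /W0->; exact: sqmod0.
have sqV0 g y : ~ (PG' g /\ N' y) -> sqmod (V g y) = 0.
  by move=> /V0->; exact: sqmod0.
have rnorm1 y : fsum (fun g => r ((sec y)^-1 * g)%g ^+ 2) = 1.
  by rewrite (fsum_act lmulP (sec y)^-1%g (fun g => r g ^+ 2)).
have sumW : fsum (fun w => fsum (fun g => sqmod (zeta w g))) =
    fsum (fun y => sqmod (xi y)).
  rewrite (swap (fun g y => sqmod (W g y)) _ _ fPG fN sqW0).
  apply: eq_fsum => y; rewrite -[RHS]mulr1 -(rnorm1 y) -fsumZ.
  by apply: eq_fsum => g; rewrite sqmodM sqmod_real mulrC.
have sumV : fsum (fun y => fsum (fun g => sqmod (V g y))) <=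
    C * fsum (fun y => sqmod (xi y)).
  rewrite -(swap (fun g y => sqmod (V g y)) _ _ fPG' fN' sqV0) -sumW -fsumZ.
  apply: fsum_le => [||w].
  - exact: (sup2 (fun g y => sqmod (V g y)) _ _ fPG' fN' sqV0).
  - by apply: fsuppMr; exact: (sup2 (fun g y => sqmod (W g y)) _ _ fPG fN sqW0).
  - by under eq_fsum do rewrite -zetaE; exact: HC.
(* U is made from [gop a s xi] as W is from xi, whereas V is the image of W under the diagonal
   action. Their difference Z is small since r is almost invariant. *)
pose U g y : R[i] := (r ((sec y)^-1 * g)%g)%:C%C * gop a s xi y.
pose Z g y : R[i] := \sum_(v <- s) v.1 * xi (a v.2^-1%g y) *
  (r ((sec y)^-1 * g)%g - r ((sec (a v.2^-1%g y))^-1 * (v.2^-1 * g))%g)%:C%C.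
have UVZ g y : U g y = V g y + Z g y.
  rewrite /U /V /Z /gop -big_split mulr_sumr /=; apply: eq_bigr => v _.
  by rewrite /W rmorphB /=; ring.
have rss y : fsupp (fun g => r ((sec y)^-1 * g)%g ^+ 2).
  apply: (fsupp_act lmulP (sec y)^-1%g (f := fun g => r g ^+ 2)).
  by apply: (fsuppW rs) => g ->; rewrite expr0n.
have sumU y : fsum (fun g => sqmod (U g y)) = sqmod (gop a s xi y).
  rewrite -[RHS]mulr1 -(rnorm1 y) -fsumZ.
  by apply: eq_fsum => g; rewrite sqmodM sqmod_real mulrC.
have sU y : fsupp (fun g => sqmod (U g y)).
  apply: (fsuppW (rss y)) => g; rewrite sqmodM sqmod_real => ->.
  by rewrite mul0r.
have sV y : fsupp (fun g => sqmod (V g y)).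
  by apply: (fsupp_sub fPG') => g Pg; apply: sqV0 => -[].
pose D (v : R[i] * G) y g : R :=
  (r ((sec y)^-1 * g)%g - r ((sec (a v.2^-1%g y))^-1 * (v.2^-1 * g))%g) ^+ 2.
have sD (v : R[i] * G) y : fsupp (D v y).
  have s1 := fsupp_act lmulP (sec y)^-1%g rs.
  have s2 := fsupp_act lmulP ((sec (a v.2^-1%g y))^-1 * v.2^-1)%g rs.
  apply: (fsuppW (fsuppD s1 (fsuppMr (fun=> -1) s2))) => g.
  rewrite /D /lmul !mulgA mulN1r => ->; exact: expr0n.
have De v y : v \in s -> N (a v.2^-1%g y) -> fsum (D v y) <= e.
  move=> vs Ny; have vts : v.2 \in ts by apply/mapP; exists v.
  apply: le_trans (rE _ _ vts Ny); rewrite le_eqVlt; apply/orP; left; apply/eqP.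
  rewrite -(fsum_act lmulP (sec y)); apply: eq_fsum => g.
  by rewrite /D /lmul mulKg (gactKV aP) -sqrrN opprB !mulgA.
have Zle g y : sqmod (Z g y) <=
    2 ^+ size s * \sum_(v <- s) sqmod v.1 * sqmod (xi (a v.2^-1%g y)) * D v y g.
  apply: (le_trans (sqmod_sum _ _)); rewrite ler_pM2l ?exprn_gt0//.
  by rewrite le_eqVlt; apply/orP; left; apply/eqP; apply: eq_bigr => v _;
    rewrite !sqmodM sqmod_real.
have sZ y : fsupp (fun g => sqmod (Z g y)).
  apply: (fsuppW (fsupp_sum s (fun v => fsuppMr (fun g => sqmod v.1 *
    sqmod (xi (a v.2^-1%g y))) (sD v y)))) => g H.
  by have := Zle g y; rewrite H mulr0 => ?; apply/eqP; rewrite eq_le sqmod_ge0 andbT.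
have sumZ y : fsum (fun g => sqmod (Z g y)) <=
    2 ^+ size s * \sum_(v <- s) sqmod v.1 * (e * sqmod (xi (a v.2^-1%g y))).
  apply: (@le_trans _ _ (fsum (fun g => 2 ^+ size s *
      \sum_(v <- s) sqmod v.1 * sqmod (xi (a v.2^-1%g y)) * D v y g))).
    apply: fsum_le => //; apply: fsuppMr; apply: fsupp_sum => v.
    exact: fsuppMr.
  rewrite fsumZ ler_pM2l ?exprn_gt0// fsum_sum => [|v]; last exact: fsuppMr.
  rewrite big_seq [leRHS]big_seq; apply: ler_sum => v vs.
  rewrite fsumZ -mulrA ler_wpM2l ?sqmod_ge0// mulrC.
  have [Ny|/xi0->] := pselect (N (a v.2^-1%g y)); last by rewrite sqmod0 !mulr0.
  by rewrite ler_wpM2r ?sqmod_ge0// De.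
have sxia t : fsupp (fun y => sqmod (xi (a t y))).
  by apply: (fsupp_act aP t (f := fun y => sqmod (xi y))); exact: fsupp_sqmod.
have sbig : fsupp (fun y => 2 ^+ size s *
    \sum_(v <- s) sqmod v.1 * (e * sqmod (xi (a v.2^-1%g y)))).
  by apply: fsuppMr; apply: fsupp_sum => v; do 2 apply: fsuppMr; exact: sxia.
have sVy : fsupp (fun y => fsum (fun g => sqmod (V g y))).
  exact: (sup1 (fun g y => sqmod (V g y)) _ _ fPG' fN' sqV0).
apply: (@le_trans _ _ (fsum (fun y => (1 + d) * fsum (fun g => sqmod (V g y)) +
    (1 + d^-1) * (2 ^+ size s *
    \sum_(v <- s) sqmod v.1 * (e * sqmod (xi (a v.2^-1%g y))))))).
  apply: fsum_le => [||y].
  - by apply: fsupp_sqmod; exact: gop_supp.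
  - by apply: fsuppD; apply: fsuppMr.
  rewrite -sumU; apply: (@le_trans _ _ (fsum (fun g =>
      (1 + d) * sqmod (V g y) + (1 + d^-1) * sqmod (Z g y)))).
    apply: fsum_le => // [|g]; first by apply: fsuppD; apply: fsuppMr.
    by rewrite UVZ; exact: sqmodD_le.
  rewrite fsumD ?fsumZ; [|exact: fsuppMr|exact: fsuppMr].
  by rewrite lerD2l ler_pM2l// addr_gt0// invr_gt0.
rewrite fsumD; [|exact: fsuppMr|exact: fsuppMr].
rewrite !fsumZ; apply: lerD; first by rewrite ler_pM2l// addr_gt0.
rewrite ler_pM2l; last by rewrite addr_gt0// invr_gt0.
rewrite ler_pM2l; last exact: exprn_gt0.
rewrite fsum_sum => [|v]; last by do 2 apply: fsuppMr; exact: sxia.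
apply: ler_sum => v _; rewrite !fsumZ.
by rewrite (fsum_act aP v.2^-1%g (fun y => sqmod (xi y))).
Qed.

Lemma weak_containment (s : seq (R[i] * G)) (C : R) (xi : Y -> R[i]) :
  (forall zeta : G -> R[i], fsupp zeta ->
     fsum (fun g => sqmod (gop lmul s zeta g)) <=
     C * fsum (fun g => sqmod (zeta g))) ->
  fsupp xi ->
  fsum (fun y => sqmod (gop a s xi y)) <= C * fsum (fun y => sqmod (xi y)).
Proof.
move=> HC sxi; set L := fsum _; set X := fsum _.
pose M := 2 ^+ size s * (\sum_(v <- s) sqmod v.1) * X.
have X0 : 0 <= X by apply: fsum_ge0 => y; exact: sqmod_ge0.
have M0 : 0 <= M.
  rewrite /M !mulr_ge0// ?exprn_ge0// sumr_ge0// => v _; exact: sqmod_ge0.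
have key d : 0 < d -> L <= C * X + d * (C * X + (1 + d) * M).
  (* Taking e = d^2 makes the error factor (1 + d^-1) e equal to d (1 + d), which tends to 0 with
     d. *)
  move=> d0; have d2 : 0 < d ^+ 2 by rewrite exprn_gt0.
  have := weak_containment_approx HC sxi d2 d0; rewrite -/L -/X -mulr_suml.
  have -> : (1 + d^-1) * (2 ^+ size s *
      ((\sum_(v <- s) sqmod v.1) * (d ^+ 2 * X))) = d * ((1 + d) * M).
    by rewrite /M; field; rewrite gt_eqF.
  by move=> ?; lra.
apply/ler_addgt0Pl => e e0.
pose K := `|C * X| + 2 * M + 1.
have K0 : 0 < K by rewrite /K ltr_wpDl// addr_ge0// mulr_ge0.
pose d := Num.min 1 (e / K).
have d0 : 0 < d by rewrite lt_min ltr01 divr_gt0.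
have d1 : d <= 1 by rewrite ge_min lexx.
have dK : d * K <= e by rewrite -ler_pdivlMr// ge_min lexx orbT.
apply: (le_trans (key d d0)).
have H : C * X + (1 + d) * M <= K.
  have := ler_norm (C * X); have : (1 + d) * M <= 2 * M.
    by rewrite ler_wpM2r// -lerBrDl; lra.
  by rewrite /K => ? ?; lra.
by have := ler_wpM2l (ltW d0) H => ?; lra.
Qed.

End WeakContainment.

(** * Order and norm in a C*-algebra *)

Lemma complex_gt0 (R : realType) (e : R[i]) : 0 < e ->
  exists2 r : R, 0 < r & e = r%:C%C.
Proof. by case: e => a b; rewrite ltcE /= => /andP[/eqP-> a0]; exists a. Qed.

Lemma conj_conjc (R : realType) (z : R[i]) : Num.conj z = (z^*)%C.
Proof. by []. Qed.

Section RealNorm.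
Variables (R : realType) (V : normedModType R[i]).
Implicit Types x y : V.

Lemma normE x : `|x| = (rnorm x)%:C%C.
Proof.
have /ger0_Im H := normr_ge0 x.
by rewrite /rnorm [LHS]complexE H rmorph0 mulr0 addr0.
Qed.

Lemma rnorm_ge0 x : 0 <= rnorm x.
Proof. by have := normr_ge0 x; rewrite normE ler0c. Qed.

Lemma rnorm0 : rnorm (0 : V) = 0.
Proof. by rewrite /rnorm normr0. Qed.

Lemma rnorm_eq0 x : rnorm x = 0 -> x = 0.
Proof. by move=> x0; apply/normr0_eq0; rewrite normE x0. Qed.

Lemma rnormD x y : rnorm (x + y) <= rnorm x + rnorm y.
Proof. by have := ler_normD x y; rewrite !normE -rmorphD /= lecR. Qed.

Lemma rnormN x : rnorm (- x) = rnorm x.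
Proof. by rewrite /rnorm normrN. Qed.

Lemma rdistC x y : rnorm (x - y) = rnorm (y - x).
Proof. by rewrite /rnorm distrC. Qed.

Lemma rnormB x y : rnorm (x - y) <= rnorm x + rnorm y.
Proof. by rewrite -(rnormN y); exact: rnormD. Qed.

Lemma rnormZ (c : R[i]) x : rnorm (c *: x) = Num.sqrt (sqmod c) * rnorm x.
Proof. by apply: complexI; rewrite rmorphM /= -!normE normrZ normc_def. Qed.

Lemma rnormZr (r : R) x : rnorm (r%:C%C *: x) = `|r| * rnorm x.
Proof. by rewrite rnormZ sqmod_real sqrtr_sqr. Qed.

Lemma rdist_triangle z x y : rnorm (x - y) <= rnorm (x - z) + rnorm (z - y).
Proof. by have := rnormD (x - z) (z - y); rewrite addrA subrK. Qed.

Lemma rnorm_small x K : (forall e, 0 < e -> rnorm x <= K * e) -> x = 0.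
Proof.
move=> H; apply: rnorm_eq0; apply/eqP; rewrite eq_le rnorm_ge0 andbT.
apply/ler_addgt0Pl => e e0; rewrite addr0.
have K0 : 0 < `|K| + 1 by rewrite ltr_wpDl.
have := H (e / (`|K| + 1)) (divr_gt0 e0 K0); move=> /le_trans; apply.
rewrite mulrCA ger_pMr// ler_pdivrMr// mul1r.
by have := ler_norm K; lra.
Qed.

Definition rclose (u : nat -> V) (l : V) :=
  forall e, 0 < e -> exists N, forall n, (N <= n)%N -> rnorm (u n - l) < e.

Lemma nbhs_rnormP x (D : set V) : nbhs x D <->
  exists2 e, 0 < e & forall y, rnorm (x - y) < e -> D y.
Proof.
split=> [/nbhs_ballP[e /= e0 De]|[e e0 De]].
  have [r r0 er] := complex_gt0 e0.
  by exists r => // y xy; apply: De; rewrite -ball_normE/= er normE ltcR.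
apply/nbhs_ballP; exists e%:C%C; first by rewrite /= ltcR.
by move=> y; rewrite -ball_normE/= normE ltcR; exact: De.
Qed.

Lemma closureP (D : set V) x : closure D x <->
  forall e, 0 < e -> exists2 y, D y & rnorm (x - y) < e.
Proof.
split=> [Dx e e0|H B /nbhs_rnormP[e e0 Be]].
  have [|y [Dy xy]] := Dx [set y | rnorm (x - y) < e].
    by apply/nbhs_rnormP; exists e.
  by exists y.
by have [y Dy xy] := H e e0; exists y; split=> //; exact: Be.
Qed.

Lemma closed_rnormP (D : set V) : closed D <-> forall x,
  (forall e, 0 < e -> exists2 y, D y & rnorm (x - y) < e) -> D x.
Proof.
split=> [Dc x H|H]; first by apply: Dc; exact/closureP.
by move=> x /closureP; exact: H.
Qed.

End RealNorm.

Lemma rcauchy_cvg (R : realType) (V : completeNormedModType R[i]) (u : nat -> V) :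
  (forall e, 0 < e -> exists N, forall m n, (N <= m)%N -> (N <= n)%N ->
    rnorm (u m - u n) < e) -> exists l, rclose u l.
Proof.
move=> H; have /cauchy_cvg ucvg : cauchy (u @ \oo).
  apply: cauchy_exP => e /complex_gt0[r r0 ->].
  have [N HN] := H _ r0; exists (u N); exists N => //= n Nn.
  by rewrite -ball_normE/= normE ltcR; exact: HN.
exists (lim (u @ \oo)) => e e0.
have /nbhs_rnormP : nbhs (lim (u @ \oo)) [set y | rnorm (lim (u @ \oo) - y) < e].
  by apply/nbhs_rnormP; exists e.
move=> /nbhs_rnormP/ucvg[N _ HN]; exists N => n Nn.
by rewrite rdistC; exact: HN.
Qed.

Lemma rnorm_complex (R : realType) (c : R[i]^o) : rnorm c ^+ 2 = sqmod c.
Proof.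
have -> : rnorm c = Num.sqrt (sqmod c).
  by apply: complexI; rewrite -normE; exact: normc_def.
by rewrite sqr_sqrtr ?sqmod_ge0.
Qed.

Section CStarBasics.
Variables (R : realType) (A : cstarType R).
Implicit Types (x y z a b c : A) (r s t T : R).

Lemma cmul0 x : x ** 0 = 0.
Proof. by apply: (addrI (x ** 0)); rewrite -cmulDr !addr0. Qed.

Lemma c0mul x : 0 ** x = 0.
Proof. by apply: (addrI (0 ** x)); rewrite -cmulDl !addr0. Qed.

Lemma cmulN x y : x ** - y = - (x ** y).
Proof. by apply/eqP; rewrite -addr_eq0 -cmulDr addNr cmul0. Qed.

Lemma cNmul x y : - x ** y = - (x ** y).
Proof. by apply/eqP; rewrite -addr_eq0 -cmulDl addNr c0mul. Qed.

Lemma cmulBr x y z : x ** (y - z) = x ** y - x ** z.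
Proof. by rewrite cmulDr cmulN. Qed.

Lemma cmulBl x y z : (x - y) ** z = x ** z - y ** z.
Proof. by rewrite cmulDl cNmul. Qed.

Lemma star0 : star (0 : A) = 0.
Proof. by apply: (addrI (star 0)); rewrite -starD !addr0. Qed.

Lemma starN x : star (- x) = - star x.
Proof. by apply/eqP; rewrite -addr_eq0 -starD addNr star0. Qed.

Lemma starB x y : star (x - y) = star x - star y.
Proof. by rewrite starD starN. Qed.

Lemma starZr r x : star (r%:C%C *: x) = r%:C%C *: star x.
Proof. by rewrite starZ conj_conjc conjc_real. Qed.

Lemma star1 : star (1c : A) = 1c.
Proof. by rewrite -[RHS]starK -[in RHS](cmul1 (star 1c)) starM starK cmul1. Qed.

Lemma rnormM x y : rnorm (x ** y) <= rnorm x * rnorm y.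
Proof. by have := cnormM x y; rewrite !normE -rmorphM /= lecR. Qed.

Lemma rnorm_starl x : rnorm (star x ** x) = rnorm x ^+ 2.
Proof. by apply: complexI; rewrite rmorphXn /= -!normE cnorm_star. Qed.

Lemma rnorm_star x : rnorm (star x) = rnorm x.
Proof.
have H y : rnorm y <= rnorm (star y).
  have [y0|y0] := eqVneq (rnorm y) 0; first by rewrite y0 rnorm_ge0.
  have yp : 0 < rnorm y by rewrite lt0r y0 rnorm_ge0.
  by rewrite -(ler_pM2r yp) -expr2 -rnorm_starl; exact: rnormM.
by apply/eqP; rewrite eq_le H andbT -{2}(starK x) H.
Qed.

Lemma rnorm_sq a : star a = a -> rnorm (a ** a) = rnorm a ^+ 2.
Proof. by move=> sa; rewrite -{1}sa rnorm_starl. Qed.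

Lemma rnorm1 : rnorm (1c : A) = 1.
Proof.
have := rnorm_sq star1; rewrite cmul1 => /esym/eqP.
rewrite -subr_eq0 expr2 -[X in _ - X]mulr1 -mulrBr mulf_eq0 subr_eq0.
by move=> /orP[/eqP/rnorm_eq0/eqP|/eqP//]; rewrite (negPf cone_neq0).
Qed.

Definition creal T : A := T%:C%C *: 1c.

Lemma crealD s t : creal (s + t) = creal s + creal t.
Proof. by rewrite /creal rmorphD /= scalerDl. Qed.

Lemma crealN t : creal (- t) = - creal t.
Proof. by rewrite /creal rmorphN /= scaleNr. Qed.

Lemma crealB s t : creal (s - t) = creal s - creal t.
Proof. by rewrite crealD crealN. Qed.

Lemma creal1 : creal 1 = 1c. Proof. by rewrite /creal rmorph1 scale1r. Qed.

Lemma creal0 : creal 0 = 0. Proof. by rewrite /creal rmorph0 scale0r. Qed.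

Lemma crealZ s t : s%:C%C *: creal t = creal (s * t).
Proof. by rewrite /creal scalerA -rmorphM. Qed.

Lemma mul_creal t x : x ** creal t = t%:C%C *: x.
Proof. by rewrite /creal cmulZr cmulr1. Qed.

Lemma star_creal t : star (creal t) = creal t.
Proof. by rewrite /creal starZr star1. Qed.

Lemma rnorm_creal t : rnorm (creal t) = `|t|.
Proof. by rewrite /creal rnormZr rnorm1 mulr1. Qed.

Lemma commB1 z x : z ** x = x ** z -> z ** (1c - x) = (1c - x) ** z.
Proof. by move=> zx; rewrite cmulBr cmulBl cmulr1 cmul1 zx. Qed.

Lemma commZ z x (k : R[i]) : z ** x = x ** z -> z ** (k *: x) = (k *: x) ** z.
Proof. by move=> zx; rewrite cmulZr cmulZl zx. Qed.

Lemma commM z x y : z ** x = x ** z -> z ** y = y ** z ->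
  z ** (x ** y) = (x ** y) ** z.
Proof. by move=> zx zy; rewrite cmulA zx -cmulA zy cmulA. Qed.

Section SquareRoot.
Variable x : A.
Hypotheses (sx : star x = x) (x1 : rnorm x <= 1).

(* Newton-like iteration for the solution y of y = (x + y^2)/2, that is of
   (1 - y)^2 = 1 - x; sqrt_bound is the same iteration for x = 1. *)
Fixpoint sqrt_iter n : A :=
  if n is m.+1 then (2^-1 : R)%:C%C *: (x + sqrt_iter m ** sqrt_iter m) else 0.

Fixpoint sqrt_bound n : R :=
  if n is m.+1 then 2^-1 * (1 + sqrt_bound m ^+ 2) else 0.

Let bound01 n : 0 <= sqrt_bound n <= 1.
Proof.
elim: n => [|n /andP[s0 s1]] /=; first by rewrite lexx ler01.
have : sqrt_bound n ^+ 2 <= 1 by rewrite expr_le1.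
have := sqr_ge0 (sqrt_bound n) => ? ?; lra.
Qed.

Let bound_incr n : sqrt_bound n <= sqrt_bound n.+1.
Proof. by have := sqr_ge0 (1 - sqrt_bound n) => /= ?; lra. Qed.

Let iter_comm z : z ** x = x ** z -> forall n,
  z ** sqrt_iter n = sqrt_iter n ** z.
Proof.
move=> zx; elim=> [|n IH] /=; first by rewrite cmul0 c0mul.
by apply: commZ; rewrite cmulDr cmulDl zx (commM IH IH).
Qed.

Let iter_star n : star (sqrt_iter n) = sqrt_iter n.
Proof. by elim: n => [|n IH] /=; rewrite ?star0// starZr starD sx starM IH. Qed.

Let iter_bound n : rnorm (sqrt_iter n) <= sqrt_bound n.
Proof.
elim: n => [|n IH] /=; first by rewrite rnorm0.
rewrite rnormZr ger0_norm ?invr_ge0// ler_pM2l ?invr_gt0//.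
apply: (le_trans (rnormD _ _)); apply: lerD => //.
by apply: (le_trans (rnormM _ _)); rewrite expr2 ler_pM// rnorm_ge0.
Qed.

Let iter_step n :
  rnorm (sqrt_iter n.+1 - sqrt_iter n) <= sqrt_bound n.+1 - sqrt_bound n.
Proof.
elim: n => [|n IH].
  rewrite /= cmul0 addr0 subr0 rnormZr expr0n addr0 mulr1 subr0.
  by rewrite ger0_norm ?invr_ge0// ger_pMr ?invr_gt0.
pose u := sqrt_iter n.+1; pose v := sqrt_iter n.
have uv : v ** u = u ** v.
  by apply: iter_comm; apply/esym; apply: iter_comm.
have -> : sqrt_iter n.+2 - u = (2^-1 : R)%:C%C *: ((u + v) ** (u - v)).
  rewrite [sqrt_iter n.+2]/= -/u {2}/u /= -/v -scalerBr; congr (_ *: _).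
  rewrite opprD addrACA subrr add0r cmulDl !cmulBr uv.
  by rewrite addrA subrK.
have -> : sqrt_bound n.+2 - sqrt_bound n.+1 =
    2^-1 * ((sqrt_bound n.+1 + sqrt_bound n) * (sqrt_bound n.+1 - sqrt_bound n)).
  by rewrite [LHS](_ : _ = 2^-1 * (1 + sqrt_bound n.+1 ^+ 2) -
    2^-1 * (1 + sqrt_bound n ^+ 2))//; ring.
rewrite rnormZr ger0_norm ?invr_ge0// ler_pM2l ?invr_gt0//.
apply: (le_trans (rnormM _ _)); apply: ler_pM => //; try exact: rnorm_ge0.
by apply: (le_trans (rnormD _ _)); apply: lerD; exact: iter_bound.
Qed.

Let iter_dist m n : (n <= m)%N ->
  rnorm (sqrt_iter m - sqrt_iter n) <= sqrt_bound m - sqrt_bound n.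
Proof.
move=> nm; rewrite -(subnK nm); elim: (m - n)%N => [|k IH].
  by rewrite add0n !subrr rnorm0.
apply: (le_trans (rdist_triangle (sqrt_iter (k + n)) _ _)).
by have := iter_step (k + n); rewrite addSn => ?; lra.
Qed.

Let bound_mono m n : (n <= m)%N -> sqrt_bound n <= sqrt_bound m.
Proof. exact: (homo_leq (r := fun s t : R => s <= t) (@lexx _ _) (@le_trans _ _) bound_incr). Qed.

(** The differences of successive iterates are bounded by those of [sqrt_bound], which increases and
    stays at most 1, so the iterates form a Cauchy sequence. Commutation with z passes from the
    iterates to the limit. *)
Lemma sqrt_exists : exists b, [/\ star b = b, b ** b = 1c - x,
  rnorm (1c - b) <= 1 & forall z, z ** x = x ** z -> z ** b = b ** z].
Proof.
have [|y yl] := @rcauchy_cvg R A sqrt_iter.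
  move=> e e0.
  have hs : has_sup (range sqrt_bound).
    split; first by exists 0, 0%N.
    by exists 1 => _ [n _ <-]; case/andP: (bound01 n).
  have [_ [N _ <-] Ne] := sup_adherent e0 hs; exists N.
  have key m n : (n <= m)%N -> (N <= n)%N ->
      rnorm (sqrt_iter m - sqrt_iter n) < e.
    move=> nm Nn; apply: (le_lt_trans (iter_dist nm)).
    have := bound_mono Nn.
    have : sqrt_bound m <= sup (range sqrt_bound).
      by apply: ub_le_sup; [case: hs|exists m].
    by move=> ? ?; lra.
  move=> m n Nm Nn; have [nm|/ltnW mn] := leqP n m; first exact: key.
  by rewrite rdistC; exact: key.
have ylim e : 0 < e -> exists n, rnorm (sqrt_iter n - y) < e /\
    rnorm (sqrt_iter n.+1 - y) < e.
  by move=> /yl[N HN]; exists N; split; apply: HN.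
have sy : star y = y.
  apply/eqP; rewrite -subr_eq0; apply/eqP; apply: (rnorm_small (K := 2)).
  move=> e /ylim[n [ne _]].
  apply: (le_trans (rdist_triangle (sqrt_iter n) _ _)).
  by rewrite -{1}(iter_star n) -starB rnorm_star rdistC; lra.
have yn : rnorm y <= 1.
  apply/ler_addgt0Pl => e /ylim[n [ne _]].
  have := rnormD (y - sqrt_iter n) (sqrt_iter n); rewrite subrK rdistC.
  have := iter_bound n; have /andP[_] := bound01 n => *; lra.
have yE : y = (2^-1 : R)%:C%C *: (x + y ** y).
  apply/eqP; rewrite -subr_eq0; apply/eqP; apply: (rnorm_small (K := 2)).
  move=> e /ylim[n [ne n1e]].
  apply: (le_trans (rdist_triangle (sqrt_iter n.+1) _ _)).
  suff : rnorm (sqrt_iter n.+1 - (2^-1 : R)%:C%C *: (x + y ** y)) <= e.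
    by rewrite rdistC => ?; lra.
  rewrite /= -scalerBr opprD addrACA subrr add0r rnormZr.
  rewrite ger0_norm ?invr_ge0// ler_pdivrMl//.
  have -> : sqrt_iter n ** sqrt_iter n - y ** y =
      sqrt_iter n ** (sqrt_iter n - y) + (sqrt_iter n - y) ** y.
    by rewrite cmulBr cmulBl addrA subrK.
  apply: (le_trans (rnormD _ _)); rewrite mulr_natl mulr2n.
  have n1 : rnorm (sqrt_iter n) <= 1.
    by apply: (le_trans (iter_bound n)); case/andP: (bound01 n).
  have := rnormM (sqrt_iter n) (sqrt_iter n - y).
  have := rnormM (sqrt_iter n - y) y.
  have := ler_piMl (rnorm_ge0 (sqrt_iter n - y)) n1.
  have := ler_piMr (rnorm_ge0 (sqrt_iter n - y)) yn.
  by move=> *; lra.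
exists (1c - y); split.
- by rewrite starB star1 sy.
- have E : y + y = x + y ** y.
    rewrite {1 2}yE -scalerDl -rmorphD /=.
    by rewrite (_ : 2^-1 + 2^-1 = 1 :> R) ?rmorph1 ?scale1r//; lra.
  rewrite cmulBr !cmulBl !cmulr1 !cmul1.
  have -> : x = y + y - y ** y by rewrite E addrK.
  by rewrite !opprB opprD !addrA [X in X - y = _]addrAC.
- by rewrite opprB addrC subrK.
- move=> z zx; apply: commB1.
  apply/eqP; rewrite -subr_eq0; apply/eqP.
  apply: (rnorm_small (K := 2 * rnorm z)) => e /ylim[n [ne _]].
  apply: (le_trans (rdist_triangle (z ** sqrt_iter n) _ _)).
  rewrite -cmulBr (iter_comm zx n) -cmulBl.
  have := rnormM z (y - sqrt_iter n); have := rnormM (sqrt_iter n - y) z.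
  have := ler_wpM2l (rnorm_ge0 z) (ltW ne).
  by rewrite (rdistC y) mulrC => *; lra.
Qed.

End SquareRoot.

End CStarBasics.

(** * Positivity and square roots without spectral theory *)

Section Positivity.
Variables (R : realType) (A : cstarType R).
Implicit Types (x y z a b c : A) (r s t T : R).

(** For selfadjoint a this norm condition says that the spectrum is nonnegative. In this form sums
    of positive elements are positive at once, whereas the positivity of x^* x becomes a theorem;
    [cposP] identifies it with [cpos]. *)
Definition spos a := star a = a /\ exists T, rnorm (creal A T - a) <= T.

Lemma spos_creal T : 0 <= T -> spos (creal A T).
Proof.
by move=> T0; split; [exact: star_creal|exists T; rewrite subrr rnorm0].
Qed.

Lemma spos0 : spos 0.
Proof. by rewrite -(creal0 A); exact: spos_creal. Qed.

Lemma spos_sqrt a : spos a -> exists b, [/\ star b = b, b ** b = a, spos b &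
  forall z, z ** a = a ** z -> z ** b = b ** z].
Proof.
move=> [sa [T aT]]; have T0 : 0 <= T by apply: le_trans aT; exact: rnorm_ge0.
have [T0'|Tp] := eqVneq T 0.
  move: aT; rewrite T0' creal0 sub0r rnormN => a0.
  have -> : a = 0 by apply: rnorm_eq0; apply/eqP; rewrite eq_le a0 rnorm_ge0.
  exists 0; split; [exact: star0|exact: cmul0|exact: spos0|].
  by move=> z; rewrite cmul0 c0mul.
have {}Tp : 0 < T by rewrite lt0r Tp.
pose x := 1c - (T^-1)%:C%C *: a.
have sx : star x = x by rewrite starB star1 starZr sa.
have xE : x = (T^-1)%:C%C *: (creal A T - a).
  by rewrite scalerBr crealZ mulVf ?gt_eqF// creal1.
have x1 : rnorm x <= 1.
  rewrite xE rnormZr ger0_norm ?invr_ge0 ?(ltW Tp)//.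
  by rewrite ler_pdivrMl// mulr1.
have [b [sb bb b1 bc]] := sqrt_exists sx x1.
exists ((Num.sqrt T)%:C%C *: b); split.
- by rewrite starZr sb.
- rewrite cmulZl cmulZr scalerA -rmorphM /= -expr2 sqr_sqrtr// bb.
  by rewrite opprB addrC subrK scalerA -rmorphM /= mulfV ?gt_eqF// rmorph1 scale1r.
- split; first by rewrite starZr sb.
  exists (Num.sqrt T); rewrite -[creal A _]/(_ *: _) -scalerBr rnormZr.
  by rewrite ger0_norm ?sqrtr_ge0// ger_pMr ?sqrtr_gt0.
- by move=> z za; apply: commZ; apply: bc; apply: commB1; exact: commZ.
Qed.

Definition ci : R[i] := 'i%C.

Lemma ci_sq : ci * ci = -1. Proof. by rewrite -expr2 sqr_i. Qed.

Lemma ci_conj : ((ci : R[i])^* = - ci)%C.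
Proof. by rewrite /ci; apply/eqP; rewrite eq_complex /= oppr0 !eqxx. Qed.

(* c + is is unitary, and c, s are its real and imaginary parts. *)
Lemma unitary_parts c (s : A) : star c = c -> star s = s -> c ** s = s ** c ->
  c ** c + s ** s = 1c -> rnorm c <= 1 /\ rnorm s <= 1.
Proof.
move=> sc ss cs E.
pose u := c + ci *: s; pose v := c - ci *: s.
have su : star u = v by rewrite starD starZ sc ss conj_conjc ci_conj scaleNr.
have vu : v ** u = 1c.
  rewrite -E cmulBl !cmulDr !cmulZl !cmulZr scalerA ci_sq cs scaleN1r.
  by rewrite opprD opprK !addrA addrK.
have u1 : rnorm u = 1.
  have := rnorm_starl u; rewrite su vu rnorm1 => /esym/eqP.
  by rewrite sqrf_eq1 => /orP[/eqP//|/eqP u1]; have := rnorm_ge0 u; lra.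
have v1 : rnorm v = 1 by rewrite -su rnorm_star.
have half (w : A) (k : R[i]) : sqmod k = 1 -> k *: (w + w) = (u + v) \/
    k *: (w + w) = u - v -> rnorm w <= 1.
  move=> k1 H; have : rnorm (k *: (w + w)) <= 2.
    by case: H => ->; [have := rnormD u v|have := rnormB u v] => ?; lra.
  rewrite rnormZ k1 sqrtr1 mul1r.
  have -> : w + w = (2 : R)%:C%C *: w.
    by rewrite (_ : 2 = 1 + 1 :> R)// rmorphD rmorph1 /= scalerDl scale1r.
  by rewrite rnormZr ger0_norm// => ?; lra.
split.
  apply: (half _ 1); first by rewrite /sqmod /= expr1n expr0n addr0.
  by left; rewrite scale1r /u /v addrACA subrr addr0.
apply: (half _ ci); first by rewrite /sqmod /= expr1n expr0n add0r.
by right; rewrite /u /v opprB [RHS]addrC addrA subrK -scalerDr.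
Qed.

(** After rescaling, 1 - c^2 is a square s^2 and c + is is unitary, so that s has norm at most 1 by
    [unitary_parts]. *)
Lemma sq_dist b T : star b = b -> rnorm b ^+ 2 <= T ->
  rnorm (creal A T - b ** b) <= T.
Proof.
move=> sb bT; have T0 : 0 <= T by apply: le_trans bT; exact: sqr_ge0.
have [T0'|Tp] := eqVneq T 0.
  move: bT; rewrite T0' => b0; have -> : b = 0.
    by apply: rnorm_eq0; apply/eqP; rewrite -sqrf_eq0 eq_le b0 sqr_ge0.
  by rewrite cmul0 subr0 creal0 rnorm0.
have {}Tp : 0 < T by rewrite lt0r Tp.
have sT0 : 0 < Num.sqrt T by rewrite sqrtr_gt0.
pose c := ((Num.sqrt T)^-1)%:C%C *: b.
have sc : star c = c by rewrite starZr sb.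
have cc : c ** c = (T^-1)%:C%C *: (b ** b).
  rewrite cmulZl cmulZr scalerA -rmorphM /= -invfM -expr2 sqr_sqrtr//.
have c1 : rnorm (c ** c) <= 1.
  rewrite cc rnormZr rnorm_sq// ger0_norm ?invr_ge0//.
  by rewrite ler_pdivrMl// mulr1.
have scc : star (c ** c) = c ** c by rewrite starM sc.
have [s [ss sE _ scomm]] := sqrt_exists scc c1.
have [|_ s1] := unitary_parts sc ss (scomm c (cmulA _ _ _)).
  by rewrite sE addrC subrK.
have -> : creal A T - b ** b = T%:C%C *: (s ** s).
  rewrite sE cc scalerBr -/(creal A T) scalerA -rmorphM /= mulfV ?gt_eqF//.
  by rewrite rmorph1 scale1r.
rewrite rnormZr ger0_norm// rnorm_sq// ger_pMr//.
by rewrite expr_le1// rnorm_ge0.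
Qed.

Lemma spos_sq b : star b = b -> spos (b ** b).
Proof.
move=> sb; split; first by rewrite starM sb.
by exists (rnorm b ^+ 2); exact: sq_dist.
Qed.

Lemma spos_dist a T : spos a -> rnorm a <= T -> rnorm (creal A T - a) <= T.
Proof.
by move=> /spos_sqrt[b [sb <- _ _]]; rewrite rnorm_sq// => bT; exact: sq_dist.
Qed.

Lemma sposD a b : spos a -> spos b -> spos (a + b).
Proof.
move=> [sa [T aT]] [sb [S bS]]; split; first by rewrite starD sa sb.
exists (T + S); rewrite crealD opprD addrACA.
by apply: (le_trans (rnormD _ _)); rewrite lerD.
Qed.

Lemma sposZ r a : 0 <= r -> spos a -> spos (r%:C%C *: a).
Proof.
move=> r0 [sa [T aT]]; split; first by rewrite starZr sa.
exists (r * T); rewrite -crealZ -scalerBr rnormZr ger0_norm//.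
by rewrite ler_wpM2l.
Qed.

Lemma spos_sum (I : Type) (r : seq I) (F : I -> A) :
  (forall k, spos (F k)) -> spos (\sum_(k <- r) F k).
Proof.
move=> F0; elim: r => [|k r IH].
  by rewrite big_nil -(creal0 A); exact: spos_creal.
by rewrite big_cons; exact: sposD.
Qed.

(** By [spos_dist] the radius in [spos] can be chosen near rnorm a for all approximants, so the
    condition passes to the limit. *)
Lemma spos_limit a : (forall e, 0 < e -> exists2 b, spos b & rnorm (a - b) < e) ->
  spos a.
Proof.
move=> H; split.
  apply/eqP; rewrite -subr_eq0; apply/eqP; apply: (rnorm_small (K := 2)).
  move=> e /H[b [sb _] ab].
  apply: (le_trans (rdist_triangle b _ _)).
  by rewrite -{1}sb -starB rnorm_star (rdistC b a); lra.
exists (rnorm a); apply/ler_addgt0Pl => e e0.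
have [b bp ab] := H (e / 3) (divr_gt0 e0 (ltr0n _ 3)).
have b_le : rnorm b <= rnorm a + e / 3.
  have := rnormB a (a - b); rewrite opprB addrC subrK => ?; lra.
have := spos_dist bp b_le.
have : rnorm (creal A (rnorm a) - a - (creal A (rnorm a + e / 3) - b)) <=
    e / 3 + e / 3.
  rewrite crealD [X in rnorm X](_ : _ = - creal A (e / 3) - (a - b)).
    apply: (le_trans (rnormB _ _)); rewrite rnormN rnorm_creal.
    by rewrite ger0_norm ?divr_ge0 ?(ltW e0)//; lra.
  rewrite -[X in _ - X = _]addrA opprD addrACA subrr add0r !opprB.
  by rewrite addrCA [RHS]addrCA [- a - _]addrC.
have := rnormD (creal A (rnorm a) - a - (creal A (rnorm a + e / 3) - b))
  (creal A (rnorm a + e / 3) - b).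
by rewrite subrK => *; lra.
Qed.

Lemma sposB_norm a T : star a = a -> rnorm a <= T -> spos (creal A T - a).
Proof.
move=> sa aT; split; first by rewrite starB star_creal sa.
by exists T; rewrite opprB addrC subrK.
Qed.

Lemma sposD_norm a T : star a = a -> rnorm a <= T -> spos (creal A T + a).
Proof.
by move=> sa aT; have := @sposB_norm (- a) T; rewrite starN sa rnormN opprK; apply.
Qed.

(** After rescaling to T = 1, take the square roots b of 1 - a and c of 1 + a, which commute. Then
    (bc)^2 = 1 - a^2, so a is the real part of the unitary a + i bc. *)
Lemma norm_le_of_spos a T : 0 < T -> spos (creal A T - a) ->
  spos (creal A T + a) -> rnorm a <= T.
Proof.
move=> T0 p1 p2; wlog T1 : a T T0 p1 p2 / T = 1 => [W|].
  have Ti : 0 <= T^-1 by rewrite invr_ge0 ltW.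
  have := W ((T^-1)%:C%C *: a) 1 ltr01.
  rewrite rnormZr ger0_norm// ler_pdivrMl// mulr1; apply=> //.
    have := sposZ Ti p1; rewrite scalerBr crealZ mulVf ?gt_eqF//.
  by have := sposZ Ti p2; rewrite scalerDr crealZ mulVf ?gt_eqF.
rewrite T1 !creal1 in p1 p2 *.
have [sp1 _] := p1.
have sa : star a = a.
  by move: sp1; rewrite starB star1 => /addrI/oppr_inj.
have [b [sb bb _ bc]] := spos_sqrt p1; have [c [sc cc _ cc']] := spos_sqrt p2.
have ba : b ** a = a ** b.
  have := commB1 (esym (bc (1c - a) erefl)).
  have H : b ** (1c - a) = (1c - a) ** b by rewrite -bb cmulA.
  move: H; rewrite cmulBr cmulBl cmulr1 cmul1 => /addrI/oppr_inj.
  by [].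
have bc1 : b ** c = c ** b.
  by apply: cc'; rewrite cmulDr cmulDl cmulr1 cmul1 ba.
have ac : a ** c = c ** a.
  by apply: cc'; rewrite cmulDr cmulDl cmulr1 cmul1.
have se : star (b ** c) = b ** c by rewrite starM sb sc bc1.
have ae : a ** (b ** c) = (b ** c) ** a by apply: commM.
have [|//] := unitary_parts sa se ae.
have -> : b ** c ** (b ** c) = (b ** b) ** (c ** c).
  by rewrite -!cmulA [c ** (b ** c)]cmulA -bc1 !cmulA.
rewrite bb cc cmulBl cmul1 cmulDr cmulr1 opprD.
by rewrite [X in _ + X]addrA addrK addrCA subrr addr0.
Qed.

Lemma spos_le_norm a T : spos a -> spos (creal A T - a) -> 0 <= T -> rnorm a <= T.
Proof.
move=> ap Ta T0; apply/ler_addgt0Pl => e e0.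
have Te : 0 < e + T by rewrite ltr_pwDl.
apply: norm_le_of_spos => //.
  by rewrite crealD -addrA; apply: sposD => //; apply: spos_creal; exact: ltW.
by apply: sposD => //; apply: spos_creal; exact: ltW.
Qed.

Lemma spos_anti a : spos a -> spos (- a) -> a = 0.
Proof.
move=> p1 p2; apply: (rnorm_small (K := 1)) => e e0; rewrite mul1r.
by apply: norm_le_of_spos => //; apply: sposD => //; apply: spos_creal; exact: ltW.
Qed.

Lemma spos_opp_sq b : star b = b -> spos (- (b ** b)) -> b = 0.
Proof.
move=> sb /(spos_anti (spos_sq sb)) b0; apply: rnorm_eq0.
by apply/eqP; rewrite -sqrf_eq0 -rnorm_sq// b0 rnorm0.
Qed.

(* With k = |a| - a and j the product of k and the square root of |a|. *)
Lemma negative_part a : star a = a -> exists k j,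
  [/\ star k = k, star j = j, k ** a ** k = - (j ** j) & j = 0 -> spos a].
Proof.
move=> sa; have [m [sm mm mp mc]] := spos_sqrt (spos_sq sa).
have [l [sl ll _ lc]] := spos_sqrt mp.
have am : a ** m = m ** a by apply: mc; rewrite cmulA.
pose k := m - a.
have sk : star k = k by rewrite starB sm sa.
have km : k ** m = m ** k by rewrite cmulBl cmulBr am.
have kl : k ** l = l ** k by exact: lc.
have ka : k ** a = - (m ** k).
  by rewrite cmulBl cmulBr -mm opprB.
exists k, (l ** k); split=> //.
- by rewrite starM sl sk kl.
- by rewrite ka cNmul -ll !cmulA -[l ** k ** l]cmulA kl !cmulA.
- move=> lk0; have mk : m ** k = 0 by rewrite -ll -cmulA lk0 cmul0.
  have kk : k ** k = 0.
    by rewrite {2}/k cmulBr km ka mk oppr0 subr0.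
  have k0 : k = 0.
    by apply: rnorm_eq0; apply/eqP; rewrite -sqrf_eq0 -rnorm_sq// kk rnorm0.
  by move/eqP: k0; rewrite subr_eq0 => /eqP <-.
Qed.

Lemma half_double x : (2^-1 : R)%:C%C *: (x + x) = x.
Proof.
rewrite -{1 2}[x]scale1r -scalerDl scalerA -(rmorph1 (real_complex R)).
by rewrite -rmorphD -rmorphM /= (_ : 2^-1 * (1 + 1) = 1 :> R) ?scale1r//; lra.
Qed.

(** With p and q twice the real and imaginary parts of y, up to sign, p^2 + q^2 is twice the sum of
    y^* y and y y^*. *)
Lemma star_swap_spos y : spos (- (star y ** y)) -> spos (y ** star y).
Proof.
move=> yp; pose p := y + star y; pose q := ci *: (y - star y).
have sp : star p = p by rewrite starD starK addrC.
have sq : star q = q.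
  by rewrite starZ starB starK conj_conjc ci_conj scaleNr -scalerN opprB.
have E : p ** p + q ** q = (star y ** y + star y ** y) +
    (y ** star y + y ** star y).
  have zsum (u v w t : A) :
      u + v + (w + t) + (w - t + (v - u)) = w + w + (v + v).
    have e1 : u + v + (v - u) = v + v.
      by rewrite [u + v]addrC addrACA subrr addr0.
    have e2 : w + t + (w - t) = w + w by rewrite addrACA subrr addr0.
    by rewrite [w - t + _]addrC addrACA e1 e2 addrC.
  rewrite /p /q cmulZl cmulZr scalerA ci_sq scaleN1r.
  by rewrite cmulBl !cmulBr cmulDl !cmulDr !opprB zsum.
have -> : y ** star y = (2^-1 : R)%:C%C *: (p ** p + q ** q + (- (star y ** y) - star y ** y)).
  by rewrite E addrAC -opprD subrr add0r half_double.
apply: sposZ; first by rewrite invr_ge0.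
by apply: sposD; [apply: sposD; exact: spos_sq|exact: sposD].
Qed.

(** If x^* x were not positive, its negative part would give y with y^* y = - f^2 and |f| = 1. Then
    w = y y^* is positive by [star_swap_spos] and of norm at most 1, so z = y (1 + f^2) = (1 - w) y
    has norm at most 1. But z^* z = - (f + f^3)^2, whose norm is at least that of 2 f^4, namely
    2. *)
Lemma kaplansky x : spos (star x ** x).
Proof.
have sa : star (star x ** x) = star x ** x by rewrite starM starK.
have [k [j [sk sj kak j0]]] := negative_part sa.
apply: j0; apply: contrapT => jn0.
have n0 : 0 < rnorm j.
  by rewrite lt0r rnorm_ge0 andbT; apply/eqP => /rnorm_eq0.
pose n := (rnorm j)^-1; have nn : 0 <= n by rewrite invr_ge0 ltW.
pose y := n%:C%C *: (x ** k); pose f := n%:C%C *: j.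
have sf : star f = f by rewrite starZr sj.
have f1 : rnorm f = 1 by rewrite rnormZr ger0_norm// mulVf// gt_eqF.
have yy : star y ** y = - (f ** f).
  rewrite starZr starM sk !cmulZl !cmulZr -scalerN -scalerN; congr (_ *: (_ *: _)).
  by rewrite -kak !cmulA.
have yp : spos (- (star y ** y)) by rewrite yy opprK; exact: spos_sq.
have wp := star_swap_spos yp; set w := y ** star y in wp.
have w1 : rnorm w <= 1.
  have := rnorm_starl (star y); rewrite starK -/w => ->.
  by rewrite rnorm_star -rnorm_starl yy rnormN rnorm_sq// f1 expr1n.
have := spos_dist wp w1; rewrite creal1 => w1'.
pose g := f + f ** f ** f.
have sg : star g = g by rewrite starD !starM sf cmulA.
pose z := y ** (1c + f ** f).
have zE : z = (1c - w) ** y.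
  rewrite /z -[f ** f]opprK -yy cmulDr cmulN cmulBl cmulr1 cmul1.
  by rewrite cmulA.
have y1 : rnorm y = 1.
  have := rnorm_starl y; rewrite yy rnormN rnorm_sq// f1 expr1n => /esym/eqP.
  by rewrite sqrf_eq1 => /orP[/eqP//|/eqP yn]; have := rnorm_ge0 y; lra.
have z1 : rnorm z <= 1.
  by rewrite zE; apply: (le_trans (rnormM _ _)); rewrite y1 mulr1.
have zz : star z ** z = - (g ** g).
  rewrite /z starM starD star1 starM sf -cmulA (cmulA (star y)) yy.
  rewrite cNmul cmulN; congr (- _).
  have gl : g = (1c + f ** f) ** f by rewrite cmulDl cmul1.
  have gr : g = f ** (1c + f ** f) by rewrite cmulDr cmulr1 cmulA.
  by transitivity ((1c + f ** f) ** f ** (f ** (1c + f ** f)));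
    [rewrite !cmulA|rewrite -gl -gr].
have g1 : rnorm (g ** g) <= 1.
  have -> : rnorm (g ** g) = rnorm z ^+ 2 by rewrite -rnorm_starl zz rnormN.
  by rewrite expr_le1// rnorm_ge0.
have sgg : star (g ** g) = g ** g by rewrite starM sg.
have p1 := sposB_norm sgg g1; rewrite creal1 in p1.
pose f2 := f ** f; have sf2 : star f2 = f2 by rewrite starM sf.
pose f3 := f ** f ** f; have sf3 : star f3 = f3 by rewrite !starM sf cmulA.
have gg : g ** g = f2 + f3 ** f3 + (f2 ** f2 + f2 ** f2).
  rewrite /g -/f3 cmulDl !cmulDr.
  have -> : f ** f3 = f2 ** f2 by rewrite /f2 /f3 !cmulA.
  have -> : f3 ** f = f2 ** f2 by rewrite /f2 /f3 !cmulA.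
  by rewrite -/f2 [X in _ + X = _]addrC addrACA.
have p2 : spos (creal A 1 - (f2 ** f2 + f2 ** f2)).
  have -> : creal A 1 - (f2 ** f2 + f2 ** f2) =
      (1c - g ** g) + (f2 + f3 ** f3).
    have aux (u v w' : A) : u - (v + w') + v = u - w'.
      by rewrite opprD addrA addrAC subrK.
    by rewrite creal1 gg aux.
  by apply: sposD p1 _; apply: sposD; exact: spos_sq.
have p3 : spos (f2 ** f2 + f2 ** f2) by apply: sposD; exact: spos_sq.
have := spos_le_norm p3 p2 ler01.
have -> : f2 ** f2 + f2 ** f2 = (2 : R)%:C%C *: (f2 ** f2).
  by rewrite (_ : 2 = 1 + 1 :> R)// rmorphD rmorph1 /= scalerDl scale1r.
rewrite rnormZr !rnorm_sq// f1 !expr1n mulr1 ger0_norm//.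
by rewrite leNgt ltr1n.
Qed.

Lemma cposP a : cpos a <-> spos a.
Proof.
split=> [[x ->]|/spos_sqrt[b [sb bb _ _]]]; first exact: kaplansky.
by exists b; rewrite sb.
Qed.

End Positivity.

Section OrderTools.
Variables (R : realType) (A : cstarType R).
Implicit Types (x y a b : A) (T : R).

Lemma spos_star_self a : spos a -> star a = a. Proof. by case. Qed.

Lemma spos_conj x a : spos a -> spos (star x ** a ** x).
Proof.
move=> /spos_sqrt[b [sb <- _ _]].
have -> : star x ** (b ** b) ** x = star (b ** x) ** (b ** x).
  by rewrite starM sb !cmulA.
exact: kaplansky.
Qed.

Lemma spos_sq_norm x : spos (creal A (rnorm x ^+ 2) - star x ** x).
Proof. by apply: sposB_norm; rewrite ?starM ?starK// rnorm_starl. Qed.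

Lemma norm_le_of_sq x T : 0 <= T -> spos (creal A (T ^+ 2) - star x ** x) ->
  rnorm x <= T.
Proof.
move=> T0 xT; have := spos_le_norm (kaplansky x) xT (sqr_ge0 T).
by rewrite rnorm_starl ler_sqr ?nnegrE// rnorm_ge0.
Qed.

Lemma spos_norm_le a b : spos a -> spos (b - a) -> rnorm a <= rnorm b.
Proof.
move=> ap ab; have bp : spos b by rewrite -(subrK a b); exact: sposD.
apply: spos_le_norm => //; last exact: rnorm_ge0.
have := sposD (sposB_norm (spos_star_self bp) (lexx _)) ab.
by rewrite addrA subrK.
Qed.

Lemma conj_le_norm x d : spos ((rnorm d ^+ 2)%:C%C *: (star x ** x) -
  star (d ** x) ** (d ** x)).
Proof.
have := spos_conj x (spos_sq_norm d).
by rewrite cmulBr mul_creal cmulBl cmulZl starM !cmulA.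
Qed.

Lemma sq_add_le x y : spos ((2 : R)%:C%C *: (star x ** x + star y ** y) -
  star (x + y) ** (x + y)).
Proof.
suff -> : (2 : R)%:C%C *: (star x ** x + star y ** y) -
    star (x + y) ** (x + y) = star (x - y) ** (x - y) by exact: kaplansky.
rewrite (_ : 2 = 1 + 1 :> R)// rmorphD rmorph1 /= scalerDl scale1r.
rewrite !(starD, starN) !cmulDl !cmulDr !cmulN !cNmul; zmod.
Qed.

Lemma cleP a b : cle a b <-> spos (b - a). Proof. exact: cposP. Qed.

End OrderTools.

(** * Homomorphisms and representations on a Hilbert space *)

Section StarHom.
Variables (R : realType) (A B : cstarType R) (f : A -> B).
Hypothesis fP : star_hom f.

Lemma shD x y : f (x + y) = f x + f y.
Proof. by have := star_hom_linear fP 1 x y; rewrite !scale1r. Qed.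

Lemma sh0 : f 0 = 0.
Proof. by apply: (addrI (f 0)); rewrite -shD !addr0. Qed.

Lemma shZ (k : R[i]) x : f (k *: x) = k *: f x.
Proof. by have := star_hom_linear fP k x 0; rewrite sh0 !addr0. Qed.

Lemma shN x : f (- x) = - f x.
Proof. by rewrite -scaleN1r shZ scaleN1r. Qed.

Lemma shB x y : f (x - y) = f x - f y. Proof. by rewrite shD shN. Qed.

Lemma sh_sum (I : Type) (r : seq I) (F : I -> A) :
  f (\sum_(k <- r) F k) = \sum_(k <- r) f (F k).
Proof. exact: (big_morph f shD sh0). Qed.

Lemma sh_creal T : f (creal A T) = creal B T.
Proof. by rewrite shZ (star_hom1 fP). Qed.

Lemma sh_spos a : spos a -> spos (f a).
Proof.
move=> /cposP[x ->]; rewrite (star_homM fP) (star_hom_star fP).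
exact: kaplansky.
Qed.

Lemma sh_contract x : rnorm (f x) <= rnorm x.
Proof.
apply: norm_le_of_sq; first exact: rnorm_ge0.
have := sh_spos (spos_sq_norm x).
by rewrite shB sh_creal (star_homM fP) (star_hom_star fP).
Qed.

(** If a were not positive, [negative_part] would give j <> 0 with k a k = - j^2. The image of k a k
    is positive, which forces f j = 0. *)
Lemma sh_reflect_spos a : (forall x, f x = 0 -> x = 0) -> star a = a ->
  spos (f a) -> spos a.
Proof.
move=> finj sa fa; have [k [j [sk sj kak]]] := negative_part sa; apply.
apply: finj; apply: spos_opp_sq; first by rewrite -(star_hom_star fP) sj.
have := spos_conj (f k) fa.
by rewrite -(star_hom_star fP) sk -!(star_homM fP) kak shN.
Qed.

End StarHom.

Section HilbertRep.
Variables (R : realType) (A : cstarType R) (H : hilbertType R).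
Variables (pi : A -> H -> H).
Hypothesis piP : faithful_rep pi.
Implicit Types (x y a b : A) (xi eta : H).

Definition qform a xi : R := complex.Re (dot (pi a xi) xi).

Lemma piZD (c : R[i]) a b xi : pi (c *: a + b) xi = c *: pi a xi + pi b xi.
Proof. exact: repP. Qed.

Lemma piD a b xi : pi (a + b) xi = pi a xi + pi b xi.
Proof. by have := piZD 1 a b xi; rewrite !scale1r. Qed.

Lemma pi0 xi : pi 0 xi = 0.
Proof. by apply: (addrI (pi 0 xi)); rewrite -piD !addr0. Qed.

Lemma piZ (c : R[i]) a xi : pi (c *: a) xi = c *: pi a xi.
Proof. by have := piZD c a 0 xi; rewrite pi0 !addr0. Qed.

Lemma piN a xi : pi (- a) xi = - pi a xi.
Proof. by rewrite -scaleN1r piZ scaleN1r. Qed.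

Lemma pi_vecD a xi eta : pi a (xi + eta) = pi a xi + pi a eta.
Proof. by have := rep_linear piP a 1 xi eta; rewrite !scale1r. Qed.

Lemma pi_vec0 a : pi a 0 = 0.
Proof. by apply: (addrI (pi a 0)); rewrite -pi_vecD !addr0. Qed.

Lemma pi_vecZ a (c : R[i]) xi : pi a (c *: xi) = c *: pi a xi.
Proof. by have := rep_linear piP a c xi 0; rewrite pi_vec0 !addr0. Qed.

Lemma dotD xi eta zeta : dot (xi + eta : H) zeta = dot xi zeta + dot eta zeta.
Proof. by have := dotPl 1 xi eta zeta; rewrite scale1r mul1r. Qed.

Lemma dot0 (zeta : H) : dot 0 zeta = 0.
Proof. by apply: (addrI (dot 0 zeta)); rewrite -dotD !addr0. Qed.

Lemma dotZ (c : R[i]) xi (zeta : H) : dot (c *: xi) zeta = c * dot xi zeta.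
Proof. by have := dotPl c xi 0 zeta; rewrite dot0 !addr0. Qed.

Lemma dotN xi (zeta : H) : dot (- xi) zeta = - dot xi zeta.
Proof. by rewrite -scaleN1r dotZ mulN1r. Qed.

Lemma dot_self xi : dot xi xi = (rnorm xi ^+ 2)%:C%C.
Proof. by rewrite dot_norm normE -rmorphXn. Qed.

Lemma qformD a b xi : qform (a + b) xi = qform a xi + qform b xi.
Proof. by rewrite /qform piD dotD raddfD. Qed.

Lemma qformN a xi : qform (- a) xi = - qform a xi.
Proof. by rewrite /qform piN dotN raddfN. Qed.

Lemma qform_creal T xi : qform (creal A T) xi = T * rnorm xi ^+ 2.
Proof.
by rewrite /qform /creal piZ (rep1 piP) dotZ dot_self -rmorphM.
Qed.

Lemma qform_star x xi : qform (star x ** x) xi = rnorm (pi x xi) ^+ 2.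
Proof. by rewrite /qform (repM piP) (rep_star piP) dot_self. Qed.

Lemma qform_conj x a xi : qform (star x ** a ** x) xi = qform a (pi x xi).
Proof.
by rewrite /qform -cmulA (repM piP) (rep_star piP) (repM piP).
Qed.

Lemma qform_spos a xi : spos a -> 0 <= qform a xi.
Proof. by move=> /cposP[x ->]; rewrite qform_star sqr_ge0. Qed.

(** The form of k a k = - j^2 is both nonnegative and nonpositive, so that j acts as 0. *)
Lemma spos_qform a : star a = a -> (forall xi, 0 <= qform a xi) -> spos a.
Proof.
move=> sa qa; have [k [j [sk sj kak]]] := negative_part sa; apply.
apply: (rep_faithful piP) => xi; apply: rnorm_eq0; apply/eqP.
rewrite -sqrf_eq0 eq_le sqr_ge0 andbT -qform_star sj -oppr_ge0 -qformN -kak.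
by rewrite -{1}sk qform_conj.
Qed.

Lemma pi_bound x xi : rnorm (pi x xi) <= rnorm x * rnorm xi.
Proof.
have := qform_spos xi (spos_sq_norm x).
rewrite qformD qformN qform_creal qform_star subr_ge0 -exprMn.
by rewrite ler_sqr ?nnegrE ?mulr_ge0 ?rnorm_ge0.
Qed.

Lemma rnorm_le_pi x T : 0 <= T -> (forall xi, rnorm (pi x xi) <= T * rnorm xi) ->
  rnorm x <= T.
Proof.
move=> T0 H0; apply: norm_le_of_sq => //; apply: spos_qform.
  by rewrite starB star_creal starM starK.
move=> xi; rewrite qformD qformN qform_creal qform_star subr_ge0 -exprMn.
by rewrite ler_sqr ?nnegrE ?mulr_ge0 ?rnorm_ge0.
Qed.

End HilbertRep.

(** * The group algebra of a C*-simple group *)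

Section L2Norm.
Variables (R : realType) (G : groupType) (V : normedModType R[i]).
Implicit Types (xi : G -> V) (T : (G -> V) -> (G -> V)) (c : R).

(** c bounds the squared l^2 norm. Finite partial sums keep the extended reals and summability out
    of the estimates. *)
Definition l2le xi c :=
  forall S : seq G, uniq S -> \sum_(s <- S) rnorm (xi s) ^+ 2 <= c.

Lemma l2norm_leP xi c : 0 <= c ->
  (l2norm xi <= c%:E)%E <-> l2le xi (c ^+ 2).
Proof.
move=> c0; rewrite /l2norm.
have -> : c%:E = sqrte ((c ^+ 2)%:E) by rewrite /= sqrtr_sqr ger0_norm.
rewrite lee_sqrt ?lee_fin ?sqr_ge0//.
split=> [H S uS|H].
  rewrite -lee_fin; apply: le_trans H; apply: ereal_sup_ubound.
  exists [set` S]; first by split=> //; exact: finite_seq.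
  by rewrite -fsbig_seq// sumEFin.
apply: ge_ereal_sup => _ [F [fF _] <-].
have [S uS FS] : exists2 S : seq G, uniq S & F = [set` S].
  have [S ->] := (finite_seqP F).1 fF; exists (undup S); first exact: undup_uniq.
  by apply/seteqP; split=> s /=; rewrite mem_undup.
by rewrite FS -fsbig_seq// sumEFin lee_fin; exact: H.
Qed.

Lemma l2opnorm_leP T c : 0 <= c ->
  (l2opnorm T <= c%:E)%E <-> forall xi, l2le xi 1 -> l2le (T xi) (c ^+ 2).
Proof.
move=> c0; split=> [H xi xi1|H].
  apply/(l2norm_leP _ c0); apply: le_trans H; apply: ereal_sup_ubound.
  by exists xi => //=; apply/(l2norm_leP _ ler01); rewrite expr1n.
apply: ge_ereal_sup => _ [xi /= /(l2norm_leP _ ler01) xi1 <-].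
rewrite expr1n in xi1.
by apply/(l2norm_leP _ c0); exact: H.
Qed.

Lemma l2le_fsum xi : fsupp (fun g => rnorm (xi g) ^+ 2) ->
  l2le xi (fsum (fun g => rnorm (xi g) ^+ 2)).
Proof.
move=> sxi S uS; rewrite fsbig_seq//.
pose h (g : G) := if g \in S then rnorm (xi g) ^+ 2 else 0.
have hs : fsupp h by apply: (fsuppW sxi) => g; rewrite /h => ->; case: ifP.
apply: (@le_trans _ _ (fsum h)).
  rewrite (fsumE (finite_seq S)); last by move=> g /= /negP/negPf; rewrite /h => ->.
  rewrite le_eqVlt; apply/orP; left; apply/eqP; apply: eq_fsbigr => g.
  by rewrite inE /= /h => ->.
by apply: fsum_le => // g; rewrite /h; case: ifP => // _; exact: sqr_ge0.
Qed.

Lemma l2op_apply T c xi : 0 <= c -> (l2opnorm T <= c%:E)%E ->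
  (forall r zeta, T (fun g => (r : R)%:C%C *: zeta g) =
    fun g => r%:C%C *: T zeta g) ->
  fsupp (fun g => rnorm (xi g) ^+ 2) ->
  l2le (T xi) (c ^+ 2 * fsum (fun g => rnorm (xi g) ^+ 2)).
Proof.
move=> c0 /(l2opnorm_leP _ c0) Tc TZ sxi S uS.
set N := fsum _; have N0 : 0 <= N by apply: fsum_ge0 => g; exact: sqr_ge0.
apply/ler_addgt0Pl => e e0.
(* d keeps the normalizing factor finite in case xi vanishes. *)
have [d d0 dc] : exists2 d, 0 < d & c ^+ 2 * d <= e.
  exists (e / (c ^+ 2 + 1)); first by rewrite divr_gt0// ltr_wpDl// sqr_ge0.
  rewrite mulrCA ger_pMr// ler_pdivrMr ?mul1r ?lerDl//.
  by rewrite ltr_wpDl// sqr_ge0.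
have M0 : 0 < N + d by rewrite ltr_wpDl.
have sM0 : 0 < Num.sqrt (N + d) by rewrite sqrtr_gt0.
pose r := (Num.sqrt (N + d))^-1.
have r2 : r ^+ 2 = (N + d)^-1 by rewrite /r exprVn sqr_sqrtr// ltW.
have xi1 : l2le (fun g => r%:C%C *: xi g) 1.
  move=> U uU; have -> : \sum_(s <- U) rnorm (r%:C%C *: xi s) ^+ 2 =
      r ^+ 2 * \sum_(s <- U) rnorm (xi s) ^+ 2.
    by rewrite mulr_sumr; apply: eq_bigr => s _; rewrite rnormZr exprMn -normrX ger0_norm ?sqr_ge0.
  rewrite r2 ler_pdivrMl// mulr1; apply: (le_trans (l2le_fsum sxi uU)).
  by rewrite lerDl ltW.
have := Tc _ xi1 S uS; rewrite TZ.
have -> : \sum_(s <- S) rnorm (r%:C%C *: T xi s) ^+ 2 =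
    r ^+ 2 * \sum_(s <- S) rnorm (T xi s) ^+ 2.
  by rewrite mulr_sumr; apply: eq_bigr => s _; rewrite rnormZr exprMn -normrX ger0_norm ?sqr_ge0.
rewrite r2 ler_pdivrMl// mulrC mulrDr => /le_trans; apply.
by rewrite addrC lerD2r.
Qed.

End L2Norm.

(** A list may repeat a group element; collecting equal elements matches it with the sums over
    finite sets in which the norms are defined. *)
Lemma sum_fibers (I : Type) (G : choiceType) (V : zmodType) (s : seq I)
  (k : I -> G) (f : I -> V) (F : {fset G}) : {subset [seq k v | v <- s] <= F} ->
  \sum_(t <- F) \sum_(v <- s | k v == t) f v = \sum_(v <- s) f v.
Proof.
elim: s => [|v s IH] sF.
  by rewrite big_nil big1// => t _; rewrite big_nil.
rewrite big_cons -IH; last by move=> t ts; apply: sF; rewrite inE ts orbT.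
have kF : k v \in F by apply: sF; rewrite inE eqxx.
rewrite (bigD1_seq (k v))//= ?fset_uniq// [in RHS](bigD1_seq (k v))//= ?fset_uniq//.
rewrite big_cons eqxx -addrA; congr (_ + (_ + _)).
by apply: eq_bigr => t tv; rewrite big_cons eq_sym (negPf tv).
Qed.

Section GroupAlgebra.
Variables (R : realType) (G : groupType).
Implicit Types (s : seq (R[i] * G)).

Definition gprod s1 s2 : seq (R[i] * G) :=
  [seq (v.1 * w.1, (v.2 * w.2)%g) | v <- s1, w <- s2].

Definition gstar s : seq (R[i] * G) := [seq ((v.1^*)%C, (v.2^-1)%g) | v <- s].

Section Action.
Variables (Y : choiceType) (a : G -> Y -> Y).
Hypothesis aP : gact a.
Implicit Types (xi zeta : Y -> R[i]).

Lemma gop_cat s1 s2 xi y :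
  gop a (s1 ++ s2) xi y = gop a s1 xi y + gop a s2 xi y.
Proof. by rewrite /gop big_cat. Qed.

Lemma gop_prod s1 s2 xi : gop a (gprod s1 s2) xi = gop a s1 (gop a s2 xi).
Proof.
apply/funext => y; rewrite /gop /gprod big_allpairs_dep /=.
apply: eq_bigr => v _; rewrite mulr_sumr; apply: eq_bigr => w _.
by rewrite invgM (gactM aP) mulrA.
Qed.

Definition nrm2 xi : R := fsum (fun y => sqmod (xi y)).

(** The real part of the inner product of l^2(Y). *)
Definition rip xi zeta : R := fsum (fun y => complex.Re (xi y * (zeta y)^*%C)).

Lemma nrm2_ge0 xi : 0 <= nrm2 xi.
Proof. by apply: fsum_ge0 => y; exact: sqmod_ge0. Qed.

Lemma rip_self xi : rip xi xi = nrm2 xi.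
Proof.
by apply: eq_fsum => y; case: (xi y) => b c; rewrite /sqmod /=; ring.
Qed.

Lemma rip_supp xi zeta : fsupp zeta ->
  fsupp (fun y => complex.Re (xi y * (zeta y)^*%C)).
Proof. by move=> zs; apply: (fsuppW zs) => y ->; rewrite conjc0 mulr0. Qed.

Lemma ripD xi xi' zeta : fsupp zeta ->
  rip (fun y => xi y + xi' y) zeta = rip xi zeta + rip xi' zeta.
Proof.
move=> zs; rewrite /rip -fsumD; [|exact: rip_supp|exact: rip_supp].
by apply: eq_fsum => y; rewrite mulrDl raddfD.
Qed.

Lemma ripC xi zeta : rip xi zeta = rip zeta xi.
Proof.
by apply: eq_fsum => y; case: (xi y) (zeta y) => [b c] [d e] /=; ring.
Qed.

Lemma rip_le xi zeta e : 0 < e -> fsupp xi -> fsupp zeta ->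
  rip xi zeta <= 2^-1 * (e^-1 * nrm2 xi + e * nrm2 zeta).
Proof.
move=> e0 sx sz; rewrite /nrm2 -!fsumZ -fsumD; last 2 first.
- by apply: fsuppMr; exact: fsupp_sqmod.
- by apply: fsuppMr; exact: fsupp_sqmod.
rewrite -fsumZ; apply: fsum_le => [||y].
- exact: rip_supp.
- by apply: fsuppMr; apply: fsuppD; apply: fsuppMr; exact: fsupp_sqmod.
case: (xi y) (zeta y) => [b c] [d f]; rewrite /sqmod /= -subr_ge0.
have -> : 2^-1 * (e^-1 * (b ^+ 2 + c ^+ 2) + e * (d ^+ 2 + f ^+ 2)) -
    (b * d - c * - f) = 2^-1 * e^-1 * ((b - e * d) ^+ 2 + (c - e * f) ^+ 2).
  by field; rewrite gt_eqF.
by rewrite !mulr_ge0 ?invr_ge0 ?(ltW e0)// addr_ge0// sqr_ge0.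
Qed.

Lemma rip_adjoint s xi zeta : fsupp xi -> fsupp zeta ->
  rip (gop a (gstar s) xi) zeta = rip xi (gop a s zeta).
Proof.
move=> sx sz; rewrite /rip.
transitivity (\sum_(v <- s) fsum (fun y =>
    complex.Re ((v.1^*)%C * xi (a v.2 y) * (zeta y)^*%C))).
  rewrite -fsum_sum => [|v]; last by apply: rip_supp.
  apply: eq_fsum => y; rewrite /gop big_map mulr_suml raddf_sum /=.
  by apply: eq_bigr => v _; rewrite invgK.
transitivity (\sum_(v <- s) fsum (fun y =>
    complex.Re (xi y * (v.1 * zeta (a v.2^-1%g y))^*%C))).
  apply: eq_bigr => v _.
  rewrite -(fsum_act aP v.2 (fun y => complex.Re (xi y * _))).
  apply: eq_fsum => y; rewrite (gactK aP) rmorphM /= mulrA.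
  by rewrite [(v.1^*)%C * _]mulrC.
rewrite -fsum_sum => [|v].
  by apply: eq_fsum => y; rewrite /gop rmorph_sum /= mulr_sumr raddf_sum.
by apply: rip_supp; apply: fsuppMr; exact: (fsupp_act aP v.2^-1%g sz).
Qed.

End Action.

Variables (L : cstarType R) (lam : G -> L).
Hypothesis lamP : reduced_group_algebra lam.

Let lmul (g h : G) := (g * h)%g.

Lemma lmul_gact : gact lmul.
Proof. by split=> [g|g h k]; rewrite /lmul ?mul1g ?mulgA. Qed.

Definition gl s : L := \sum_(v <- s) v.1 *: lam v.2.

Lemma gl_cat s1 s2 : gl (s1 ++ s2) = gl s1 + gl s2.
Proof. by rewrite /gl big_cat. Qed.

Lemma gl_prod s1 s2 : gl (gprod s1 s2) = gl s1 ** gl s2.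
Proof.
rewrite /gl /gprod big_allpairs_dep /=.
rewrite (big_morph (cmul^~ _) (fun x y => cmulDl x y _) (c0mul _)).
apply: eq_bigr => v _.
rewrite (big_morph (cmul _) (cmulDr _) (cmul0 _)); apply: eq_bigr => w _.
by rewrite cmulZl cmulZr scalerA (unitary_repM (rga_unitary lamP)).
Qed.

Lemma gl_star s : gl (gstar s) = star (gl s).
Proof.
rewrite /gl /gstar big_map (big_morph star starD (star0 L)).
by apply: eq_bigr => v _; rewrite starZ (unitary_repV (rga_unitary lamP)).
Qed.

Lemma gl_dense (x : L) e : 0 < e -> exists s, rnorm (x - gl s) < e.
Proof.
move=> e0; have : [set: L] x by [].
rewrite -(rga_dense lamP) => /closureP/(_ e e0)[_ [F [c ->]] xe].
by exists [seq (c t, t) | t <- F]; rewrite /gl big_map.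
Qed.

Lemma gl_bound s (xi : G -> R[i]) : fsupp xi ->
  nrm2 (gop lmul s xi) <= rnorm (gl s) ^+ 2 * nrm2 xi.
Proof.
move=> sxi.
pose F : {fset G} := seq_fset tt [seq v.2 | v <- s].
have sF : {subset [seq v.2 | v <- s] <= F} by move=> t; rewrite seq_fsetE.
pose c t := \sum_(v <- s | v.2 == t) v.1.
have glE : gl s = \sum_(t <- F) c t *: lam t.
  rewrite /gl -(sum_fibers _ sF); apply: eq_bigr => t _.
  by rewrite scaler_suml; apply: eq_bigr => v /eqP->.
pose T (zeta : G -> R[i]^o) g := \sum_(t <- F) c t *: left_translation t zeta g.
have TE zeta : T zeta = gop lmul s zeta.
  apply/funext => g; rewrite /T /gop -(sum_fibers _ sF); apply: eq_bigr => t _.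
  by rewrite scaler_suml; apply: eq_bigr => v /eqP->.
have nT : (l2opnorm T <= (rnorm (gl s))%:E)%E.
  by rewrite glE (rga_norm lamP F c).
have TZ r zeta : T (fun g => (r : R)%:C%C *: zeta g) = fun g => r%:C%C *: T zeta g.
  apply/funext => g; rewrite /T scaler_sumr; apply: eq_bigr => t _.
  by rewrite /left_translation !scalerA mulrC.
have n2 (zeta : G -> R[i]^o) : fsum (fun g => rnorm (zeta g) ^+ 2) = nrm2 zeta.
  by apply: eq_fsum => g; exact: rnorm_complex.
have sx2 : fsupp (fun g => rnorm (xi g : R[i]^o) ^+ 2).
  by apply: (fsuppW (fsupp_sqmod sxi)) => g; rewrite rnorm_complex.
have := l2op_apply (rnorm_ge0 _) nT TZ sx2; rewrite n2 TE => H.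
have sg := gop_supp lmul_gact s sxi.
have [S uS ->] : exists2 S : seq G, uniq S &
    nrm2 (gop lmul s xi) = \sum_(g <- S) rnorm (gop lmul s xi g : R[i]^o) ^+ 2.
  have [S SE] := (finite_seqP _).1 sg; exists (undup S); first exact: undup_uniq.
  rewrite /nrm2 (fsum_seq (undup_uniq S)).
    by apply: eq_bigr => g _; rewrite rnorm_complex.
  move=> g; rewrite mem_undup => /negP gS.
  suff -> : gop lmul s xi g = 0 by exact: sqmod0.
  by apply/eqP/negPn/negP => gn; apply: gS; have : [set` S] g by rewrite -SE.
exact: H.
Qed.

End GroupAlgebra.

Lemma cmul_approx (R : realType) (A : cstarType R) (x y : A) (e : R) : 0 < e ->
  exists2 d, 0 < d & forall x' y', rnorm (x - x') < d -> rnorm (y - y') < d ->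
    rnorm (x ** y - x' ** y') < e.
Proof.
move=> e0; pose K := rnorm x + rnorm y + 2.
have K0 : 0 < K.
  by rewrite /K; have := rnorm_ge0 x; have := rnorm_ge0 y => ? ?; lra.
exists (Num.min 1 (e / K)); first by rewrite lt_min ltr01 divr_gt0.
move=> x' y' xx yy; set d := Num.min _ _ in xx yy.
have d1 : d <= 1 by rewrite ge_min lexx.
have dK : d * K <= e by rewrite -ler_pdivlMr// ge_min lexx orbT.
have -> : x ** y - x' ** y' = (x - x') ** y + x' ** (y - y').
  by rewrite cmulBl cmulBr; zmod.
apply: (le_lt_trans (rnormD _ _)).
have x'K : rnorm x' <= rnorm x + 1.
  by have := rnormB x (x - x'); rewrite opprB addrC subrK => ?; lra.
have d0 : 0 < d by apply: le_lt_trans xx; exact: rnorm_ge0.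
have h1 : rnorm ((x - x') ** y) <= d * rnorm y.
  apply: (le_trans (rnormM _ _)); rewrite ler_wpM2r ?rnorm_ge0//; exact: ltW.
have h2 : rnorm (x' ** (y - y')) <= (rnorm x + 1) * d.
  by apply: (le_trans (rnormM _ _)); apply: ler_pM; rewrite ?rnorm_ge0// ltW.
have : d * rnorm y + (rnorm x + 1) * d < d * K by rewrite /K; lra.
by move=> ?; lra.
Qed.

Section RealForm.
Variables (R : realType) (G : groupType) (Z : choiceType) (b : G -> Z -> Z).
Hypothesis bP : gact b.

Definition cform t (f : Z -> R) := fsum (fun z => f (b t^-1%g z) * f z).

Lemma cform1 f : cform 1%g f = fsum (fun z => f z ^+ 2).
Proof. by apply: eq_fsum => z; rewrite invg1 (gact1 bP) expr2. Qed.

Definition complexify (r : seq (R * G)) : seq (R[i] * G) :=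
  [seq ((u.1)%:C%C, u.2) | u <- r].

Lemma rip_complexify r (xi : Z -> R[i]) : fsupp xi ->
  rip (gop b (complexify r) xi) xi =
  \sum_(u <- r) u.1 * (cform u.2 (fun z => complex.Re (xi z)) +
    cform u.2 (fun z => complex.Im (xi z))).
Proof.
move=> sxi.
have sre : fsupp (fun z => complex.Re (xi z)) by apply: (fsuppW sxi) => z ->.
have sim : fsupp (fun z => complex.Im (xi z)) by apply: (fsuppW sxi) => z ->.
transitivity (\sum_(u <- r) fsum (fun z => u.1 *
    (complex.Re (xi (b u.2^-1%g z)) * complex.Re (xi z) +
     complex.Im (xi (b u.2^-1%g z)) * complex.Im (xi z)))).
  rewrite -fsum_sum => [|u]; last by apply: fsuppMr; apply: fsuppD; apply: fsuppMr.
  apply: eq_fsum => z; rewrite /gop big_map mulr_suml raddf_sum /=.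
  apply: eq_bigr => u _; case: (xi z) (xi _) => [c d] [e f] /=; ring.
apply: eq_bigr => u _; rewrite fsumZ; congr (_ * _).
by rewrite fsumD//; exact: fsuppMr.
Qed.

Lemma sphere_homogeneous (r : seq (R * G)) (e : R) :
  (forall xi : sphere R Z, \sum_(u <- r) u.1 * coeff b u.2 xi <= e) ->
  forall f : Z -> R, fsupp f ->
  \sum_(u <- r) u.1 * cform u.2 f <= e * fsum (fun y => f y ^+ 2).
Proof.
move=> re f sf; have s2 : fsupp (fun y => f y ^+ 2).
  by apply: (fsuppW sf) => z ->; rewrite expr0n.
have [n0|n0] := eqVneq (fsum (fun y => f y ^+ 2)) 0.
  have f0 y : f y = 0.
    apply/eqP; rewrite -sqrf_eq0 eq_le sqr_ge0 andbT -n0.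
    exact: (le_fsum y s2 (fun z => sqr_ge0 (f z))).
  rewrite n0 mulr0 big1// => u _; rewrite /cform.
  by rewrite (eq_fsum (g := fun=> 0)) ?fsum0 ?mulr0// => y; rewrite f0 mul0r.
set n := fsum _ in n0 *.
have np : 0 < n by rewrite lt0r n0 fsum_ge0// => y; exact: sqr_ge0.
pose c := (Num.sqrt n)^-1.
have c2 : c ^+ 2 = n^-1 by rewrite /c exprVn sqr_sqrtr// ltW.
have fP : fsupp (fun y => c * f y) /\ fsum (fun y => (c * f y) ^+ 2) = 1.
  split; first exact: fsuppMr.
  rewrite (eq_fsum (g := fun y => c ^+ 2 * f y ^+ 2)) => [|y]; last by rewrite exprMn.
  by rewrite fsumZ c2 mulVf.
have := re (exist _ _ fP).
have -> : \sum_(u <- r) u.1 * coeff b u.2 (exist _ _ fP) =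
    n^-1 * \sum_(u <- r) u.1 * cform u.2 f.
  rewrite mulr_sumr; apply: eq_bigr => u _.
  rewrite mulrCA; congr (_ * _); rewrite /coeff /cform -c2 -fsumZ.
  by apply: eq_fsum => y; rewrite /vec /=; ring.
by rewrite ler_pdivrMl// mulrC.
Qed.

End RealForm.

(** * Vector states of l^2(Y) when C*_lambda(G) is simple *)

Section Simplicity.
Variables (R : realType) (G : groupType) (L : cstarType R) (lam : G -> L).
Hypotheses (lamP : reduced_group_algebra lam) (Lsimple : simple [set: L]).
Variables (Y : choiceType) (a : G -> Y -> Y) (y0 : Y).
Hypothesis aP : gact a.
Hypothesis weak : forall s (xi : Y -> R[i]), fsupp xi ->
  nrm2 (gop a s xi) <= rnorm (gl lam s) ^+ 2 * nrm2 xi.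

Let lmul (g h : G) := (g * h)%g.

Definition opbound (s : seq (R[i] * G)) (e : R) := forall xi : Y -> R[i],
  fsupp xi -> nrm2 (gop a s xi) <= e * nrm2 xi.

(* The kernel of the representation of L on l^2(Y), which is defined on the
   group algebra only. *)
Definition rep_kernel : set L := [set b | forall e, 0 < e -> exists s,
  rnorm (b - gl lam s) < e /\ opbound s e].

Lemma opbound_le s e e' : e <= e' -> opbound s e -> opbound s e'.
Proof.
by move=> ee sb xi sx; rewrite (le_trans (sb xi sx))// ler_wpM2r// nrm2_ge0.
Qed.

Lemma nrm2_delta : nrm2 (fun y => (y == y0)%:R : R[i]) = 1.
Proof.
rewrite /nrm2 (fsum_delta (y0 := y0)); first by rewrite eqxx /sqmod /= expr1n expr0n addr0.
by move=> y /negPf->; exact: sqmod0.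
Qed.

Lemma delta_supp : fsupp (fun y => (y == y0)%:R : R[i]).
Proof.
by apply: (@fsupp_sub _ _ _ [set y0]) => // y /= /eqP/negPf->.
Qed.

(** [weak] bounds the approximants of d on l^2(Y), so that multiplication by d only inflates the
    tolerance by a constant. *)
Lemma rep_kernel_ideal : closed_ideal [set: L] rep_kernel.
Proof.
have KM d x : rep_kernel x -> rep_kernel (d ** x) /\ rep_kernel (x ** d).
  move=> Kx; split=> e e0.
    have [d1 d10 H1] := cmul_approx d x e0.
    have [sd sdP] := gl_dense lamP d d10.
    pose K := rnorm (gl lam sd) ^+ 2 + 1.
    have K0 : 0 < K by rewrite ltr_wpDl// sqr_ge0.
    have m0 : 0 < Num.min d1 (e / K) by rewrite lt_min d10 divr_gt0.
    have [sx [xs sxb]] := Kx _ m0; exists (gprod sd sx); split.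
      rewrite (gl_prod lamP); apply: H1 => //.
      by apply: (lt_le_trans xs); rewrite ge_min lexx.
    move=> xi sxi; rewrite (gop_prod aP).
    apply: (le_trans (weak _ (gop_supp aP _ sxi))).
    have := sxb _ sxi; set u := nrm2 _; set v := nrm2 _ => uv.
    have v0 : 0 <= v by exact: nrm2_ge0.
    have u0 : 0 <= u by exact: nrm2_ge0.
    have : K * u <= e * v.
      rewrite -ler_pdivlMl// mulrA (le_trans uv)// ler_wpM2r//.
      by rewrite ge_min mulrC lexx orbT.
    by apply: le_trans; rewrite ler_wpM2r// lerDl.
  have [d1 d10 H1] := cmul_approx x d e0.
  have [sd sdP] := gl_dense lamP d d10.
  pose K := rnorm (gl lam sd) ^+ 2 + 1.
  have K0 : 0 < K by rewrite ltr_wpDl// sqr_ge0.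
  have m0 : 0 < Num.min d1 (e / K) by rewrite lt_min d10 divr_gt0.
  have [sx [xs sxb]] := Kx _ m0; exists (gprod sx sd); split.
    rewrite (gl_prod lamP); apply: H1 => //.
    by apply: (lt_le_trans xs); rewrite ge_min lexx.
  move=> xi sxi; rewrite (gop_prod aP).
  apply: (le_trans (sxb _ (gop_supp aP _ sxi))).
  have mK : Num.min d1 (e / K) <= e / K by rewrite ge_min lexx orbT.
  have := weak sd sxi; set u := nrm2 _; set v := nrm2 _ => uv.
  have v0 : 0 <= v by exact: nrm2_ge0.
  have u0 : 0 <= u by exact: nrm2_ge0.
  apply: (@le_trans _ _ (e / K * u)); first by rewrite ler_wpM2r.
  rewrite -mulrA ler_wpM2l ?(ltW e0)// ler_pdivrMl//.
  by apply: (le_trans uv); rewrite ler_wpM2r// lerDl.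
split=> //.
- move=> e e0; exists [::]; split; first by rewrite /gl big_nil subrr rnorm0.
  move=> xi sxi; rewrite (_ : nrm2 _ = 0) ?mulr_ge0 ?(ltW e0) ?nrm2_ge0//.
  rewrite -[RHS](fsum0 R Y); apply: eq_fsum => y.
  by rewrite /gop big_nil sqmod0.
- move=> x y Kx Ky e e0; have e4 : 0 < e / 4 by rewrite divr_gt0.
  have [sx [xs sxb]] := Kx _ e4; have [sy [ys syb]] := Ky _ e4.
  exists (sx ++ sy); split.
    rewrite gl_cat; have := rnormD (x - gl lam sx) (y - gl lam sy).
    rewrite (_ : x - _ + (y - _) = x + y - (gl lam sx + gl lam sy)); last by zmod.
    by move=> ?; lra.
  move=> xi sxi; have := sxb _ sxi; have := syb _ sxi.
  set u := nrm2 _; set v := nrm2 _; set w := nrm2 _ => uv wv.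
  have : nrm2 (gop a (sx ++ sy) xi) <= 2 * w + 2 * u.
    rewrite /w /u /nrm2 -!fsumZ -fsumD; last 2 first.
    - by apply: fsuppMr; apply: fsupp_sqmod; exact: gop_supp.
    - by apply: fsuppMr; apply: fsupp_sqmod; exact: gop_supp.
    apply: fsum_le => [||z].
    - by apply: fsupp_sqmod; exact: gop_supp.
    - by apply: fsuppD; apply: fsuppMr; apply: fsupp_sqmod; exact: gop_supp.
    rewrite gop_cat; have := sqmodD_le (gop a sx xi z) (gop a sy xi z) ltr01.
    by rewrite invr1.
  by move=> ?; lra.
- move=> c x Kx; have -> : c *: x = (c *: 1c) ** x by rewrite cmulZl cmul1.
  by have [] := KM (c *: 1c) x Kx.
- by move=> d x _ Kx; have [] := KM d x Kx.
- by move=> x d Kx _; have [] := KM d x Kx.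
- apply/closed_rnormP => x H e e0; have e2 : 0 < e / 2 by rewrite divr_gt0.
  have [y Ky xy] := H _ e2; have [s [ys sb]] := Ky _ e2.
  exists s; split; last by apply: opbound_le sb; lra.
  by apply: (le_lt_trans (rdist_triangle y _ _)); lra.
Qed.

Lemma rep_kernel_proper : ~ rep_kernel 1c.
Proof.
(* With 1/8 the point mass at y0, a unit vector, would have squared norm at most 2/8 + 2/8. *)
move=> /(_ 8^-1)[|s [s1 sb]]; first by rewrite invr_gt0.
pose xi y : R[i] := (y == y0)%:R.
have sxi : fsupp xi by exact: delta_supp.
have x1 : nrm2 xi = 1 by exact: nrm2_delta.
pose t := (1, 1%g) :: [seq (- v.1, v.2) | v <- s] : seq (R[i] * G).
have glt : gl lam t = 1c - gl lam s.
  rewrite /gl big_cons big_map /= scale1r (unitary_rep1 (rga_unitary lamP)).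
  by congr (_ + _); rewrite -sumrN; apply: eq_bigr => v _; rewrite scaleNr.
have gt y : gop a t xi y = xi y - gop a s xi y.
  rewrite /gop big_cons big_map /= invg1 (gact1 aP) mul1r; congr (_ + _).
  by rewrite -sumrN; apply: eq_bigr => v _; rewrite mulNr.
have b1 : nrm2 (gop a t xi) <= 8^-1.
  apply: (le_trans (weak _ sxi)); rewrite x1 mulr1 glt.
  have := rnorm_ge0 (1c - gl lam s) => ?.
  by rewrite expr2; apply: (@le_trans _ _ (8^-1 * 8^-1)); [apply: ler_pM => //; exact: ltW|lra].
have b2 := sb _ sxi; rewrite x1 mulr1 in b2.
have : nrm2 xi <= 2 * nrm2 (gop a t xi) + 2 * nrm2 (gop a s xi).
  rewrite /nrm2 -!fsumZ -fsumD; last 2 first.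
  - by apply: fsuppMr; apply: fsupp_sqmod; exact: gop_supp.
  - by apply: fsuppMr; apply: fsupp_sqmod; exact: gop_supp.
  apply: fsum_le => [||z].
  - exact: fsupp_sqmod.
  - by apply: fsuppD; apply: fsuppMr; apply: fsupp_sqmod; exact: gop_supp.
  have := sqmodD_le (gop a t xi z) (gop a s xi z) ltr01.
  by rewrite invr1 gt subrK.
by rewrite x1 => ?; lra.
Qed.

Lemma rep_kernel0 x : rep_kernel x -> x = 0.
Proof.
move=> Kx; have [_ /(_ _ rep_kernel_ideal)[E|E]] := Lsimple.
  by rewrite E in Kx.
by case: rep_kernel_proper; rewrite E.
Qed.

Section Form.
Variables (Z : choiceType) (b : G -> Z -> Z).
Hypothesis bP : gact b.
Hypothesis wk : forall s (xi : Z -> R[i]), fsupp xi ->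
  nrm2 (gop b s xi) <= rnorm (gl lam s) ^+ 2 * nrm2 xi.

Lemma rip_gop_le s (xi : Z -> R[i]) m : 0 < m -> rnorm (gl lam s) <= m ->
  fsupp xi -> rip (gop b s xi) xi <= m * nrm2 xi.
Proof.
move=> m0 sm sxi; apply: (le_trans (rip_le m0 (gop_supp bP _ sxi) sxi)).
have n0 := nrm2_ge0 xi.
have : nrm2 (gop b s xi) <= m ^+ 2 * nrm2 xi.
  apply: (le_trans (wk _ sxi)); rewrite ler_wpM2r// ler_sqr ?nnegrE ?rnorm_ge0//.
  exact: ltW.
rewrite -(ler_pM2l (_ : 0 < m^-1)) ?invr_gt0// mulrA expr2 mulKf ?gt_eqF// => ?.
by lra.
Qed.

Lemma rip_gop_cat s t (xi zeta : Z -> R[i]) : fsupp zeta ->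
  rip (gop b (s ++ t) xi) zeta = rip (gop b s xi) zeta + rip (gop b t xi) zeta.
Proof.
move=> sz; rewrite -ripD//; congr rip; apply/funext => z; exact: gop_cat.
Qed.

Lemma rip_gop_starM s (xi : Z -> R[i]) : fsupp xi ->
  rip (gop b (gprod (gstar s) s) xi) xi = nrm2 (gop b s xi).
Proof.
move=> sx; rewrite (gop_prod bP) (rip_adjoint bP) ?rip_self//.
exact: gop_supp.
Qed.

Lemma rip_gop_sym s (xi : Z -> R[i]) : fsupp xi ->
  rip (gop b (s ++ gstar s) xi) xi = 2 * rip (gop b s xi) xi.
Proof.
by move=> sx; rewrite rip_gop_cat// (rip_adjoint bP)// [rip xi _]ripC mulr_natl mulr2n.
Qed.

End Form.

(* An element of the group algebra that is positive on l^2(Y) is positive in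
   L, hence has nonnegative trace. *)
Lemma trace_ge0 s m : 0 < m ->
  (forall xi : Y -> R[i], fsupp xi -> 0 <= rip (gop a s xi) xi) ->
  - m <= rip (gop lmul s (fun g => (g == 1%g)%:R)) (fun g => (g == 1%g)%:R).
Proof.
(* Only the real part of the form of s is controlled, so s is replaced by s + s^*, whose form is
   twice that. *)
move=> m0 spos; pose b := gl lam (s ++ gstar s).
have bE : b = gl lam s + star (gl lam s) by rewrite /b gl_cat (gl_star lamP).
have sb : star b = b by rewrite bE starD starK addrC.
have [k [j [sk sj kbk j0]]] := negative_part sb.
(* For approximants of j and k in the group algebra, the form of j^2 + k b k on l^2(Y) is nearly 0,
   and both terms are nonnegative; so the approximants of j nearly act as 0. *)
have jK : rep_kernel j.
  move=> e e0; have e2 : 0 < e / 3 by rewrite divr_gt0.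
  have [d1 d10 H1] := cmul_approx j j e2.
  have [d2 d20 H2] := cmul_approx (k ** b) k e2.
  have [d3 d30 H3] := cmul_approx k b d20.
  have [d4 d40 dd] : exists2 d, 0 < d & [/\ d <= d1, d <= d2, d <= d3 & d <= e].
    exists (Num.min (Num.min d1 d2) (Num.min d3 e)).
      by rewrite !lt_min d10 d20 d30 e0.
    by split; rewrite !ge_min lexx ?orbT.
  have [l1 l2 l3 l4] := dd.
  have [ka kaP] := gl_dense lamP k d40; have [ga gaP] := gl_dense lamP j d40.
  exists ga; split; first exact: lt_le_trans gaP l4.
  pose th := gprod (gstar ga) ga ++ gprod (gprod (gstar ka) (s ++ gstar s)) ka.
  have sgk : rnorm (k - star (gl lam ka)) < d4.
    by rewrite -{1}sk -starB rnorm_star.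
  have sgj : rnorm (j - star (gl lam ga)) < d4.
    by rewrite -{1}sj -starB rnorm_star.
  have thn : rnorm (gl lam th) <= e.
    have -> : gl lam th = star (gl lam ga) ** gl lam ga +
        (star (gl lam ka) ** b) ** gl lam ka.
      by rewrite /th gl_cat !(gl_prod lamP) !(gl_star lamP).
    have n1 := H1 _ _ (lt_le_trans sgj l1) (lt_le_trans gaP l1).
    have n3 : rnorm (k ** b - star (gl lam ka) ** b) < d2.
      by apply: H3; [exact: lt_le_trans sgk l3|rewrite subrr rnorm0].
    have n2 := H2 _ _ n3 (lt_le_trans kaP l2).
    rewrite -rnormN; set u := star _ ** _ in n1 *.
    set v := star _ ** _ ** _ in n2 *.
    have -> : - (u + v) = (j ** j - u) + (k ** b ** k - v).
      by rewrite kbk; zmod.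
    by have := rnormD (j ** j - u) (k ** b ** k - v) => ?; lra.
  move=> xi sxi; have := rip_gop_le aP weak e0 thn sxi.
  rewrite /th rip_gop_cat// (rip_gop_starM aP)//.
  rewrite !(gop_prod aP) (rip_adjoint aP)//; last first.
    by do 2 apply: gop_supp => //.
  have sk' := gop_supp aP ka sxi.
  rewrite (rip_gop_sym aP)//.
  by have := spos _ sk' => ? ?; lra.
(* Now b = x^* x, and its trace is the squared norm of x applied to the point mass at 1, up to the
   approximation of x by [ch]. *)
have := rep_kernel0 jK => /j0 /cposP[x bx].
pose de (g : G) : R[i] := (g == 1%g)%:R.
have sde : fsupp de.
  by apply: (@fsupp_sub _ _ _ [set 1%g]) => // y /= /eqP/negPf; rewrite /de => ->.
have nde : nrm2 de = 1.
  rewrite /nrm2 (fsum_delta (y0 := 1%g)); first by rewrite /de eqxx /sqmod /= expr1n expr0n addr0.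
  by move=> y; rewrite /de => /negPf->; exact: sqmod0.
have m2 : 0 < m by [].
have [d d0 H] := cmul_approx (star x) x m0.
have [ch chP] := gl_dense lamP x d0.
have schP : rnorm (star x - star (gl lam ch)) < d by rewrite -starB rnorm_star.
have xn := H _ _ schP chP.
pose N := [seq (- v.1, v.2) | v <- s ++ gstar s] : seq (R[i] * G).
have glN : gl lam N = - b.
  by rewrite /b /gl big_map -sumrN; apply: eq_bigr => v _; rewrite scaleNr.
pose th := gprod (gstar ch) ch ++ N.
have thn : rnorm (gl lam th) <= m.
  rewrite /th gl_cat (gl_prod lamP) (gl_star lamP) glN bx rdistC.
  exact: ltW.
have lP := lmul_gact G; rewrite -/lmul in lP.
have := rip_gop_le lP (gl_bound lamP) m0 thn sde.
rewrite /th rip_gop_cat// (rip_gop_starM lP)// nde mulr1.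
have -> : rip (gop lmul N de) de = - rip (gop lmul (s ++ gstar s) de) de.
  rewrite /rip -fsumN; apply: eq_fsum => g; rewrite -raddfN -mulNr.
  congr (complex.Re (_ * _)); rewrite /gop big_map -sumrN.
  by apply: eq_bigr => v _; rewrite mulNr.
rewrite (rip_gop_sym lP)//.
by have := nrm2_ge0 (gop lmul ch de) => ? ?; lra.
Qed.

(** Otherwise minimax gives a convex combination of elements t <> 1 whose form is at least d on the
    unit vectors of l^2(Y). Subtracting d leaves an element that is positive there and of trace - d,
    against [trace_ge0]. *)
Lemma simple_mean : exists2 w : (sphere R Y -> R) -> R, mean w &
  forall t, t != 1%g -> w (coeff a t) <= 0.
Proof.
apply: contrapT => H.
pose I := {t : G | t != 1%g}.
pose v (t : I) (xi : sphere R Y) := - coeff a (sval t) xi.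
have bv t : bnd (v t) by apply: bndN; exact: coeff_bnd.
have [w wm|ws [d d0 [ws0 ws1 wsd]]] := minimax (sphere_delta R y0) bv.
  apply: contrapT => /forallNP Hw; apply: H; exists w => // t t1.
  have /negP := Hw (exist _ t t1); rewrite -leNgt /v/=.
  by rewrite (meanN wm (coeff_bnd aP t)) oppr_ge0.
have scaled (f : Y -> R) : fsupp f -> d * fsum (fun y => f y ^+ 2) <=
    \sum_(u <- ws) u.1 * cform a (sval u.2) f.
  move=> sf; pose r : seq (R * G) := [seq (- u.1, sval u.2) | u <- ws].
  have rd (xi : sphere R Y) : \sum_(u <- r) u.1 * coeff a u.2 xi <= - d.
    rewrite big_map /=; apply: le_trans (wsd xi).
    rewrite le_eqVlt; apply/orP; left; apply/eqP.
    by apply: eq_bigr => u _; rewrite /v mulrN mulNr.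
  have := sphere_homogeneous rd sf; rewrite big_map /=.
  by under eq_bigr do rewrite mulNr; rewrite sumrN mulNr lerN2.
pose r : seq (R * G) := (- d, 1%g) :: [seq (u.1, sval u.2) | u <- ws].
have := @trace_ge0 (complexify r) (d / 2) (divr_gt0 d0 (ltr0n _ 2)).
have lP := lmul_gact G; rewrite -/lmul in lP.
pose de (g : G) : R[i] := (g == 1%g)%:R.
have sde : fsupp de.
  by apply: (@fsupp_sub _ _ _ [set 1%g]) => // y /= /eqP/negPf; rewrite /de => ->.
rewrite -/de (rip_complexify lmul)//.
have -> : \sum_(u <- r) u.1 * (cform lmul u.2 (fun z => complex.Re (de z)) +
    cform lmul u.2 (fun z => complex.Im (de z))) = - d.
  have imE t : cform lmul t (fun z => complex.Im (de z)) = 0.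
    rewrite /cform (eq_fsum (g := fun=> 0)) ?fsum0// => z.
    by rewrite /de; case: (z == _); rewrite /= mulr0.
  rewrite /r big_cons big_map /= big1 => [|u _].
    rewrite imE (cform1 lP) (fsum_delta (y0 := 1%g)) /de.
      by rewrite eqxx /= expr1n !addr0 mulr1.
    by move=> y /negPf->; rewrite /= expr0n.
  rewrite imE addr0 /cform (eq_fsum (g := fun=> 0)) ?fsum0 ?mulr0// => z.
  rewrite /de /lmul; case: (eqVneq z 1%g) => [->|_]; last by rewrite mulr0.
  by rewrite mulg1 invg_eq1 (negPf (svalP u.2)) mul0r.
have Hpos (xi : Y -> R[i]) : fsupp xi -> 0 <= rip (gop a (complexify r) xi) xi.
  move=> sxi; rewrite (rip_complexify a)//.
  have sre : fsupp (fun z => complex.Re (xi z)) by apply: (fsuppW sxi) => z ->.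
  have sim : fsupp (fun z => complex.Im (xi z)) by apply: (fsuppW sxi) => z ->.
  rewrite /r big_cons big_map /= !(cform1 aP).
  under eq_bigr do rewrite mulrDr.
  by rewrite big_split /=; have := scaled _ sre; have := scaled _ sim => ? ?; lra.
by move=> /(_ Hpos) ?; lra.
Qed.

End Simplicity.

(** The orbit consists of means, not of cosets, so that distinct points are distinguished by their
    values on functions. *)
Definition orbit (R : realType) (G : groupType) (x : (G -> R) -> R) : Type :=
  {z : (G -> R) -> R | exists g, z = act_mean g x}.

HB.instance Definition _ (R : realType) (G : groupType) (x : (G -> R) -> R) :=
  gen_eqMixin (orbit x).
HB.instance Definition _ (R : realType) (G : groupType) (x : (G -> R) -> R) :=
  gen_choiceMixin (orbit x).

Section Orbit.
Variables (R : realType) (G : groupType) (x : (G -> R) -> R).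

Lemma act_meanM g h (z : (G -> R) -> R) :
  act_mean g (act_mean h z) = act_mean (g * h)%g z.
Proof. by apply/funext => f; rewrite /act_mean translateM. Qed.

Lemma act_mean1 (z : (G -> R) -> R) : act_mean 1%g z = z.
Proof. by apply/funext => f; rewrite /act_mean translate1. Qed.

Lemma orbit_act_subproof g (y : orbit x) : exists h, act_mean g (sval y) = act_mean h x.
Proof. by case: (svalP y) => h ->; exists (g * h)%g; rewrite act_meanM. Qed.

Definition orbit_act g (y : orbit x) : orbit x :=
  exist _ (act_mean g (sval y)) (orbit_act_subproof g y).

Lemma orbit_eq (y z : orbit x) : sval y = sval z -> y = z.
Proof. by case: y z => [u p] [v q] /= uv; exact: eq_exist. Qed.

Lemma orbit_gact : gact orbit_act.
Proof.
by split=> [y|g h y]; apply: orbit_eq; rewrite /= ?act_mean1 ?act_meanM.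
Qed.

Definition orbit_base : orbit x :=
  exist _ x (ex_intro _ 1%g (esym (act_mean1 x))).

Lemma orbit_section : {sec : orbit x -> G |
  forall y, orbit_act (sec y) orbit_base = y}.
Proof.
exists (fun y : orbit x => projT1 (cid (proj2_sig y))) => y.
by apply: orbit_eq => /=; case: cid => g /= ->.
Qed.

End Orbit.

Lemma simple_powers_averaging (R : realType) (G : groupType) (T : seq G) (e : R) :
  cstar_simple R G -> 0 < e -> all (fun t => t != 1%g) T ->
  exists ws : seq (R * G), [/\ all (fun v => 0 <= v.1) ws,
    \sum_(v <- ws) v.1 = 1 &
    forall xi : sphere R G, \sum_(v <- ws)
      v.1 * (\sum_(t <- T) coeff (fun g h => (g * h)%g) (v.2^-1 * t * v.2)%g xi)
      <= e].
Proof.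
move=> [L [lam [lamP Ls]]] e0 T1.
have [p pmin] := minimal_invariant_exists R G; have [ps _ _] := pmin.
have [x0 x0e] := extreme_mean_exists ps.
(* Normalized on unbounded functions, so that means are separated by their
   values on bounded ones. *)
pose x (f : G -> R) := if pselect (bnd f) then x0 f else 0.
have xE f : bnd f -> x f = x0 f by rewrite /x; case: pselect.
have xe : extreme_mean p x.
  have [x0m x0p x0x] := x0e; split.
  - apply: mean_intro => [f g bf bg|c f bf|f c bf fc].
    + by rewrite !xE ?(meanD x0m)//; exact: bndD.
    + by rewrite !xE ?(meanZ x0m)//; exact: bndZ.
    + by rewrite xE//; exact: (sublin_le x0m).
  - by move=> f bf; rewrite xE//; exact: x0p.
  - move=> a b am bm ap bp abx f bf; rewrite xE//; apply: (x0x a b) => // g bg.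
    by rewrite abx// xE.
have xm : mean x by case: xe.
pose a := orbit_act (x := x); have aP := orbit_gact x.
pose z (y : orbit x) := sval y.
have zext y : extreme_mean p (z y).
  by rewrite /z; case: (svalP y) => g ->; exact: extreme_act.
have zE g y f : z (a g y) f = z y (translate g f) by [].
have zsep y y' : y <> y' -> exists2 f, bnd f & z y f != z y' f.
  move=> yy'; apply: contrapT => H; apply: yy'; apply: orbit_eq; apply/funext => f.
  have [bf|bf] := pselect (bnd f).
    by apply: contrapT => /eqP nf; apply: H; exists f.
  have out (u : orbit x) : z u f = 0.
    rewrite /z; case: (svalP u) => g ->; rewrite /act_mean /x.
    case: pselect => // bg; case: bf.
    by have := bnd_translate g^-1%g bg; rewrite translateM mulgV translate1.
  by have := out y; have := out y'; rewrite /z => -> ->.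
have [sec secE] := orbit_section x.
(* x is a mean on G invariant under its own stabilizer, which is therefore amenable; the weak
   containment rests on this. *)
have xstab h f : a h (orbit_base x) = orbit_base x -> bnd f ->
    x (translate h f) = x f.
  by move=> /(congr1 (fun y => z y f)).
have weak s (xi : orbit x -> R[i]) : fsupp xi ->
    nrm2 (gop a s xi) <= rnorm (gl lam s) ^+ 2 * nrm2 xi.
  apply: (weak_containment aP secE xm xstab) => zeta.
  exact: (gl_bound lamP).
have [w wm w0] := simple_mean lamP Ls (orbit_base x) aP weak.
have [y yT] := free_point aP pmin zext zE zsep (orbit_base x) wm w0 T1.
apply: (powers_averaging pmin e0 (zext y)) => t /yT ty.
by have [f bf ff] := zsep _ _ ty; exists f.
Qed.

(** * The conditional expectation of the crossed product *)

Lemma unitary_rep_norm (R : realType) (G : groupType) (A : cstarType R)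
  (u : G -> A) (t : G) : unitary_rep u -> rnorm (u t) = 1.
Proof.
move=> [u1 uM uV]; have := rnorm_starl (u t).
rewrite -uV -uM mulVg u1 rnorm1 => /esym/eqP.
by rewrite sqrf_eq1 => /orP[/eqP//|/eqP n]; have := rnorm_ge0 (u t); lra.
Qed.

Section Action.
Variables (R : realType) (G : groupType) (B : cstarType R).
Variable alpha : G -> B -> B.
Hypothesis alphaP : action alpha.

Lemma alphaK t b : alpha t^-1%g (alpha t b) = b.
Proof. by rewrite -(actionM alphaP) mulVg (action1 alphaP). Qed.

Lemma alpha_hom t : star_hom (alpha t). Proof. exact: (action_star_hom alphaP). Qed.

Lemma alpha_norm t b : rnorm (alpha t b) = rnorm b.
Proof.
apply/eqP; rewrite eq_le (sh_contract (alpha_hom t))/=.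
by rewrite -{1}(alphaK t b) (sh_contract (alpha_hom _)).
Qed.

End Action.

Section CrossedProductNorm.
Variables (R : realType) (G : groupType) (B A : cstarType R).
Variables (alpha : G -> B -> B) (iota : B -> A) (u : G -> A).
Hypotheses (alphaP : action alpha) (AP : reduced_crossed_product alpha iota u).
Variables (H : hilbertType R) (pi : B -> H -> H).
Hypothesis piP : faithful_rep pi.
Hypothesis rcpN : forall (F : {fset G}) (f : G -> B),
  (rnorm (\sum_(t <- F) iota (f t) ** u t))%:E =
  l2opnorm (fun (xi : G -> H) s =>
    \sum_(t <- F) induced_rep alpha pi (f t) (left_translation t xi) s).

Implicit Types (s : seq (B * G)) (xi : G -> H).

Let uP : unitary_rep u. Proof. exact: (rcp_unitary AP). Qed.
Let iotaP : star_hom iota. Proof. exact: (rcp_iota AP). Qed.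

(* A list of pairs (b, t) stands for the sum of the b u_t. *)
Definition cl s : A := \sum_(v <- s) iota v.1 ** u v.2.

Definition cop s xi (g : G) : H :=
  \sum_(v <- s) pi (alpha g^-1%g v.1) (xi (v.2^-1 * g)%g).

Definition ccoef s (t : G) : B := \sum_(v <- s | v.2 == t) v.1.

Definition copp s : seq (B * G) := [seq (- v.1, v.2) | v <- s].

Lemma pi_sum (I : Type) (r : seq I) (P : pred I) (F : I -> B) (xi : H) :
  pi (\sum_(k <- r | P k) F k) xi = \sum_(k <- r | P k) pi (F k) xi.
Proof. exact: (big_morph (pi^~ xi) (fun x y => piD piP x y xi) (pi0 piP xi)). Qed.

Lemma alpha_sum t (I : Type) (r : seq I) (P : pred I) (F : I -> B) :
  alpha t (\sum_(k <- r | P k) F k) = \sum_(k <- r | P k) alpha t (F k).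
Proof.
exact: (big_morph (alpha t) (shD (alpha_hom alphaP t)) (sh0 (alpha_hom alphaP t))).
Qed.

Lemma iota_sum (I : Type) (r : seq I) (P : pred I) (F : I -> B) :
  iota (\sum_(k <- r | P k) F k) = \sum_(k <- r | P k) iota (F k).
Proof. exact: (big_morph iota (shD iotaP) (sh0 iotaP)). Qed.

Lemma cmul_suml (C : cstarType R) (I : Type) (r : seq I) (P : pred I)
  (F : I -> C) (y : C) :
  (\sum_(k <- r | P k) F k) ** y = \sum_(k <- r | P k) F k ** y.
Proof. exact: (big_morph (cmul^~ y) (fun a b => cmulDl a b y) (c0mul y)). Qed.

Lemma cmul_sumr (C : cstarType R) (I : Type) (r : seq I) (P : pred I)
  (F : I -> C) (y : C) :
  y ** (\sum_(k <- r | P k) F k) = \sum_(k <- r | P k) y ** F k.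
Proof. exact: (big_morph (cmul y) (cmulDr y) (cmul0 y)). Qed.

Lemma cl_cat s s' : cl (s ++ s') = cl s + cl s'.
Proof. by rewrite /cl big_cat. Qed.

Lemma cl_opp s : cl (copp s) = - cl s.
Proof.
rewrite /cl big_map -sumrN; apply: eq_bigr => v _.
by rewrite (shN iotaP) cNmul.
Qed.

Lemma cop_cat s s' xi g : cop (s ++ s') xi g = cop s xi g + cop s' xi g.
Proof. by rewrite /cop big_cat. Qed.

Lemma cop_opp s xi g : cop (copp s) xi g = - cop s xi g.
Proof.
rewrite /cop big_map -sumrN; apply: eq_bigr => v _.
by rewrite (shN (alpha_hom alphaP _)) (piN piP).
Qed.

Lemma ccoef_cat s s' t : ccoef (s ++ s') t = ccoef s t + ccoef s' t.
Proof. by rewrite /ccoef big_cat. Qed.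

Lemma ccoef_opp s t : ccoef (copp s) t = - ccoef s t.
Proof. by rewrite /ccoef big_map -sumrN. Qed.

Lemma cl_norm s : (rnorm (cl s))%:E = l2opnorm (cop s).
Proof.
pose F : {fset G} := seq_fset tt [seq v.2 | v <- s].
have sF : {subset [seq v.2 | v <- s] <= F} by move=> t; rewrite seq_fsetE.
have -> : cl s = \sum_(t <- F) iota (ccoef s t) ** u t.
  rewrite /cl -(sum_fibers _ sF); apply: eq_bigr => t _.
  by rewrite iota_sum cmul_suml; apply: eq_bigr => v /eqP->.
rewrite rcpN; congr l2opnorm; apply/funext => xi; apply/funext => g.
rewrite /cop -(sum_fibers _ sF); apply: eq_bigr => t _.
rewrite /induced_rep /left_translation alpha_sum pi_sum.
by apply: eq_bigr => v /eqP->.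
Qed.

Lemma copZ s (r : R) xi :
  cop s (fun g => r%:C%C *: xi g) = fun g => r%:C%C *: cop s xi g.
Proof.
apply/funext => g; rewrite /cop scaler_sumr; apply: eq_bigr => v _.
exact: (pi_vecZ piP).
Qed.

Lemma cop_bound s xi : fsupp (fun g => rnorm (xi g) ^+ 2) ->
  l2le (cop s xi) (rnorm (cl s) ^+ 2 * fsum (fun g => rnorm (xi g) ^+ 2)).
Proof.
move=> sxi; apply: l2op_apply => //; first exact: rnorm_ge0.
  by rewrite cl_norm.
by move=> r zeta; exact: copZ.
Qed.

(** Apply the operator to a vector supported at 1 and read the coordinate t of the result. *)
Lemma ccoef_norm s t : rnorm (ccoef s t) <= rnorm (cl s).
Proof.
rewrite -(alpha_norm alphaP t^-1%g).
apply: (rnorm_le_pi piP); first exact: rnorm_ge0.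
move=> eta; pose xi (g : G) : H := if g == 1%g then eta else 0.
have sxi : fsupp (fun g => rnorm (xi g) ^+ 2).
  apply: (@fsupp_sub _ _ _ [set 1%g]) => // g /= /eqP/negPf; rewrite /xi => ->.
  by rewrite rnorm0 expr0n.
have := cop_bound s sxi (isT : uniq [:: t]).
rewrite big_seq1 (fsum_delta (y0 := 1%g)); last first.
  by move=> g; rewrite /xi => /negPf->; rewrite rnorm0 expr0n.
rewrite {2}/xi eqxx -exprMn.
have -> : cop s xi t = pi (alpha t^-1%g (ccoef s t)) eta.
  rewrite alpha_sum pi_sum [RHS]big_mkcond /cop; apply: eq_bigr => v _.
  rewrite /xi; have -> : ((v.2^-1 * t)%g == 1%g) = (v.2 == t).
    apply/eqP/eqP => [E|->]; last by rewrite mulVg.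
    by rewrite -[LHS]mulg1 -E mulVKg.
  by case: eqP => // _; exact: (pi_vec0 piP).
by rewrite ler_sqr// nnegrE ?mulr_ge0// rnorm_ge0.
Qed.

Lemma cl_dense (x : A) e : 0 < e -> exists (F : {fset G}) (f : G -> B),
  rnorm (x - cl [seq (f t, t) | t <- F]) < e.
Proof.
move=> e0; have : [set: A] x by [].
rewrite -(rcp_dense AP) => /closureP/(_ e e0)[_ [F [f ->]] xe].
by exists F, f; rewrite /cl big_map.
Qed.

(** The extension of the coefficient at 1 by continuity. The inequality against all lists determines
    e and replaces limits in the sequel. *)
Lemma cond_exp_exists (x : A) : exists e : B,
  forall s, rnorm (e - ccoef s 1%g) <= rnorm (x - cl s).
Proof.
have H0 n : exists s, rnorm (x - cl s) < n.+1%:R^-1.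
  by have [|F [f xf]] := @cl_dense x n.+1%:R^-1; [rewrite invr_gt0|eexists; exact: xf].
have [sq sqP] := choice H0.
have cdist s s' : rnorm (ccoef s 1%g - ccoef s' 1%g) <= rnorm (cl s - cl s').
  by rewrite -ccoef_opp -cl_opp -ccoef_cat -cl_cat; exact: ccoef_norm.
have small e : 0 < e -> exists N, forall n, (N <= n)%N -> rnorm (x - cl (sq n)) < e.
  move=> e0; have [N Ne] : exists N, N.+1%:R^-1 < e.
    exists (Num.truncn e^-1); rewrite invf_plt ?posrE//.
    exact: truncnS_gt.
  exists N => n Nn; apply: (lt_trans (sqP n)); apply: le_lt_trans Ne.
  by rewrite lef_pV2 ?posrE// ler_nat.
have [|l lP] := @rcauchy_cvg R B (fun n => ccoef (sq n) 1%g).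
  move=> e e0; have [N HN] := small (e / 2) (divr_gt0 e0 (ltr0n _ 2)).
  exists N => m n Nm Nn; apply: (le_lt_trans (cdist _ _)).
  apply: (le_lt_trans (rdist_triangle x _ _)); rewrite rdistC.
  by have := HN _ Nm; have := HN _ Nn => ? ?; lra.
exists l => s; apply/ler_addgt0Pl => e e0.
have e2 : 0 < e / 2 by rewrite divr_gt0.
have [N1 HN1] := small _ e2; have [N2 HN2] := lP _ e2.
pose n := maxn N1 N2.
have h1 := HN1 n (leq_maxl _ _); have h2 := HN2 n (leq_maxr _ _).
apply: (le_trans (rdist_triangle (ccoef (sq n) 1%g) _ _)).
have := cdist (sq n) s; have := rdist_triangle x (cl (sq n)) (cl s).
by rewrite (rdistC (cl _) x) (rdistC l) => ? ?; lra.
Qed.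

Definition cond_exp (x : A) : B := projT1 (cid (cond_exp_exists x)).

Lemma cond_expP x s : rnorm (cond_exp x - ccoef s 1%g) <= rnorm (x - cl s).
Proof. by rewrite /cond_exp; case: cid. Qed.

Lemma cl_dense_seq (x : A) e : 0 < e -> exists s, rnorm (x - cl s) < e.
Proof. by move=> /(cl_dense x)[F [f xf]]; eexists; exact: xf. Qed.

Lemma cond_expD x y : cond_exp (x + y) = cond_exp x + cond_exp y.
Proof.
apply/eqP; rewrite -subr_eq0; apply/eqP; apply: (rnorm_small (K := 4)) => e e0.
have [s xs] := cl_dense_seq x e0; have [s' ys] := cl_dense_seq y e0.
have h1 := cond_expP x s; have h2 := cond_expP y s'.
have := cond_expP (x + y) (s ++ s'); rewrite ccoef_cat cl_cat => h3.
have h4 := rnormD (x - cl s) (y - cl s').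
have E4 : x - cl s + (y - cl s') = x + y - (cl s + cl s') by zmod.
rewrite E4 in h4.
set p := cond_exp (x + y) - _ in h3.
set q := cond_exp x - _ in h1; set r := cond_exp y - _ in h2.
have -> : cond_exp (x + y) - (cond_exp x + cond_exp y) = p - (q + r).
  by rewrite /p /q /r; zmod.
have := rnormB p (q + r); have := rnormD q r => ? ?; lra.
Qed.

Lemma cond_exp_conj t x :
  cond_exp (star (u t) ** x ** u t) = alpha t^-1%g (cond_exp x).
Proof.
apply/eqP; rewrite -subr_eq0; apply/eqP; apply: (rnorm_small (K := 2)) => e e0.
have [s xs] := cl_dense_seq x e0.
pose s' : seq (B * G) := [seq (alpha t^-1%g v.1, (t^-1 * v.2 * t)%g) | v <- s].
have cs' : cl s' = star (u t) ** cl s ** u t.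
  rewrite /cl big_map cmul_sumr cmul_suml; apply: eq_bigr => v _ /=.
  rewrite (rcp_conj AP) !(unitary_repM uP) (unitary_repV uP) !cmulA.
  rewrite -[star (u t) ** iota v.1 ** u t ** star (u t)]cmulA.
  by rewrite -(unitary_repV uP) -(unitary_repM uP) mulgV (unitary_rep1 uP) cmulr1.
have c1 : ccoef s' 1%g = alpha t^-1%g (ccoef s 1%g).
  rewrite /ccoef big_map alpha_sum /=; apply: eq_bigl => v.
  apply/eqP/eqP => [E|->]; last by rewrite mulg1 mulVg.
  have -> : v.2 = (t * (t^-1 * v.2 * t) * t^-1)%g.
    by rewrite !mulgA mulgV mul1g mulgK.
  by rewrite E mulg1 mulgV.
have h1 := cond_expP (star (u t) ** x ** u t) s'.
rewrite cs' c1 in h1.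
have h2 : rnorm (star (u t) ** x ** u t - star (u t) ** cl s ** u t) <= rnorm (x - cl s).
  rewrite -cmulBl -cmulBr; apply: (le_trans (rnormM _ _)).
  rewrite (unitary_rep_norm _ uP) mulr1; apply: (le_trans (rnormM _ _)).
  by rewrite rnorm_star (unitary_rep_norm _ uP) mul1r.
have h3 : rnorm (alpha t^-1%g (ccoef s 1%g) - alpha t^-1%g (cond_exp x)) <=
    rnorm (x - cl s).
  rewrite -(shB (alpha_hom alphaP _)) (alpha_norm alphaP) rdistC.
  exact: cond_expP.
by apply: (le_trans (rdist_triangle (alpha t^-1%g (ccoef s 1%g)) _ _)); lra.
Qed.

Definition cfs (F : {fset G}) (f : G -> B) : seq (B * G) :=
  [seq (f t, t) | t <- F].

Definition csq (F : {fset G}) (f : G -> B) : seq (B * G) :=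
  [seq (alpha t^-1%g (star (f t) ** f t'), (t^-1 * t')%g) | t <- F, t' <- F].

Lemma ccoef_cfs (F : {fset G}) (f : G -> B) t :
  ccoef (cfs F f) t = if t \in F then f t else 0.
Proof.
rewrite /ccoef big_map /= -big_filter; case: ifP => tF.
  by rewrite filter_pred1_uniq ?fset_uniq// big_seq1.
rewrite big_filter big_seq_cond big1// => v /andP[vF /eqP vt].
by rewrite vt tF in vF.
Qed.

Lemma cl_csq (F : {fset G}) (f : G -> B) :
  cl (csq F f) = star (cl (cfs F f)) ** cl (cfs F f).
Proof.
rewrite /cl /csq /cfs big_allpairs_dep !big_map.
rewrite (big_morph star starD (star0 A)) cmul_suml; apply: eq_bigr => t _ /=.
rewrite cmul_sumr; apply: eq_bigr => t' _ /=.
rewrite (rcp_conj AP) (unitary_repM uP) (unitary_repV uP) starM.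
rewrite -[LHS]cmulA [u t ** _]cmulA -(unitary_repV uP) -(unitary_repM uP) mulgV.
by rewrite (unitary_rep1 uP) cmul1 (star_homM iotaP) (star_hom_star iotaP) !cmulA.
Qed.

Lemma ccoef_csq (F : {fset G}) (f : G -> B) : ccoef (csq F f) 1%g =
  \sum_(t <- F) alpha t^-1%g (star (f t) ** f t).
Proof.
rewrite /ccoef /csq big_mkcond big_allpairs_dep /=.
rewrite big_seq [RHS]big_seq; apply: eq_bigr => t tF.
rewrite (bigD1_seq t)//= ?fset_uniq// mulVg eqxx big1 ?addr0// => t' tt'.
case: eqP => // E; case/eqP: tt'.
by rewrite -[LHS](mulVKg t) E mulg1.
Qed.

Lemma sq_approx (z : A) e : 0 < e -> exists (F : {fset G}) (f : G -> B),
  rnorm (z - cl (cfs F f)) < e /\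
  rnorm (star z ** z - cl (csq F f)) < e.
Proof.
move=> e0; have [d d0 Hd] := cmul_approx (star z) z e0.
have m0 : 0 < Num.min d e by rewrite lt_min d0 e0.
have [F [f zf]] := cl_dense z m0; exists F, f.
have zd : rnorm (z - cl (cfs F f)) < d by apply: lt_le_trans zf _; rewrite ge_min lexx.
split; first by apply: lt_le_trans zf _; rewrite ge_min lexx orbT.
by rewrite cl_csq; apply: Hd => //; rewrite -starB rnorm_star.
Qed.

Lemma csq_term_spos t b : spos (alpha t^-1%g (star b ** b)).
Proof. by apply: (sh_spos (alpha_hom alphaP _)); exact: kaplansky. Qed.

Lemma cond_exp_spos z : spos (cond_exp (star z ** z)).
Proof.
apply: spos_limit => e e0; have [F [f [_ zf]]] := sq_approx z e0.
exists (ccoef (csq F f) 1%g).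
  by rewrite ccoef_csq; apply: spos_sum => t; exact: csq_term_spos.
exact: le_lt_trans (cond_expP _ _) zf.
Qed.

(** The coefficient at 1 of an approximant of z^* z is a sum of positive terms, the translates of
    f_t^* f_t, and dominates each of them in norm. As the norm of f_t enters squared, the
    approximation is made up to e ^+ 2. *)
Lemma cond_exp_small z e : cond_exp (star z ** z) = 0 -> 0 < e ->
  exists (F : {fset G}) (f : G -> B), rnorm (z - cl (cfs F f)) < e /\
    forall t, t \in F -> rnorm (f t) <= e.
Proof.
move=> Ez e0; have m0 : 0 < Num.min e (e ^+ 2) by rewrite lt_min e0 exprn_gt0.
have [F [f [zf sf]]] := sq_approx z m0; exists F, f; split.
  by apply: lt_le_trans zf _; rewrite ge_min lexx.
move=> t tF; rewrite -ler_sqr ?nnegrE ?rnorm_ge0//; last exact: ltW.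
rewrite -rnorm_starl -(alpha_norm alphaP t^-1%g).
have := cond_expP (star z ** z) (csq F f).
rewrite Ez sub0r rnormN ccoef_csq => Hle.
apply: (@le_trans _ _ (rnorm (\sum_(t <- F) alpha t^-1%g (star (f t) ** f t)))).
  apply: spos_norm_le; first exact: csq_term_spos.
  rewrite (bigD1_seq t)//= ?fset_uniq// addrC addrK -big_filter.
  by apply: spos_sum => t'; exact: csq_term_spos.
apply: (le_trans Hle); apply: ltW; apply: (lt_le_trans sf).
by rewrite ge_min lexx orbT.
Qed.

Lemma rnorm_sqD (V : normedModType R[i]) (x y : V) :
  rnorm (x + y) ^+ 2 <= 2 * rnorm x ^+ 2 + 2 * rnorm y ^+ 2.
Proof.
have h := rnormD x y; have hx := rnorm_ge0 x; have hy := rnorm_ge0 y.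
have hxy := rnorm_ge0 (x + y).
apply: (@le_trans _ _ ((rnorm x + rnorm y) ^+ 2)).
  by rewrite ler_sqr// nnegrE// addr_ge0.
by have := sqr_ge0 (rnorm x - rnorm y); rewrite !expr2 => ?; lra.
Qed.

Lemma rnorm_sum (V : normedModType R[i]) (I : Type) (r : seq I) (F : I -> V) :
  rnorm (\sum_(k <- r) F k) <= \sum_(k <- r) rnorm (F k).
Proof.
elim: r => [|k r IH]; first by rewrite !big_nil rnorm0.
by rewrite !big_cons; apply: (le_trans (rnormD _ _)); rewrite lerD2l.
Qed.

Lemma le_sum_uniq (P : seq G) (n : G -> R) (F : {fset G}) : uniq P ->
  (forall g, 0 <= n g) -> (forall g, g \notin P -> n g = 0) ->
  \sum_(t <- F) n t <= \sum_(t <- P) n t.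
Proof.
move=> uP' n0 nP.
have s1 : fsupp n by apply: (fsupp_sub (finite_seq P)) => g /= /negP; exact: nP.
rewrite -(fsum_seq uP' nP).
pose h t := if t \in F then n t else 0.
have -> : \sum_(t <- F) n t = fsum h.
  rewrite (@fsum_seq _ _ h F)//; last by move=> t; rewrite /h => /negPf->.
  by rewrite big_seq [RHS]big_seq; apply: eq_bigr => t; rewrite /h => ->.
apply: fsum_le => // [|t]; last by rewrite /h; case: ifP.
by apply: (fsuppW s1) => t; rewrite /h => ->; case: ifP.
Qed.

(** Small coefficients do not make an approximant small, as the number of its terms is not bounded.
    So one approximant s1, a vector and a finite set S of coordinates are fixed; only the entries of
    the vector in the finite set P then matter, and a second approximant s0 with coefficients at
    most d contributes at most d |P| to each coordinate, however many terms it has. *)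
Lemma cond_exp_faithful z : cond_exp (star z ** z) = 0 -> z = 0.
Proof.
move=> Ez; apply: (rnorm_small (K := 3)) => e e0.
have [F1 [f1 [zf1 _]]] := cond_exp_small Ez e0; set s1 := cfs F1 f1 in zf1.
suff : rnorm (cl s1) <= 2 * e.
  by have := rnormD (z - cl s1) (cl s1); rewrite subrK => ? ?; lra.
have e20 : 0 <= 2 * e by rewrite mulr_ge0// ltW.
rewrite -lee_fin cl_norm; apply/(l2opnorm_leP _ e20) => xi xi1 S uS.
pose P := undup [seq (t^-1 * g)%g | t <- F1, g <- S].
have uP' : uniq P by exact: undup_uniq.
pose xi' g : H := if g \in P then xi g else 0.
have xi'0 g : g \notin P -> xi' g = 0 by rewrite /xi' => /negPf->.
have sxi' : fsupp (fun g => rnorm (xi' g) ^+ 2).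
  apply: (fsupp_sub (finite_seq P)) => g /= /negP/xi'0->.
  by rewrite rnorm0 expr0n.
have xi'1 : fsum (fun g => rnorm (xi' g) ^+ 2) <= 1.
  rewrite (@fsum_seq _ _ _ P)//; last by move=> g /xi'0->; rewrite rnorm0 expr0n.
  apply: le_trans (xi1 P uP'); rewrite big_seq [leRHS]big_seq.
  by apply: ler_sum => g gP; rewrite /xi' gP.
have copE g : g \in S -> cop s1 xi g = cop s1 xi' g.
  move=> gS; rewrite /cop /s1 /cfs !big_map big_seq [RHS]big_seq.
  apply: eq_bigr => t tF /=; rewrite /xi' ifT// mem_undup.
  by apply/allpairsP; exists (t, g).
have xn g : rnorm (xi' g) <= 1.
  have h : rnorm (xi' g) ^+ 2 <= 1.
    exact: (le_trans (le_fsum g sxi' (fun g => sqr_ge0 _)) xi'1).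
  by rewrite -(@expr_le1 _ 2)// rnorm_ge0.
pose k : R := (size P)%:R.
have bound d : 0 < d -> \sum_(g <- S) rnorm (cop s1 xi g) ^+ 2 <=
    2 * (e + d) ^+ 2 + 2 * ((size S)%:R * (d * k) ^+ 2).
  move=> d0; have [F0 [f0 [zf0 f0d]]] := cond_exp_small Ez d0.
  set s0 := cfs F0 f0 in zf0.
  have split g : g \in S -> cop s1 xi g = cop (s1 ++ copp s0) xi' g + cop s0 xi' g.
    by move=> gS; rewrite copE// cop_cat cop_opp subrK.
  rewrite big_seq; apply: (@le_trans _ _ (\sum_(g <- S | g \in S)
      (2 * rnorm (cop (s1 ++ copp s0) xi' g) ^+ 2 +
       2 * rnorm (cop s0 xi' g) ^+ 2))).
    by apply: ler_sum => g gS; rewrite split//; exact: rnorm_sqD.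
  rewrite -big_seq big_split /= -!mulr_sumr; apply: lerD; rewrite ler_pM2l//.
    apply: (le_trans (cop_bound _ sxi' uS)).
    rewrite cl_cat cl_opp; set m := rnorm _.
    have m0 : 0 <= m by exact: rnorm_ge0.
    have me : m <= e + d.
      by have := rdist_triangle z (cl s1) (cl s0); rewrite (rdistC (cl s1) z) /m => ?; lra.
    apply: (@le_trans _ _ (m ^+ 2 * 1)).
      by rewrite ler_wpM2l// sqr_ge0.
    by rewrite mulr1 ler_sqr// nnegrE// (le_trans m0).
  apply: (@le_trans _ _ (\sum_(g <- S) (d * k) ^+ 2)); last first.
    by rewrite big_const_seq count_predT iter_addr addr0 mulr_natl.
  apply: ler_sum => g _; rewrite ler_sqr ?nnegrE ?rnorm_ge0//; last first.
    by rewrite mulr_ge0 ?(ltW d0)// ler0n.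
  rewrite /cop /s0 /cfs big_map /=; apply: (le_trans (rnorm_sum _ _)).
  apply: (@le_trans _ _ (\sum_(t <- F0) d * rnorm (xi' (t^-1 * g)%g))).
    rewrite big_seq [leRHS]big_seq; apply: ler_sum => t tF.
    apply: (le_trans (pi_bound piP _ _)); rewrite (alpha_norm alphaP).
    by rewrite ler_wpM2r ?rnorm_ge0// f0d.
  rewrite -mulr_sumr ler_pM2l//.
  pose n h := rnorm (xi' h).
  pose F' : {fset G} := [fset (t^-1 * g)%g | t in F0]%fset.
  have -> : \sum_(t <- F0) rnorm (xi' (t^-1 * g)%g) = \sum_(h <- F') n h.
    rewrite /F' big_imfset//= => t t' _ _ /mulIg/invg_inj//.
  apply: (le_trans (le_sum_uniq F' uP' _ _)) => [h|h /xi'0|].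
  - exact: rnorm_ge0.
  - by rewrite /n => ->; exact: rnorm0.
  apply: (@le_trans _ _ (\sum_(h <- P) 1)); first by apply: ler_sum => h _; exact: xn.
  by rewrite big_const_seq count_predT iter_addr addr0 /k.
pose m : R := (size S)%:R * k ^+ 2.
have m0 : 0 <= m by rewrite mulr_ge0 ?ler0n ?sqr_ge0.
(* This choice bounds the sum by 2 (5 e / 4)^2 + 2 (e / 4)^2, which is below (2 e)^2. *)
pose d := Num.min (e / 4) (e / (4 * (m + 1))).
have m1 : 0 < m + 1 by rewrite ltr_wpDl.
have d0 : 0 < d by rewrite lt_min !divr_gt0// mulr_gt0.
have d4 : d <= e / 4 by rewrite ge_min lexx.
have dm : d * (m + 1) <= e / 4.
  rewrite -ler_pdivlMr//; have -> : e / 4 / (m + 1) = e / (4 * (m + 1)).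
    by field; rewrite gt_eqF.
  by rewrite ge_min lexx orbT.
apply: (le_trans (bound d d0)).
have -> : (size S)%:R * (d * k) ^+ 2 = d * (d * m) by rewrite /m; ring.
have dm' : d * (d * m) <= e / 4 * (e / 4).
  apply: ler_pM => //; [exact: ltW|by rewrite mulr_ge0// ltW|].
  by move: dm; rewrite mulrDr mulr1 => ?; lra.
have h2 : (e + d) ^+ 2 <= (e + e / 4) ^+ 2.
  by rewrite ler_sqr ?nnegrE ?addr_ge0 ?divr_ge0 ?(ltW e0) ?(ltW d0)// lerD2l.
have : 2 * (e + e / 4) ^+ 2 + 2 * (e / 4 * (e / 4)) <= (2 * e) ^+ 2.
  by have := sqr_ge0 e; rewrite !expr2 => ?; lra.
by move=> ?; lra.
Qed.

End CrossedProductNorm.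

(** * Intermediate algebras *)

Section IdealUnit.
Variables (R : realType) (A : cstarType R).

Fixpoint cpow (x : A) n : A := if n is m.+1 then cpow x m ** x else 1c.

(* The powers of x = 1 - w/T tend to 0, and 1 - x^n lies in the ideal. *)
Lemma ideal_unit (D I : set A) (w : A) (c : R) : sub_cstar D -> D 1c ->
  closed_ideal D I -> I w -> 0 < c -> spos (w - creal A c) -> I 1c.
Proof.
move=> DP D1 IP Iw c0 wc.
have wp : spos w.
  by rewrite -(subrK (creal A c) w); apply: sposD => //; apply: spos_creal; exact: ltW.
pose T := Num.max (rnorm w) c.
have wT : rnorm w <= T by rewrite le_max lexx.
have cT : c <= T by rewrite le_max lexx orbT.
have T0 : 0 < T by exact: lt_le_trans cT.
have Ti : 0 <= T^-1 by rewrite invr_ge0 ltW.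
pose x := 1c - (T^-1)%:C%C *: w.
have xp : spos x.
  have := sposZ Ti (sposB_norm (spos_star_self wp) wT).
  by rewrite scalerBr crealZ mulVf ?gt_eqF// creal1.
pose q := 1 - c / T.
have q0 : 0 <= q by rewrite subr_ge0 ler_pdivrMr// mul1r.
have q1 : q < 1 by rewrite gtrBl divr_gt0.
have xq : rnorm x <= q.
  apply: spos_le_norm => //; have := sposZ Ti wc.
  rewrite scalerBr crealZ crealB creal1 mulrC.
  suff -> : 1c - creal A (c / T) - x = (T^-1)%:C%C *: w - creal A (c / T) by [].
  by rewrite /x; zmod.
have Dw : D w by exact: (closed_ideal_sub IP).
have ISub y z : I y -> I z -> I (y - z).
  move=> Iy Iz; apply: (closed_idealD IP) => //.
  by rewrite -scaleN1r; exact: (closed_idealZ IP).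
have Iw' : I ((T^-1)%:C%C *: w) by exact: (closed_idealZ IP).
have Dx : D x.
  apply: (sub_cstarD DP) => //; rewrite -scaleN1r; apply: (sub_cstarZ DP).
  by apply: (sub_cstarZ DP).
have Ipow n : I (1c - cpow x n).
  elim: n => [|n IH] /=; first by rewrite subrr; exact: (closed_ideal0 IP).
  have -> : 1c - cpow x n ** x = (1c - cpow x n) ** x + (T^-1)%:C%C *: w.
    by rewrite cmulBl cmul1 /x; zmod.
  by apply: (closed_idealD IP) => //; exact: (closed_idealMr IP).
have npow n : rnorm (cpow x n) <= q ^+ n.
  elim: n => [|n IH] /=; first by rewrite rnorm1 expr0.
  rewrite exprSr; apply: (le_trans (rnormM _ _)).
  by apply: ler_pM; rewrite ?rnorm_ge0.
apply: (closed_rnormP I).1; first exact: (closed_ideal_closed IP).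
move=> e e0; have /cvgrPdist_lt/(_ e e0)[N _ HN] : (fun n => q ^+ n) @ \oo --> (0 : R).
  by apply: cvg_expr; rewrite ger0_norm.
exists (1c - cpow x N) => //.
rewrite opprB addrC subrK; apply: (le_lt_trans (npow N)).
by have := HN N (leqnn N); rewrite sub0r normrN ger0_norm// exprn_ge0.
Qed.

End IdealUnit.

(** * Averaging in the crossed product *)

Section Averaging.
Variables (R : realType) (G : groupType) (B A : cstarType R).
Variables (alpha : G -> B -> B) (iota : B -> A) (u : G -> A).
Hypotheses (alphaP : action alpha) (AP : reduced_crossed_product alpha iota u).
Variables (H : hilbertType R) (pi : B -> H -> H).
Hypothesis piP : faithful_rep pi.
Hypothesis rcpN : forall (F : {fset G}) (f : G -> B),
  (rnorm (\sum_(t <- F) iota (f t) ** u t))%:E =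
  l2opnorm (fun (xi : G -> H) s =>
    \sum_(t <- F) induced_rep alpha pi (f t) (left_translation t xi) s).

Let uP : unitary_rep u. Proof. exact: (rcp_unitary AP). Qed.
Let iotaP : star_hom iota. Proof. exact: (rcp_iota AP). Qed.
Let lmul (g h : G) := (g * h)%g.
Let lP : gact lmul. Proof. exact: lmul_gact. Qed.

(* Pointwise, the operator is dominated by the positive scalar kernel with the
   coefficients k, whose quadratic form is bounded by e. *)
Lemma dominated_norm (I : eqType) (r : seq I) (b : I -> B) (g : I -> G)
  (k : I -> R) (e : R) : 0 < e ->
  (forall j, j \in r -> rnorm (b j) <= k j) ->
  (forall f : G -> R, fsupp f ->
    \sum_(j <- r) k j * cform lmul (g j) f <= e * fsum (fun y => f y ^+ 2)) ->
  rnorm (\sum_(j <- r) iota (b j) ** u (g j)) <= 4 * e.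
Proof.
move=> e0 bk Q; pose s : seq (B * G) := [seq (b j, g j) | j <- r].
have -> : \sum_(j <- r) iota (b j) ** u (g j) = cl iota u s by rewrite /cl big_map.
have e4 : 0 <= 4 * e by rewrite mulr_ge0// ltW.
rewrite -lee_fin (cl_norm alphaP AP piP rcpN); apply/(l2opnorm_leP _ e4) => xi xi1 S uS.
have k0 j : j \in r -> 0 <= k j by move=> /bk; apply: le_trans; exact: rnorm_ge0.
pose P := undup [seq ((g j)^-1 * h)%g | j <- r, h <- S].
have uP' : uniq P by exact: undup_uniq.
pose n h := if h \in P then rnorm (xi h) else 0.
have n0 h : 0 <= n h by rewrite /n; case: ifP => // _; exact: rnorm_ge0.
have ns : fsupp n.
  by apply: (fsupp_sub (finite_seq P)) => h /= /negP/negPf; rewrite /n => ->.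
have n1 : fsum (fun h => n h ^+ 2) <= 1.
  rewrite (@fsum_seq _ _ _ P)//; last by move=> h; rewrite /n => /negPf->; rewrite expr0n.
  apply: le_trans (xi1 P uP'); rewrite big_seq [leRHS]big_seq.
  by apply: ler_sum => h hP; rewrite /n hP.
pose Tn h := \sum_(j <- r) k j * n ((g j)^-1 * h)%g.
have Tn0 h : 0 <= Tn h.
  by rewrite /Tn big_seq; apply: sumr_ge0 => j /k0 kj; rewrite mulr_ge0.
have copT h : h \in S -> rnorm (cop alpha pi s xi h) <= Tn h.
  move=> hS; rewrite /cop big_map; apply: (le_trans (rnorm_sum _ _)).
  rewrite /Tn big_seq [leRHS]big_seq; apply: ler_sum => j jr /=.
  apply: (le_trans (pi_bound piP _ _)); rewrite (alpha_norm alphaP).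
  rewrite /n ifT; first by rewrite ler_wpM2r ?rnorm_ge0// bk.
  by rewrite mem_undup; apply/allpairsP; exists (j, h).
(* eta is Tn cut down to the finite set S, so that its squared norm and its inner product with Tn
   are both N. *)
pose eta h := if h \in S then Tn h else 0.
have eta0 h : 0 <= eta h by rewrite /eta; case: ifP.
have es : fsupp eta.
  by apply: (fsupp_sub (finite_seq S)) => h /= /negP/negPf; rewrite /eta => ->.
pose N := \sum_(h <- S) Tn h ^+ 2.
have N0 : 0 <= N by apply: sumr_ge0 => h _; exact: sqr_ge0.
have NE : fsum (fun h => eta h ^+ 2) = N.
  rewrite (@fsum_seq _ _ _ S)//; last by move=> h; rewrite /eta => /negPf->; rewrite expr0n.
  by rewrite /N big_seq [RHS]big_seq; apply: eq_bigr => h hS; rewrite /eta hS.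
have NE' : fsum (fun h => Tn h * eta h) = N.
  rewrite -NE; apply: eq_fsum => h; rewrite /eta; case: ifP => _; last by rewrite mulr0 expr0n.
  by rewrite expr2.
suff N16 : N <= (4 * e) ^+ 2.
  apply: le_trans N16; rewrite /N big_seq [leRHS]big_seq; apply: ler_sum => h hS.
  by rewrite ler_sqr ?nnegrE ?rnorm_ge0// copT.
(* The form at n + rho eta dominates rho N, since all terms are nonnegative, and is at most e (2 + 2
   rho^2 N). With rho = 1 / (4 e) the part with N is half of rho N, whence rho N <= 4 e. *)
pose rho := (4 * e)^-1.
have rho0 : 0 < rho by rewrite invr_gt0 mulr_gt0.
pose f h := n h + rho * eta h.
have fs : fsupp f by apply: fsuppD => //; exact: fsuppMr.
have sq (v : G -> R) : fsupp v -> fsupp (fun h => v h ^+ 2).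
  by move=> sv; apply: (fsuppW sv) => h ->; rewrite expr0n.
have f2 : fsum (fun h => f h ^+ 2) <= 2 + 2 * rho ^+ 2 * N.
  rewrite -NE; apply: (@le_trans _ _ (2 * fsum (fun h => n h ^+ 2) +
      2 * rho ^+ 2 * fsum (fun h => eta h ^+ 2))); last by lra.
  rewrite -!fsumZ -fsumD; [|by apply: fsuppMr; exact: sq..].
  apply: fsum_le => [||h]; first exact: sq.
    by apply: fsuppD; apply: fsuppMr; exact: sq.
  by rewrite /f; have := sqr_ge0 (n h - rho * eta h); rewrite !expr2 => ?; lra.
have low : rho * N <= \sum_(j <- r) k j * cform lmul (g j) f.
  have sj j : fsupp (fun h => n ((g j)^-1 * h)%g * eta h) by exact: fsuppMr.
  have -> : rho * N = \sum_(j <- r) k j *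
      (rho * fsum (fun h => n ((g j)^-1 * h)%g * eta h)).
    rewrite -NE' [in LHS](eq_fsum (g := fun h => \sum_(j <- r)
      k j * (n ((g j)^-1 * h)%g * eta h))).
      rewrite fsum_sum => [|j]; last exact: fsuppMr.
      by rewrite mulr_sumr; apply: eq_bigr => j _; rewrite fsumZ mulrCA.
    by move=> h; rewrite /Tn mulr_suml; apply: eq_bigr => j _; rewrite mulrA.
  rewrite big_seq [leRHS]big_seq; apply: ler_sum => j jr.
  rewrite ler_wpM2l ?k0// -fsumZ; apply: fsum_le => [||h].
  - exact: fsuppMr.
  - exact: fsuppMr.
  rewrite /f /lmul; set x := n _; set y := eta h; set z := n h; set w := eta _.
  have -> : (x + rho * w) * (z + rho * y) =
     rho * (x * y) + (x * z + rho * w * (z + rho * y)) by ring.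
  have [x0 y0 z0 w0] : [/\ 0 <= x, 0 <= y, 0 <= z & 0 <= w].
    by split; [exact: n0|exact: eta0|exact: n0|exact: eta0].
  have r0 := ltW rho0.
  by rewrite lerDl addr_ge0 ?mulr_ge0 ?addr_ge0 ?mulr_ge0.
have := Q f fs => Qf.
have : rho * N <= e * (2 + 2 * rho ^+ 2 * N).
  apply: (le_trans low); apply: (le_trans Qf).
  by rewrite ler_pM2l.
have -> : e * (2 + 2 * rho ^+ 2 * N) = 2 * e + 2^-1 * (rho * N).
  by rewrite /rho; field; rewrite gt_eqF.
move=> h; have : rho * N <= 4 * e by lra.
by rewrite /rho ler_pdivrMl ?mulr_gt0// expr2.
Qed.

Definition waverage (ws : seq (R * G)) (x : A) : A :=
  \sum_(v <- ws) (v.1)%:C%C *: (star (u v.2) ** x ** u v.2).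

Lemma waverageD ws x y : waverage ws (x + y) = waverage ws x + waverage ws y.
Proof.
rewrite /waverage -big_split; apply: eq_bigr => v _ /=.
by rewrite cmulDr cmulDl scalerDr.
Qed.

Lemma waverage_norm ws x : all (fun v => 0 <= v.1) ws ->
  \sum_(v <- ws) v.1 = 1 -> rnorm (waverage ws x) <= rnorm x.
Proof.
move=> ws0 ws1; apply: (le_trans (rnorm_sum _ _)).
rewrite -[leRHS]mul1r -ws1 mulr_suml big_seq [leRHS]big_seq.
apply: ler_sum => v vws; rewrite rnormZr ger0_norm; last exact: (allP ws0).
apply: ler_wpM2l; first exact: (allP ws0).
apply: (le_trans (rnormM _ _)); rewrite (unitary_rep_norm _ uP) mulr1.
by apply: (le_trans (rnormM _ _)); rewrite rnorm_star (unitary_rep_norm _ uP) mul1r.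
Qed.

(** [dominated_norm] only sees a bound M of the norms of the coefficients, so Powers' averaging of
    the sum of the elements of F also works with coefficients in B. The tolerance e / 4 / M absorbs
    M and the constant 4 of that lemma. *)
Lemma waverage_small (F : {fset G}) (f : G -> B) e : cstar_simple R G ->
  0 < e -> 1%g \notin F -> exists ws : seq (R * G),
  [/\ all (fun v => 0 <= v.1) ws, \sum_(v <- ws) v.1 = 1 &
    rnorm (waverage ws (cl iota u (cfs F f))) <= e].
Proof.
move=> Gs e0 F1; pose M := \sum_(t <- F) rnorm (f t) + 1.
have M0 : 0 < M by rewrite ltr_wpDl// sumr_ge0// => t _; exact: rnorm_ge0.
have fM t : t \in F -> rnorm (f t) <= M.
  move=> tF; rewrite /M (bigD1_seq t)//= ?fset_uniq// -addrA lerDl.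
  by rewrite addr_ge0// sumr_ge0// => k _; exact: rnorm_ge0.
have eM : 0 < e / 4 / M by rewrite !divr_gt0.
have T1 : all (fun t => t != 1%g) (F : seq G).
  by apply/allP => t tF; apply: contra F1 => /eqP <-.
have [ws [ws0 ws1 wsP]] := simple_powers_averaging Gs eM T1.
exists ws; split=> //.
pose r : seq ((R * G) * G) := [seq (v, t) | v <- ws, t <- F].
pose b (j : (R * G) * G) : B := (j.1.1)%:C%C *: alpha (j.1.2)^-1%g (f j.2).
pose g (j : (R * G) * G) : G := ((j.1.2)^-1 * j.2 * j.1.2)%g.
have -> : waverage ws (cl iota u (cfs F f)) = \sum_(j <- r) iota (b j) ** u (g j).
  rewrite /waverage /r big_allpairs_dep /=; apply: eq_bigr => v _.
  rewrite /cl /cfs big_map cmul_sumr cmul_suml scaler_sumr; apply: eq_bigr => t _ /=.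
  rewrite (shZ iotaP) (rcp_conj AP) !(unitary_repM uP) (unitary_repV uP) cmulZl.
  congr (_ *: _); rewrite !cmulA; congr (_ ** _ ** _).
  rewrite -[RHS]cmulA -(unitary_repV uP) -(unitary_repM uP) mulgV.
  by rewrite (unitary_rep1 uP) cmulr1.
have -> : e = 4 * (e / 4) by field.
apply: (@dominated_norm _ r b g (fun j => j.1.1 * M)); first by rewrite divr_gt0.
  move=> j /allpairsP[[v t] /= [vws tF ->]]; rewrite /b /=.
  rewrite rnormZr (alpha_norm alphaP) ger0_norm; last exact: (allP ws0).
  by rewrite ler_wpM2l ?fM//; exact: (allP ws0).
move=> h sh; pose r' : seq (R * G) := [seq (j.1.1, g j) | j <- r].
have r'P (xi : sphere R G) : \sum_(v <- r') v.1 * coeff lmul v.2 xi <= e / 4 / M.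
  apply: le_trans (wsP xi); rewrite le_eqVlt; apply/orP; left; apply/eqP.
  rewrite /r' /r big_map big_allpairs_dep /=; apply: eq_bigr => v _.
  by rewrite mulr_sumr.
have := sphere_homogeneous r'P sh; rewrite /r' big_map /= => Hr.
have -> : \sum_(j <- r) j.1.1 * M * cform lmul (g j) h =
    M * \sum_(j <- r) j.1.1 * cform lmul (g j) h.
  by rewrite mulr_sumr; apply: eq_bigr => j _; ring.
have -> : e / 4 = M * (e / 4 / M) by rewrite [RHS]mulrC divfK// gt_eqF.
by rewrite -mulrA ler_pM2l.
Qed.

Let E := cond_exp alphaP AP piP rcpN.

Lemma irreducible_of_full : cstar_simple R G ->
  (forall a : B, cpos a -> a <> 0 -> exists (n : nat) (t : 'I_n -> G),
     cle 1%cstar (\sum_(j < n) alpha (t j)^-1%g a)) ->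
  forall D : set A, sub_cstar D -> (forall t, D (u t)) -> simple D.
Proof.
move=> Gs full D DP Du.
have D1 : D 1c by rewrite -(unitary_rep1 uP); exact: Du.
have DuV t : D (star (u t)) by rewrite -(unitary_repV uP); exact: Du.
split=> [D0|I IP].
  by move: D1; rewrite D0 /= => /eqP; rewrite (negPf cone_neq0).
have [I0|I0] := pselect (exists2 z, I z & z <> 0); last first.
  left; apply/seteqP; split=> z /=; last by move->; exact: (closed_ideal0 IP).
  by move=> Iz; apply: contrapT => z0; apply: I0; exists z.
right; have [z Iz z0] := I0.
suff I1 : I 1c.
  apply/seteqP; split=> x; first exact: (closed_ideal_sub IP).
  by move=> Dx; rewrite -(cmulr1 x); exact: (closed_idealMl IP).
pose x := star z ** z.
have Ix : I x.
  apply: (closed_idealMl IP) => //; apply: (sub_cstar_star DP).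
  exact: (closed_ideal_sub IP).
have Ex : spos (E x) by exact: cond_exp_spos.
have Ex0 : E x <> 0 by move=> /cond_exp_faithful.
have [n [t /cleP xt]] := full _ ((cposP _).2 Ex) Ex0.
pose y := \sum_(j < n) star (u (t j)) ** x ** u (t j).
have Iconj w s : I w -> I (star (u s) ** w ** u s).
  by move=> Iw; apply: (closed_idealMr IP) => //; exact: (closed_idealMl IP).
have Isum (J : Type) (r : seq J) (F : J -> A) :
    (forall j, I (F j)) -> I (\sum_(j <- r) F j).
  move=> IF; elim: r => [|j r IH]; first by rewrite big_nil; exact: (closed_ideal0 IP).
  by rewrite big_cons; exact: (closed_idealD IP).
have Iy : I y by apply: Isum => j; exact: Iconj.
have E0 : E 0 = 0.
  by apply: (addrI (E 0)); rewrite -(cond_expD alphaP AP piP rcpN) !addr0.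
have Ey : E y = \sum_(j < n) alpha (t j)^-1%g (E x).
  rewrite /y (big_morph E (cond_expD alphaP AP piP rcpN) E0).
  by apply: eq_bigr => j _; exact: cond_exp_conj.
rewrite -Ey in xt.
have sEy : star (E y) = E y.
  by have := spos_star_self xt; rewrite starB star1 => /addIr.
(* Three errors of 1/10 arise: from the approximation of y, from the replacement of its coefficient
   at 1 by E y, and from the averaged terms off the unit. So W >= 1 - 3/10 >= 1/2. *)
have e10 : 0 < 10^-1 :> R by rewrite invr_gt0.
have [F [f yf]] := cl_dense AP y e10.
pose F' : {fset G} := (F `\ 1%g)%fset.
have F'1 : 1%g \notin F' by rewrite !inE eqxx.
pose b1 := ccoef (cfs F f) 1%g.
have clE : cl iota u (cfs F f) = iota b1 + cl iota u (cfs F' f).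
  have cl_mem (F0 : {fset G}) : cl iota u (cfs F0 f) =
      \sum_(s <- F0) iota (f s) ** u s by rewrite /cl /cfs big_map.
  rewrite !cl_mem /b1 ccoef_cfs; case: ifP => [F1|F1].
    rewrite (big_fsetD1 1%g)//= (unitary_rep1 uP) cmulr1; congr (_ + _).
  rewrite (sh0 iotaP) add0r; suff -> : F' = F by [].
  by apply/fsetP => s; rewrite !inE; case: eqP => // ->; rewrite F1.
have [ws [ws0 ws1 wsP]] := waverage_small f Gs e10 F'1.
have b1y : rnorm (iota (b1 - E y)) <= 10^-1.
  apply: (le_trans (sh_contract iotaP _)); rewrite rdistC.
  exact: le_trans (cond_expP alphaP AP piP rcpN _ _) (ltW yf).
pose W := waverage ws y.
apply: (ideal_unit (w := W) (c := 2^-1) DP D1 IP); last 2 first.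
- by rewrite invr_gt0.
- pose V := waverage ws (iota (E y)).
  have VW : rnorm (W - V) <= 3 / 10.
    have -> : W - V = waverage ws (y - cl iota u (cfs F f)) +
        (waverage ws (iota (b1 - E y)) + waverage ws (cl iota u (cfs F' f))).
      have aN v : waverage ws (- v) = - waverage ws v.
        apply/eqP; rewrite -addr_eq0 -waverageD addNr; apply/eqP.
        by rewrite /waverage big1// => k _; rewrite cmul0 c0mul scaler0.
      rewrite clE (shB iotaP) !waverageD !aN !waverageD /W /V; zmod.
    apply: (le_trans (rnormD _ _)).
    have h1 := waverage_norm (y - cl iota u (cfs F f)) ws0 ws1.
    have h2 := waverage_norm (iota (b1 - E y)) ws0 ws1.
    have := rnormD (waverage ws (iota (b1 - E y))) (waverage ws (cl iota u (cfs F' f))).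
    by lra.
  have sav v : star v = v -> star (waverage ws v) = waverage ws v.
    move=> sv; rewrite /waverage (big_morph star starD (star0 A)).
    by apply: eq_bigr => k _; rewrite starZr !starM starK sv cmulA.
  have sy : star y = y.
    rewrite /y (big_morph star starD (star0 A)); apply: eq_bigr => j _.
    by rewrite !starM !starK !cmulA.
  (* V - 1 is a convex combination of conjugates of E y - 1, which is positive. *)
  have V1 : spos (V - 1c).
    have -> : V - 1c = \sum_(v <- ws) (v.1)%:C%C *:
        iota (alpha v.2^-1%g (E y - 1c)).
      have -> : 1c = \sum_(v <- ws) (v.1)%:C%C *: 1c :> A.
        by rewrite -scaler_suml -(rmorph_sum (real_complex R)) ws1 rmorph1 scale1r.
      rewrite -sumrB; apply: eq_bigr => v _; rewrite -scalerBr; congr (_ *: _).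
      rewrite -(rcp_conj AP) (shB (alpha_hom alphaP _)) (shB iotaP).
      by rewrite (star_hom1 (alpha_hom alphaP _)) (star_hom1 iotaP).
    elim: (ws) ws0 => [_|v r IH /= /andP[v0 /IH r0]].
      by rewrite big_nil; exact: spos0.
    rewrite big_cons; apply: sposD r0; apply: sposZ => //.
    by apply: (sh_spos iotaP); exact: (sh_spos (alpha_hom alphaP _)).
  have sWV : star (W - V) = W - V.
    by rewrite starB !sav// -(star_hom_star iotaP) sEy.
  have p1 := sposD (sposD_norm sWV VW) V1.
  have -> : W - creal A 2^-1 = creal A (3 / 10) + (W - V) + (V - 1c) +
      creal A (1 - 3 / 10 - 2^-1).
    by rewrite !crealB creal1; zmod.
  by apply: sposD p1 _; apply: spos_creal; lra.
by apply: Isum => v; apply: (closed_idealZ IP); exact: Iconj.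
Qed.

End Averaging.

Lemma sub_cstar_smallest (R : realType) (A : cstarType R) (X : set A) :
  sub_cstar (smallest (@sub_cstar R A) X).
Proof.
split.
- by move=> D [DP _]; exact: (sub_cstar0 DP).
- by move=> x y Xx Xy D DX; case: (DX) => DP _; apply: (sub_cstarD DP); [exact: Xx|exact: Xy].
- by move=> c x Xx D DX; case: (DX) => DP _; apply: (sub_cstarZ DP); exact: Xx.
- by move=> x y Xx Xy D DX; case: (DX) => DP _; apply: (sub_cstarM DP); [exact: Xx|exact: Xy].
- by move=> x Xx D DX; case: (DX) => DP _; apply: (sub_cstar_star DP); exact: Xx.
- apply/closed_rnormP => x xX D DX; have [DP _] := DX.
  apply: ((closed_rnormP D).1 (sub_cstar_closed DP)) => e /xX[y Xy xy].
  by exists y => //; exact: Xy.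
Qed.

Lemma ceil_nat (R : realType) (x : R) : exists n : nat, x <= n%:R.
Proof.
exists (Num.truncn `|x|).+1; apply: (le_trans (ler_norm x)); apply: ltW.
exact: truncnS_gt.
Qed.

(** * The left ideal defined by the conjugates of a positive element *)

Section Idealizer.
Variables (R : realType) (G : groupType) (B A : cstarType R).
Variables (alpha : G -> B -> B) (iota : B -> A) (u : G -> A).
Hypotheses (alphaP : action alpha) (AP : reduced_crossed_product alpha iota u).
Variable a : B.
Hypothesis ap : spos a.

Let uP : unitary_rep u. Proof. exact: (rcp_unitary AP). Qed.
Let iotaP : star_hom iota. Proof. exact: (rcp_iota AP). Qed.

Definition orbit_sum (ts : seq G) : B := \sum_(t <- ts) alpha t^-1%g a.

Lemma orbit_sum_spos ts : spos (orbit_sum ts).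
Proof. by apply: spos_sum => t; exact: (sh_spos (alpha_hom alphaP _)). Qed.

Lemma orbit_sum_cat ts ts' : orbit_sum (ts ++ ts') = orbit_sum ts + orbit_sum ts'.
Proof. by rewrite /orbit_sum big_cat. Qed.

(** The real factor is rounded up to an integer, and the list is repeated that many times. *)
Lemma orbit_sum_scale ts (r : R) : 0 <= r ->
  exists ts', spos (orbit_sum ts' - r%:C%C *: orbit_sum ts).
Proof.
move=> r0; have [n rn] := ceil_nat r.
exists (flatten (nseq n ts)).
have -> : orbit_sum (flatten (nseq n ts)) = (n%:R : R)%:C%C *: orbit_sum ts.
  elim: n {rn} => [|n IH] /=; first by rewrite /orbit_sum big_nil rmorph0 scale0r.
  by rewrite orbit_sum_cat IH -natr1 rmorphD rmorph1 scalerDl scale1r addrC.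
rewrite -scalerBl -rmorphB; apply: sposZ; first by rewrite subr_ge0.
exact: orbit_sum_spos.
Qed.

(** The tolerance e makes this set closed in norm. *)
Definition order_left_ideal : set A := [set x | forall e, 0 < e ->
  exists ts, spos (iota (orbit_sum ts) + creal A e - star x ** x)].

Let N := order_left_ideal.

Lemma oli_scaled x y (r : R) : 0 < r -> N x ->
  (forall e, 0 < e -> spos (r%:C%C *: (star x ** x) + creal A e - star y ** y)) ->
  N y.
Proof.
move=> r0 Nx H e e0; have e1 : 0 < e / 2 / r by rewrite !divr_gt0.
have [ts xts] := Nx _ e1; have [ts' ts'P] := orbit_sum_scale ts (ltW r0).
exists ts'; have e2 : 0 < e / 2 by rewrite divr_gt0.
have := sposD (sposD (H _ e2) (sposZ (ltW r0) xts)) (sh_spos iotaP ts'P).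
rewrite (shB iotaP) (shZ iotaP) scalerBr scalerDr crealZ [r * _]mulrC divfK ?gt_eqF//.
rewrite {3}(splitr e) crealD.
set p := iota (orbit_sum ts'); set q := _ *: iota _; set s := _ *: (star x ** x).
set c := creal _ _; set d := star y ** y.
suff -> : s + c - d + (q + c - s) + (p - q) = p + (c + c) - d by [].
by zmod.
Qed.

Lemma oliM d x : N x -> N (d ** x).
Proof.
move=> Nx; apply: (oli_scaled (r := rnorm d ^+ 2 + 1)) Nx _.
  by rewrite ltr_wpDl// sqr_ge0.
move=> e e0; rewrite rmorphD rmorph1 scalerDl scale1r.
have := sposD (sposD (conj_le_norm x d) (kaplansky x)) (spos_creal A (ltW e0)).
set p := _ *: _; set q := star x ** x; set r := creal _ _; set s := star _ ** _.
suff -> : p - s + q + r = p + q + r - s by [].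
by zmod.
Qed.

Lemma oli0 : N 0.
Proof.
move=> e e0; exists [::]; rewrite star0 cmul0 subr0 /orbit_sum big_nil (sh0 iotaP).
by rewrite add0r; apply: spos_creal; exact: ltW.
Qed.

Lemma oliD x y : N x -> N y -> N (x + y).
Proof.
move=> Nx Ny e e0; have e4 : 0 < e / 4 by rewrite divr_gt0.
have [ts xts] := Nx _ e4; have [ts' yts'] := Ny _ e4.
(* Each list is taken twice because of the factor 2 in [sq_add_le]. *)
exists ((ts ++ ts') ++ (ts ++ ts')).
have two : 0 <= 2 :> R by [].
have := sposD (sq_add_le x y) (sposZ two (sposD xts yts')).
rewrite !orbit_sum_cat !(shD iotaP) (_ : 2 = 1 + 1 :> R)// rmorphD rmorph1.
rewrite !scalerDl !scale1r.
have -> : creal A e = creal A (e / 4) + creal A (e / 4) + (creal A (e / 4) + creal A (e / 4)).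
  by rewrite -!crealD; congr creal; field.
set p := iota _; set q := iota _; set c := creal _ _.
set X := star x ** x; set Y := star y ** y; set Z := star _ ** _.
suff -> : X + Y + (X + Y) - Z + (p + c - X + (q + c - Y) + (p + c - X + (q + c - Y)))
   = p + q + (p + q) + (c + c + (c + c)) - Z by [].
by zmod.
Qed.

Lemma oli_closed x : (forall e, 0 < e -> exists2 y, N y & rnorm (x - y) < e) -> N x.
Proof.
move=> H e e0; have e4 : 0 < e / 4 by rewrite divr_gt0.
have m0 : 0 < Num.min 1 (e / 4) by rewrite lt_min ltr01 e4.
have [y Ny xy] := H _ m0; have [ts yts] := Ny _ e4.
have d2 : rnorm (x - y) ^+ 2 <= e / 4.
  have n0 := rnorm_ge0 (x - y); have n1 : rnorm (x - y) <= 1.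
    by apply: ltW; apply: (lt_le_trans xy); rewrite ge_min lexx.
  rewrite expr2; apply: (@le_trans _ _ (1 * rnorm (x - y))).
    by rewrite ler_wpM2r.
  by rewrite mul1r ltW// (lt_le_trans xy)// ge_min lexx orbT.
exists (ts ++ ts); have two : 0 <= 2 :> R by [].
have p1 : spos (creal A (e / 4) - star (x - y) ** (x - y)).
  by apply: sposB_norm; rewrite ?starM ?starK// rnorm_starl.
have := sposD (sq_add_le y (x - y)) (sposZ two (sposD yts p1)).
rewrite [y + (x - y)]addrC subrK.
rewrite !orbit_sum_cat !(shD iotaP) (_ : 2 = 1 + 1 :> R)// rmorphD rmorph1.
rewrite !scalerDl !scale1r.
have -> : creal A e = creal A (e / 4) + creal A (e / 4) + (creal A (e / 4) + creal A (e / 4)).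
  by rewrite -!crealD; congr creal; field.
set p := iota _; set c := creal _ _.
set X := star x ** x; set Y := star y ** y; set Z := star _ ** _.
suff -> : Y + Z + (Y + Z) - X + (p + c - Y + (c - Z) + (p + c - Y + (c - Z)))
   = p + p + (c + c + (c + c)) - X by [].
by zmod.
Qed.

(** Conjugating x^* x by u t only translates the list of group elements; this is why the whole orbit
    of a is allowed in the sums. *)
Lemma oli_unitary x t : N x -> N (x ** u t).
Proof.
move=> Nx e e0; have [ts xts] := Nx _ e0; exists [seq (s * t)%g | s <- ts].
have -> : iota (orbit_sum [seq (s * t)%g | s <- ts]) =
    star (u t) ** iota (orbit_sum ts) ** u t.
  rewrite -(rcp_conj AP) /orbit_sum big_map.
  rewrite (sh_sum (alpha_hom alphaP _)).
  by congr iota; apply: eq_bigr => s _; rewrite invgM (actionM alphaP).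
have := spos_conj (u t) xts; rewrite cmulBr cmulDr cmulBl cmulDl mul_creal cmulZl.
rewrite -(unitary_repV uP) -(unitary_repM uP) mulVg (unitary_rep1 uP).
by rewrite (unitary_repV uP) starM !cmulA.
Qed.

Definition order_ideal : set A := [set x | N x /\ N (star x)].
Definition idealizer : set A :=
  [set d | forall x, order_ideal x -> order_ideal (d ** x) /\ order_ideal (x ** d)].

Let I0 := order_ideal.

Lemma order_ideal_star x : I0 x -> I0 (star x).
Proof. by move=> [Nx Nsx]; split; rewrite ?starK. Qed.

Lemma order_idealD x y : I0 x -> I0 y -> I0 (x + y).
Proof. by move=> [x1 x2] [y1 y2]; split; rewrite ?starD; exact: oliD. Qed.

Lemma oliZ (c : R[i]) x : N x -> N (c *: x).
Proof. by move=> Nx; rewrite -[x]cmul1 -cmulZl; exact: oliM. Qed.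

Lemma order_idealZ (c : R[i]) x : I0 x -> I0 (c *: x).
Proof. by move=> [x1 x2]; split; rewrite ?starZ; exact: oliZ. Qed.

Lemma order_ideal0 : I0 0. Proof. by split; rewrite ?star0; exact: oli0. Qed.

Lemma order_ideal_closed x :
  (forall e, 0 < e -> exists2 y, I0 y & rnorm (x - y) < e) -> I0 x.
Proof.
move=> H; split; apply: oli_closed => e /H[y [y1 y2] xy]; first by exists y.
by exists (star y) => //; rewrite -starB rnorm_star.
Qed.

Lemma order_idealM x y : I0 x -> I0 y -> I0 (x ** y).
Proof. by move=> [x1 x2] [y1 y2]; split; rewrite ?starM; exact: oliM. Qed.

Lemma idealizer_sub_cstar : sub_cstar idealizer.
Proof.
split.
- by move=> x _; rewrite c0mul cmul0; split; exact: order_ideal0.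
- move=> d d' Dd Dd' x Ix; have [p1 p2] := Dd _ Ix; have [q1 q2] := Dd' _ Ix.
  by rewrite cmulDl cmulDr; split; exact: order_idealD.
- move=> c d Dd x Ix; have [p1 p2] := Dd _ Ix.
  by rewrite cmulZl cmulZr; split; exact: order_idealZ.
- move=> d d' Dd Dd' x Ix; have [p1 p2] := Dd _ Ix; have [q1 q2] := Dd' _ Ix.
  have [r1 _] := Dd _ q1; have [_ r2] := Dd' _ p2.
  by split; [rewrite -cmulA|rewrite cmulA].
- move=> d Dd x Ix; have [p1 p2] := Dd _ (order_ideal_star Ix).
  have := order_ideal_star p1; have := order_ideal_star p2.
  by rewrite !starM !starK.
- apply/closed_rnormP => d H x Ix.
  have K0 : 0 < rnorm x + 1 by rewrite ltr_wpDl// rnorm_ge0.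
  have xe e : 0 < e -> e / (rnorm x + 1) * rnorm x <= e.
    by move=> e0; rewrite mulrAC ler_pdivrMr// ler_wpM2l ?(ltW e0)// lerDl.
  split; apply: order_ideal_closed => e e0;
    have [d' Dd' dd] := H _ (divr_gt0 e0 K0); have [p1 p2] := Dd' _ Ix.
    exists (d' ** x) => //; rewrite -cmulBl.
    apply: (le_lt_trans (rnormM _ _)).
    have [->|x0] := eqVneq (rnorm x) 0; first by rewrite mulr0.
    apply: (lt_le_trans _ (xe _ e0)); rewrite ltr_pM2r// lt0r x0; exact: rnorm_ge0.
  exists (x ** d') => //; rewrite -cmulBr.
  apply: (le_lt_trans (rnormM _ _)); rewrite mulrC.
  have [->|x0] := eqVneq (rnorm x) 0; first by rewrite mulr0.
  apply: (lt_le_trans _ (xe _ e0)); rewrite ltr_pM2r// lt0r x0; exact: rnorm_ge0.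
Qed.

Lemma idealizer_unitary t : idealizer (u t).
Proof.
move=> x [x1 x2]; split; split.
- exact: oliM.
- by rewrite starM -(unitary_repV uP); exact: oli_unitary.
- exact: oli_unitary.
- by rewrite starM; exact: oliM.
Qed.

Lemma order_ideal_ideal : closed_ideal idealizer I0.
Proof.
split.
- by move=> x Ix y Iy; split; exact: order_idealM.
- exact: order_ideal0.
- exact: order_idealD.
- exact: order_idealZ.
- by move=> d x Dd /Dd[].
- by move=> x d Ix Dd; have [] := Dd _ Ix.
- by apply/closed_rnormP => x; exact: order_ideal_closed.
Qed.

(** a^2 <= |a| a, and |a| a is below a multiple of the conjugate of a by the unit. *)
Lemma order_ideal_gen : I0 (iota a).
Proof.
have sa : star (iota a) = iota a.
  by rewrite -(star_hom_star iotaP) (spos_star_self ap).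
suff Na : N (iota a) by split; rewrite ?sa.
move=> e e0; have [ts tsP] := orbit_sum_scale [:: 1%g] (rnorm_ge0 a).
exists ts; rewrite sa -(star_homM iotaP).
have [b [sb bb _ _]] := spos_sqrt ap.
have p1 := spos_conj b (sposB_norm (spos_star_self ap) (lexx _)).
have {}p1 : spos ((rnorm a)%:C%C *: a - a ** a).
  by move: p1; rewrite sb cmulBr cmulBl mul_creal cmulZl bb -{3}bb !cmulA bb -cmulA bb.
rewrite /orbit_sum big_seq1 invg1 (action1 alphaP) -/(orbit_sum ts) in tsP.
have := sposD (sh_spos iotaP (sposD tsP p1)) (spos_creal A (ltW e0)).
by rewrite addrA subrK (shB iotaP) addrAC.
Qed.

(** With tolerance 1/2 an orbit sum is at least 1/2, and its double at least 1. The inequality holds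
    in A and is pulled back along the injective iota. *)
Lemma order_ideal_unit : (forall b, iota b = 0 -> b = 0) -> I0 1c ->
  exists ts, spos (orbit_sum ts - 1c).
Proof.
move=> iota_inj [N1 _]; have e2 : 0 < 2^-1 :> R by rewrite invr_gt0.
have [ts tsP] := N1 _ e2; exists (ts ++ ts).
apply: (sh_reflect_spos iotaP iota_inj).
  by rewrite starB star1 (spos_star_self (orbit_sum_spos _)).
have := sposD tsP tsP; rewrite star1 cmul1 (shB iotaP) (star_hom1 iotaP).
rewrite orbit_sum_cat (shD iotaP).
have E : creal A 2^-1 + creal A 2^-1 = 1c :> A.
  by rewrite -crealD -creal1; congr creal; field.
set p := iota _; set h := creal _ _ in E *.
suff -> : p + h - 1c + (p + h - 1c) = p + p - 1c by [].
by rewrite -E; zmod.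
Qed.

End Idealizer.

Lemma group_subalgebra_mem (R : realType) (G : groupType) (A : cstarType R)
  (u : G -> A) t : group_subalgebra u (u t).
Proof. by apply: sub_gen_smallest; exists t. Qed.

(** By [ccoef_norm] for a one-term list, iota does not decrease norms. *)
Lemma iota_injective (R : realType) (G : groupType) (B A : cstarType R)
  (alpha : G -> B -> B) (iota : B -> A) (u : G -> A) :
  action alpha -> reduced_crossed_product alpha iota u ->
  forall b, iota b = 0 -> b = 0.
Proof.
move=> alphaP AP b b0; have [H [pi [piP rcpN]]] := rcp_norm AP.
have := ccoef_norm alphaP AP piP rcpN [:: (b, 1%g)] 1%g.
rewrite /cl big_seq1 /= b0 c0mul rnorm0 /ccoef big_mkcond big_seq1 /= eqxx.
by move=> h; apply: rnorm_eq0; apply/eqP; rewrite eq_le h rnorm_ge0.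
Qed.

Lemma full_of_irreducible (R : realType) (G : groupType) (B A : cstarType R)
  (alpha : G -> B -> B) (iota : B -> A) (u : G -> A) :
  action alpha -> reduced_crossed_product alpha iota u ->
  cstar_irreducible (group_subalgebra u) ->
  forall a : B, cpos a -> a <> 0 -> exists (n : nat) (t : 'I_n -> G),
    cle 1%cstar (\sum_(j < n) alpha (t j)^-1%g a).
Proof.
move=> alphaP AP [_ _ irr] a /cposP ap a0.
have inj := iota_injective alphaP AP.
have DP := idealizer_sub_cstar alphaP AP ap.
have Cu : group_subalgebra u `<=` idealizer alpha iota a.
  apply: smallest_sub => // _ [t _ <-]; exact: idealizer_unitary.
have [_ /(_ _ (order_ideal_ideal alphaP AP ap))[I0|ID]] := irr _ DP Cu.
  have := order_ideal_gen alphaP AP ap; rewrite I0 => /inj; exact.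
have I1 : order_ideal alpha iota a 1c.
  by rewrite ID => x Ix; rewrite cmul1 cmulr1.
have [ts tsP] := order_ideal_unit alphaP AP ap inj I1.
exists (size ts), (tnth (in_tuple ts)); apply/cleP.
by rewrite -(big_tnth _ _ ts xpredT (fun t => alpha t^-1%g a)).
Qed.

(** * States *)

Lemma rnorm_ci (R : realType) (V : normedModType R[i]) (x : V) :
  rnorm (ci R *: x) = rnorm x.
Proof.
by rewrite /rnorm normrZ normc_def /= expr0n expr1n /= add0r sqrtr1 mul1r.
Qed.

Section States.
Variables (R : realType) (B : cstarType R).
Implicit Types (phi : B -> R[i]) (a b : B).

Section OneState.
Variables (phi : B -> R[i]) (phiP : state phi).

Lemma stateD a b : phi (a + b) = phi a + phi b.
Proof. by have := state_linear phiP 1 a b; rewrite scale1r mul1r. Qed.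

Lemma state0 : phi 0 = 0.
Proof. by apply: (addrI (phi 0)); rewrite -stateD !addr0. Qed.

Lemma stateZ (c : R[i]) a : phi (c *: a) = c * phi a.
Proof. by have := state_linear phiP c a 0; rewrite state0 !addr0. Qed.

Lemma stateN a : phi (- a) = - phi a.
Proof. by rewrite -scaleN1r stateZ mulN1r. Qed.

Lemma state_sum (I : Type) (r : seq I) (F : I -> B) :
  phi (\sum_(k <- r) F k) = \sum_(k <- r) phi (F k).
Proof. exact: (big_morph phi stateD state0). Qed.

Lemma state_creal (r : R) : phi (creal B r) = r%:C%C.
Proof. by rewrite /creal stateZ (state_one phiP) mulr1. Qed.

Lemma state_ge0 a : spos a -> 0 <= phi a.
Proof. by move=> /cposP; exact: (state_pos phiP). Qed.

(** Both |a| + a and |a| - a are positive. *)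
Lemma state_bound_self a : star a = a ->
  complex.Im (phi a) = 0 /\ `|complex.Re (phi a)| <= rnorm a.
Proof.
move=> sa; have := state_ge0 (sposB_norm sa (lexx _)).
have := state_ge0 (sposD_norm sa (lexx _)).
rewrite !stateD stateN state_creal; case: (phi a) => x y.
rewrite !lecE /= => /andP[/eqP y0 x0] /andP[_ x1]; split; first by lra.
by rewrite ler_norml; apply/andP; split; lra.
Qed.

(** By [state_bound_self], phi is real on twice the real and imaginary parts of b. *)
Lemma state_star b : phi (star b) = ((phi b)^*)%C.
Proof.
have /state_bound_self[p _] : star (b + star b) = b + star b.
  by rewrite starD starK addrC.
have /state_bound_self[q _] : star (ci R *: (b - star b)) = ci R *: (b - star b).
  rewrite starZ starB starK.
  by rewrite conj_conjc ci_conj scaleNr -scalerN opprB.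
move: p q; rewrite stateZ stateD stateD stateN; case: (phi b) (phi (star b)) => x y [z t].
rewrite /ci /= => p q; apply/eqP; rewrite eq_complex /=; apply/andP.
by split; apply/eqP; lra.
Qed.

Lemma state_Re_bound b : `|complex.Re (phi b)| <= rnorm b.
Proof.
have /state_bound_self[_] : star (b + star b) = b + star b.
  by rewrite starD starK addrC.
have := rnormD b (star b); rewrite stateD state_star rnorm_star raddfD /=.
by case: (phi b) => x y /= p q; rewrite !ler_norml in q *; lra.
Qed.

Lemma state_Im_bound b : `|complex.Im (phi b)| <= rnorm b.
Proof.
have := state_Re_bound (ci R *: b).
by rewrite rnorm_ci stateZ /ci; case: (phi b) => x y /=; rewrite mul0r mul1r sub0r normrN.
Qed.

Lemma state_comp (f : B -> B) : star_hom f -> state (fun b => phi (f b)).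
Proof.
move=> fP; split.
- by move=> c a b; rewrite (shD fP) (shZ fP) stateD stateZ.
- by move=> a /cposP ap; apply: state_ge0; exact: (sh_spos fP).
- by rewrite (star_hom1 fP) (state_one phiP).
Qed.

End OneState.

(** Means act on real functions, hence on the two parts separately. *)
Definition state_average (S : Type) (w : (S -> R) -> R) (Phi : S -> B -> R[i]) b : R[i] :=
  (w (fun s => complex.Re (Phi s b)) +i* w (fun s => complex.Im (Phi s b)))%C.

Lemma mean_state (S : Type) (w : (S -> R) -> R) (Phi : S -> B -> R[i]) :
  mean w -> (forall s, state (Phi s)) -> state (state_average w Phi).
Proof.
move=> wm st.
have bR b : bnd (fun s => complex.Re (Phi s b)).
  by exists (rnorm b) => s; exact: state_Re_bound.
have bI b : bnd (fun s => complex.Im (Phi s b)).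
  by exists (rnorm b) => s; exact: state_Im_bound.
split.
- move=> [c d] a b; rewrite /state_average.
  have -> : (fun s => complex.Re (Phi s ((c +i* d)%C *: a + b))) =
      (fun s => c * complex.Re (Phi s a) - d * complex.Im (Phi s a) + complex.Re (Phi s b)).
    apply/funext => s; rewrite (stateD (st s)) (stateZ (st s)).
    by case: (Phi s a) (Phi s b) => [? ?] [].
  have -> : (fun s => complex.Im (Phi s ((c +i* d)%C *: a + b))) =
      (fun s => c * complex.Im (Phi s a) + d * complex.Re (Phi s a) + complex.Im (Phi s b)).
    apply/funext => s; rewrite (stateD (st s)) (stateZ (st s)).
    by case: (Phi s a) (Phi s b) => [? ?] [].
  rewrite (meanD wm (bndB (bndZ c (bR a)) (bndZ d (bI a))) (bR b)).
  rewrite (meanD wm (bndD (bndZ c (bI a)) (bndZ d (bR a))) (bI b)).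
  rewrite (meanB wm (bndZ c (bR a)) (bndZ d (bI a))).
  by rewrite (meanD wm (bndZ c (bI a)) (bndZ d (bR a))) !(meanZ wm).
- move=> a /cposP ap.
  have H s : complex.Im (Phi s a) = 0 /\ 0 <= complex.Re (Phi s a).
    by have := state_ge0 (st s) ap; rewrite lecE /= => /andP[/eqP].
  rewrite lecE /=; apply/andP; split.
    by rewrite (_ : (fun s => _) = fun=> 0) ?(mean_cst wm)//; apply/funext => s; exact: (H s).1.
  by apply: (sublin_ge wm (bR a)) => s; exact: (H s).2.
- rewrite /state_average.
  rewrite (_ : (fun s => complex.Re _) = fun=> 1); last first.
    by apply/funext => s; rewrite (state_one (st s)).
  rewrite (_ : (fun s => complex.Im _) = fun=> 0); last first.
    by apply/funext => s; rewrite (state_one (st s)).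
  by rewrite !(mean_cst wm).
Qed.

Lemma vector_state (H : hilbertType R) (pi : B -> H -> H) xi :
  faithful_rep pi -> rnorm xi = 1 -> state (fun b => dot (pi b xi) xi).
Proof.
move=> piP x1; split.
- by move=> c a b; rewrite (repP piP) dotPl.
- by move=> a [x ->]; rewrite (repM piP) (rep_star piP) dot_norm exprn_ge0.
- by rewrite (rep1 piP) dot_self x1 expr1n.
Qed.

End States.

Section QuadraticForm.
Variables (R : realType) (B : cstarType R) (H : hilbertType R).
Variables (pi : B -> H -> H) (piP : faithful_rep pi).

Lemma qform0 xi : qform pi 0 xi = 0.
Proof. by rewrite /qform (pi0 piP) dot0. Qed.

Lemma qformZ (r : R) b xi : qform pi (r%:C%C *: b) xi = r * qform pi b xi.
Proof. by rewrite /qform (piZ piP) dotZ; case: (dot _ _) => x y /=; rewrite mul0r subr0. Qed.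

Lemma qform_scale (r : R) b xi :
  qform pi b (r%:C%C *: xi) = r ^+ 2 * qform pi b xi.
Proof.
rewrite /qform (pi_vecZ piP) dotZ dotC dotZ [dot xi _]dotC.
by case: (dot _ _) => x y /=; ring.
Qed.

End QuadraticForm.

Section FullFaithful.
Variables (R : realType) (G : groupType) (B : cstarType R).
Variables (alpha : G -> B -> B) (alphaP : action alpha).

Lemma group_faithful_of_full :
  (forall a : B, cpos a -> a <> 0 -> exists (n : nat) (t : 'I_n -> G),
     cle 1%cstar (\sum_(j < n) alpha (t j)^-1%g a)) ->
  forall phi : B -> R[i], state phi -> group_faithful alpha phi.
Proof.
move=> full phi phiP a ap a0; apply: contrapT => an0.
have [n [t /cleP /(state_ge0 phiP)]] := full a ap an0.
rewrite (stateD phiP) (stateN phiP) (state_one phiP) (state_sum phiP) big1 => [|j _].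
  by rewrite sub0r oppr_ge0 ler10.
exact: a0.
Qed.

Lemma orbit_sum_dominates (a : B) (ws : seq (R * G)) : spos a ->
  all (fun v => 0 <= v.1) ws ->
  exists ts, spos (orbit_sum alpha a ts - \sum_(v <- ws) v.1%:C%C *: alpha v.2^-1%g a).
Proof.
move=> ap; elim: ws => [_|v ws IH /= /andP[v0 /IH[ts tsP]]].
  by exists [::]; rewrite /orbit_sum !big_nil subrr; exact: spos0.
have [ts' ts'P] := orbit_sum_scale alphaP ap [:: v.2] v0; exists (ts' ++ ts).
rewrite orbit_sum_cat big_cons opprD addrACA; apply: sposD => //.
by move: ts'P; rewrite {2}/orbit_sum big_seq1.
Qed.

Lemma full_of_group_faithful (H : hilbertType R) (pi : B -> H -> H) :
  faithful_rep pi ->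
  (forall phi : B -> R[i], state phi -> group_faithful alpha phi) ->
  forall a : B, cpos a -> a <> 0 -> exists (n : nat) (t : 'I_n -> G),
     cle 1%cstar (\sum_(j < n) alpha (t j)^-1%g a).
Proof.
move=> piP gf a /cposP ap a0.
have al t : spos (alpha t^-1%g a) := sh_spos (alpha_hom alphaP _) ap.
pose S := {xi : H | rnorm xi = 1}.
have unit (xi : H) : xi <> 0 -> rnorm ((rnorm xi)^-1%:C%C *: xi) = 1.
  move=> xi0; have n0 : rnorm xi != 0 by apply: contra_notN xi0 => /eqP/rnorm_eq0.
  by rewrite rnormZr ger0_norm ?invr_ge0 ?rnorm_ge0// mulVf.
(* H is not zero, since 1 <> 0 in B acts as the identity. *)
have [xi xi0] : exists xi : H, xi <> 0.
  apply: contrapT => /forallNP H0; apply/(negP (@cone_neq0 R B))/eqP.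
  by apply: (rep_faithful piP) => xi; rewrite (rep1 piP); apply: contrapT; exact: H0.
pose Phi (s : S) (b : B) := dot (pi b (sval s)) (sval s).
have st s : state (Phi s) by apply: vector_state => //; exact: (svalP s).
pose v t (s : S) := - complex.Re (Phi s (alpha t^-1%g a)).
have bv t : bnd (v t).
  by apply: bndN; exists (rnorm (alpha t^-1%g a)) => s; exact: state_Re_bound.
have [|ws [d d0 [ws0 _ wsd]]] := @minimax R S G v (exist _ _ (unit _ xi0)) bv.
  (* If w (v t) >= 0 for all t, the average of the vector states by w is a state that vanishes on
     the orbit of a, so a = 0. *)
  move=> w wm; apply: contrapT => /forallNP wv; apply: a0.
  have stw := mean_state wm st.
  apply: (gf _ stw); first exact/cposP.
  move=> t; apply/eqP; rewrite eq_le; apply/andP; split; last first.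
    by apply: (state_ge0 stw); exact: al.
  have := state_ge0 stw (al t); rewrite !lecE /= => /andP[/eqP-> _]; rewrite eqxx /=.
  have bP : bnd (fun s => complex.Re (Phi s (alpha t^-1%g a))).
    by exists (rnorm (alpha t^-1%g a)) => s; exact: state_Re_bound.
  by move/negP: (wv t); rewrite -leNgt /v (meanN wm bP) oppr_ge0.
pose y := \sum_(x <- ws) (x.1)%:C%C *: alpha x.2^-1%g a.
have yd : spos (y - creal B d).
  apply: (spos_qform piP) => [|eta].
    rewrite starB star_creal; congr (_ - _); rewrite /y.
    rewrite (big_morph (@star R B) starD (star0 B)).
    by apply: eq_bigr => x _; rewrite starZr (spos_star_self (al _)).
  have [->|/eqP eta0] := eqVneq eta 0; first by rewrite /qform (pi_vec0 piP) dot0.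
  have n0 : rnorm eta != 0 by apply: contra_notN eta0 => /eqP/rnorm_eq0.
  rewrite -[eta]scale1r -(rmorph1 (real_complex R)) -(mulfV n0) rmorphM -scalerA /=.
  rewrite (qform_scale piP) mulr_ge0 ?sqr_ge0// (qformD piP) (qformN piP) (qform_creal piP).
  rewrite (unit _ eta0) expr1n mulr1 subr_ge0 -lerN2.
  apply: le_trans _ (wsd (exist _ _ (unit _ eta0))).
  rewrite /y (big_morph (fun b => qform pi b _) (fun b c => qformD piP b c _) (qform0 piP _)).
  rewrite -sumrN; apply: ler_sum => x _.
  by rewrite (qformZ piP) /v mulrN.
(* The combination y is at least d; an orbit sum dominates it, and repeating this sum at least d^-1
   times makes it at least 1. *)
have [ts tsP] := orbit_sum_dominates ap ws0.
have d0' : 0 <= d^-1 by rewrite invr_ge0 ltW.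
have [ts' ts'P] := orbit_sum_scale alphaP ap ts d0'.
exists (size ts'), (tnth (in_tuple ts')); apply/cleP.
rewrite -(big_tnth _ _ ts' xpredT (fun t => alpha t^-1%g a)).
have := sposD ts'P (sposZ d0' (sposD tsP yd)).
rewrite addrA subrK scalerBr crealZ mulVf ?gt_eqF// creal1.
by rewrite addrA subrK.
Qed.

End FullFaithful.

Lemma fset_sum_le (R : numDomainType) (I : choiceType) (F F' : {fset I}) (g : I -> R) :
  (F `<=` F')%fset -> (forall s, 0 <= g s) ->
  \sum_(s <- F) g s <= \sum_(s <- F') g s.
Proof.
move=> FF' g0; rewrite [leLHS](_ : _ = \sum_(s <- F) (g s *+ (s \in F))); last first.
  by apply: eq_big_seq => s sF; rewrite sF.
rewrite (big_fset_incl _ FF') => [|s _ /negPf->//].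
by apply: ler_sum => s _; case: (s \in F) => //=; rewrite mulr1n.
Qed.

(** * Measures of full support and stationary means on G *)

Section Probability.
Variables (R : realType) (G : groupType).
Hypothesis G_countable : countable [set: G].

Let numbering : exists f : G -> nat, injective f.
Proof.
by move: G_countable => /countable_injP[f fi]; exists f => x y; apply: fi; rewrite inE.
Qed.

(** The image of a Poisson law, which charges every integer, under a left inverse of the numbering;
    the integers that number nothing are sent to 1. *)
Lemma full_support : exists mu : probability (discr G) R,
  forall t, 0 < fine (mu [set t]).
Proof.
have [f finj] := numbering.
pose h (n : nat) : discr G := xget (1%g : G) [set t | f t = n].
have hf t : h (f t) = t.
  by apply: finj; rewrite /h; case: xgetP => // /(_ t) /=.
have mh : measurable_fun [set: nat] h by [].
pose X : {mfun nat >-> discr G} := mfun_Sub (mem_set mh).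
pose P : probability nat R := poisson_prob 1 0.
exists (distribution P X) => t; apply: fine_gt0; apply/andP; split; last first.
  by rewrite ltey_eq fin_num_measure.
have : (P [set f t] <= distribution P X [set t])%E.
  by apply: le_measure; rewrite ?inE// => n /= ->; exact: hf.
apply: lt_le_trans; rewrite /P /= /poisson_prob ltr01.
have pos : 0 < poisson_pmf 1 (f t) :> R.
  by rewrite /poisson_pmf ltr01 mulr_gt0 ?expR_gt0// mulr_gt0 ?exprn_gt0.
by rewrite esum_set1 ?lte_fin// lee_fin ltW.
Qed.

Variable mu : probability (discr G) R.
Let p t : R := fine (mu [set t]).

Lemma mass_ge0 t : 0 <= p t.
Proof. by rewrite /p fine_ge0. Qed.

Lemma mass_fset (F : {fset G}) : (\sum_(t <- F) p t)%:E = mu [set` F].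
Proof.
rewrite -sumEFin (eq_bigr (fun t : G => mu [set t])); last first.
  by move=> t _; rewrite /p fineK// fin_num_measure.
have -> : [set` F] = \big[setU/set0]_(t <- F) [set t].
  by rewrite -bigcup_fset; apply/seteqP; split=> [t Ft|t [s Fs ->]//]; exists t.
rewrite [RHS](@measure_fbigsetU _ _ _ mu G F (fun t => [set t]))//.
by move=> s t _ _ [x [/= <- <-]].
Qed.

Lemma mass_fset_le1 (F : {fset G}) : \sum_(t <- F) p t <= 1.
Proof. by rewrite -lee_fin mass_fset probability_le1. Qed.

Lemma mass_fset_gt e : 0 < e -> exists F : {fset G}, 1 - e < \sum_(t <- F) p t.
Proof.
move=> e0; have [f finj] := numbering.
pose A n : set (discr G) := [set t | (f t < n)%N].
have fA n : finite_set (A n).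
  apply: (@finite_preimage _ _ (`I_n) f) => [x y _ _|]; first exact: finj.
  exact: finite_II.
have : mu \o A @ \oo --> mu (\bigcup_n A n).
  apply: nondecreasing_cvg_mu => // m n mn; apply/subsetPset => t /= tm.
  exact: leq_trans tm mn.
have -> : \bigcup_n A n = setT.
  by apply/seteqP; split=> // t _; exists (f t).+1 => //=; rewrite /A /=.
rewrite probability_setT => /fine_cvg /cvgr_gt /(_ (1 - e)).
rewrite ltrBlDr ltrDl => /(_ e0) [n _ /(_ n (leqnn n)) /= H].
by exists (fset_set (A n)); rewrite -lte_fin mass_fset fset_setK// -[mu _]fineK ?fin_num_measure.
Qed.

(* Hahn-Banach makes w nonnegative on the functions that dominate some f - mu * f
   up to a small error; truncating mu to finite sets keeps mu * f elementary. *)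
Lemma stationary_mean : exists2 w : (G -> R) -> R, mean w &
  forall (F : {fset G}) (f : G -> R) M, (forall t, `|f t| <= M) ->
    `|\sum_(s <- F) p s * w (fun t => f (s * t)%g) - w f| <= M * (1 - \sum_(s <- F) p s).
Proof.
have psum_mono (F F' : {fset G}) (g : G -> R) : (F `<=` F')%fset -> (forall s, 0 <= g s) ->
    \sum_(s <- F) p s * g s <= \sum_(s <- F') p s * g s.
  by move=> FF' g0; apply: fset_sum_le => // s; rewrite mulr_ge0// mass_ge0.
pose K : set (G -> R) := [set k | bnd k /\ forall e, 0 < e -> exists2 f, bnd f &
  exists F0 : {fset G}, forall F : {fset G}, (F0 `<=` F)%fset -> forall t,
    f t - \sum_(s <- F) p s * f (s * t)%g - e <= k t].
have Kc : is_cone K.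
  split.
  - by move=> k [].
  - split; first exact: bnd_cst.
    move=> e e0; exists (fun=> 0); first exact: bnd_cst.
    exists fset0 => F _ t; rewrite big1 => [|s _]; last by rewrite mulr0.
    by lra.
  - move=> k l [bk Hk] [bl Hl]; split; first exact: bndD.
    move=> e e0; have e2 : 0 < e / 2 by rewrite divr_gt0.
    have [f bf [F0 fk]] := Hk _ e2; have [g bg [F1 gl]] := Hl _ e2.
    exists (fun t => f t + g t); first exact: bndD.
    exists (F0 `|` F1)%fset => F; rewrite fsubUset => /andP[F0F F1F] t.
    under eq_bigr do rewrite mulrDr.
    rewrite big_split /=; have := fk _ F0F t; have := gl _ F1F t; lra.
  - move=> c k; rewrite le_eqVlt => /orP[/eqP<-|c0] [bk Hk]; (split; first exact: bndZ).
      move=> e e0; exists (fun=> 0); first exact: bnd_cst.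
      exists fset0 => F _ t; rewrite big1 => [|s _]; last by rewrite mulr0.
      by rewrite mul0r; lra.
    move=> e e0; have [f bf [F0 fk]] := Hk _ (divr_gt0 e0 c0).
    exists (fun t => c * f t); first exact: bndZ.
    exists F0 => F F0F t; have := fk _ F0F t; rewrite -(ler_pM2l c0).
    rewrite !mulrBr [c * (e / c)]mulrC divfK ?gt_eqF// mulr_sumr.
    by under eq_bigr do rewrite mulrCA.
have Ksup k e : K k -> 0 < e -> exists t, - e < k t.
  move=> [bk Hk] e0; apply: contrapT => /forallNP H.
  have e4 : 0 < e / 4 by rewrite divr_gt0.
  have [f [M fM] [F0 fk]] := Hk _ e4.
  have M0 : 0 <= M by apply: le_trans (fM 1%g).
  have M1 : 0 < M + 1 by rewrite ltr_wpDl.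
  have [F1 F1e] := mass_fset_gt (divr_gt0 e4 M1).
  pose F := (F0 `|` F1)%fset; pose P := \sum_(s <- F) p s.
  have Pe : (1 - P) * (M + 1) <= e / 4.
    rewrite -ler_pdivlMr//.
    have := psum_mono F1 F (fun=> 1) (fsubsetUr _ _) (fun=> ler01).
    under eq_bigr do rewrite mulr1.
    by under [leRHS]eq_bigr do rewrite mulr1; rewrite -/P; lra.
  have P1 : P <= 1 := mass_fset_le1 F.
  have hs : has_sup (range f) by apply: (sup_has (1%g : G)); exists M.
  set T := sup (range f).
  have fT t : f t <= T by apply: ub_le_sup; [case: hs|exists t].
  have TM : - M <= T by apply: le_trans (fT 1%g); have := fM 1%g; rewrite ler_norml => /andP[].
  (* If k <= - e everywhere, then f t <= P T - 3 e / 4 for all t, while P T <= T + e / 4 as T >= -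
     M. So the supremum T of f would be smaller than itself. *)
  suff : T <= T - e / 4 by lra.
  apply: ge_sup; first by exists (f 1%g), 1%g.
  move=> _ [t _ <-]; have := fk F (fsubsetUl _ _) t; have /negP := H t; rewrite -leNgt.
  have : \sum_(s <- F) p s * f (s * t)%g <= P * T.
    by rewrite /P mulr_suml; apply: ler_sum => s _; rewrite ler_wpM2l ?mass_ge0.
  have : (1 - P) * (M + T) >= 0 by rewrite mulr_ge0 ?subr_ge0//; lra.
  have : (1 - P) >= 0 by rewrite subr_ge0.
  nra.
have [w wm wK] := sup_cone_mean (1%g : G) Kc Ksup; exists w => // F f M fM.
have bt (g : G -> R) s : bnd g -> bnd (fun t => g (s * t)%g).
  by move=> [N gN]; exists N => t.
have key (g : G -> R) : (forall t, `|g t| <= M) ->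
    0 <= w g - \sum_(s <- F) p s * w (fun t => g (s * t)%g) + M * (1 - \sum_(s <- F) p s).
  move=> gM; have bg : bnd g by exists M.
  have bS : bnd (fun t => \sum_(s <- F) p s * g (s * t)%g).
    by apply: bnd_sum => s; apply: bndZ; exact: bt.
  have -> : \sum_(s <- F) p s * w (fun t => g (s * t)%g) =
      w (fun t => \sum_(s <- F) p s * g (s * t)%g).
    rewrite (mean_sum wm) => [|s]; last by apply: bndZ; exact: bt.
    by apply: eq_bigr => s _; rewrite (meanZ wm)//; exact: bt.
  rewrite -(meanB wm bg bS) -[X in _ + X](mean_cst wm) -(meanD wm (bndB bg bS) (bnd_cst _)).
  (* The function lies in K by means of g itself: enlarging F to F' lowers the truncated sum of g by
     at most M times the mass missing from F, since M + g >= 0. *)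
  apply: wK; split; first by apply: bndD; [exact: bndB|exact: bnd_cst].
  move=> e e0; exists g => //; exists F => F' FF' t.
  have := psum_mono F F' (fun s => M + g (s * t)%g) FF'.
  have gM' s : 0 <= M + g s by have := gM s; rewrite ler_norml => /andP[]; lra.
  move=> /(_ (fun s => gM' _)); under eq_bigr do rewrite mulrDr.
  under [leRHS]eq_bigr do rewrite mulrDr.
  rewrite !big_split /= -!mulr_suml.
  have := mass_fset_le1 F'; have M0 : 0 <= M by apply: le_trans (gM 1%g).
  set P := \sum_(s <- F) p s; set P' := \sum_(s <- F') p s => P1 h.
  have : 0 <= M * (1 - P') by rewrite mulr_ge0 ?subr_ge0.
  lra.
have k1 := key f fM; have bf : bnd f by exists M.
have nM t : `|- f t| <= M by rewrite normrN.
have := key (fun t => - f t) nM; rewrite (meanN wm bf).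
under eq_bigr => s _ do rewrite (meanN wm (bt f s bf)) mulrN.
by rewrite sumrN ler_norml => k2; apply/andP; split; lra.
Qed.

End Probability.

(** * Stationary states *)

Section StationaryStates.
Variables (R : realType) (G : groupType) (B : cstarType R).
Hypothesis G_countable : countable [set: G].
Variables (alpha : G -> B -> B) (alphaP : action alpha).
Variable mu : probability (discr G) R.
Let p t : R := fine (mu [set t]).

Lemma stationaryP (phi : B -> R[i]) : stationary alpha mu phi <->
  forall a (e : R), 0 < e -> exists F0 : {fset G}, forall F : {fset G}, (F0 `<=` F)%fset ->
    `|phi a - \sum_(t <- F) (p t)%:C%C * phi (alpha t^-1%g a)| < e%:C%C.
Proof.
have E (F : {fset G}) (f : G -> R[i]) :
    summability.partial_sum (f : G -> R[i]^o) F = \sum_(t <- F) f t.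
  by rewrite /summability.partial_sum big_seq_fsetE.
have TF : ProperFilter (@summability.totally G) by exact: summability.totally_filter.
split=> [st a e e0|H a].
  have := st a => /cvgrPdist_lt /(_ (e%:C%C)); rewrite ltcR => /(_ e0)[F0 _ H].
  by exists F0 => F /H /=; rewrite E.
apply/cvgrPdist_lt => _ /complex_gt0[e e0 ->]; have [F0 FP] := H a e e0.
by exists F0 => // F /FP /=; rewrite E.
Qed.

(** phi a is the sum of the values of phi on the orbit of a with the positive weights p. A partial
    sum that contains t is at least p t times the value at t, so all these values vanish with phi
    a. *)
Lemma stationary_faithful (phi : B -> R[i]) : (forall t, 0 < p t) ->
  state phi -> stationary alpha mu phi -> group_faithful alpha phi -> faithful phi.
Proof.
move=> p0 phiP /stationaryP st gf a ap a0; apply: gf => // t.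
have al s : exists2 x : R, 0 <= x & phi (alpha s^-1%g a) = x%:C%C.
  have := state_ge0 phiP (sh_spos (alpha_hom alphaP s^-1%g) ((cposP a).1 ap)).
  by case: (phi _) => x y; rewrite lecE /= => /andP[/eqP-> x0]; exists x.
have [x x0 xE] := al t; rewrite /act_functional xE.
move: x0; rewrite le_eqVlt => /orP[/eqP<-//|x0].
have [F0 FP] := st a _ (mulr_gt0 (p0 t) x0).
have := FP (t |` F0)%fset (fsubsetU1 _ _); rewrite a0 sub0r normrN.
rewrite (big_fsetD1 t) ?fset1U1//= xE -rmorphM => H.
have [y y0 yE] : exists2 y : R, 0 <= y &
    \sum_(s <- ((t |` F0) `\ t)%fset) (p s)%:C%C * phi (alpha s^-1%g a) = y%:C%C.
  elim/big_rec: _ => [|s z _ [y y0 ->]]; first by exists 0.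
  have [v v0 ->] := al s; exists (p s * v + y); first by rewrite addr_ge0// mulr_ge0// ltW.
  by rewrite -rmorphM -rmorphD.
have z0 : 0 <= p t * x + y by rewrite addr_ge0// mulr_ge0// ltW.
by move: H; rewrite yE -rmorphD ger0_norm ?ler0c// ltcR gtrDl ltNge y0.
Qed.

Lemma group_faithful_of_stationary :
  (forall phi : B -> R[i], state phi -> stationary alpha mu phi -> faithful phi) ->
  forall phi : B -> R[i], state phi -> group_faithful alpha phi.
Proof.
move=> st phi phiP a ap a0.
have [w wm wst] := stationary_mean G_countable mu.
pose Phi (t : G) (b : B) := phi (alpha t^-1%g b).
have PhiP t : state (Phi t) by apply: state_comp => //; exact: alpha_hom.
have PhiM s t b : Phi t (alpha s^-1%g b) = Phi (s * t)%g b.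
  by rewrite /Phi -(actionM alphaP) -invgM.
have PhiR t b : `|complex.Re (Phi t b)| <= rnorm b.
  apply: (le_trans (state_Re_bound phiP _)); exact: (sh_contract (alpha_hom alphaP _)).
have PhiI t b : `|complex.Im (Phi t b)| <= rnorm b.
  apply: (le_trans (state_Im_bound phiP _)); exact: (sh_contract (alpha_hom alphaP _)).
apply: (st _ (mean_state wm PhiP)) => //; last first.
  have Phia t : Phi t a = 0 by exact: a0.
  rewrite /state_average; under eq_fun do rewrite Phia.
  by rewrite (mean_cst wm); under eq_fun do rewrite Phia; rewrite (mean_cst wm).
apply/stationaryP => b e e0.
(* The real and the imaginary part each contribute an error of at most rnorm b times the mass
   missing from F. *)
have K0 : 0 < 2 * rnorm b + 1 by have := rnorm_ge0 b; lra.
have [F0 F0P] := mass_fset_gt G_countable mu (divr_gt0 e0 K0).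
exists F0 => F FF.
have massF : 1 - e / (2 * rnorm b + 1) < \sum_(t <- F) p t.
  by apply: (lt_le_trans F0P); apply: fset_sum_le => // t; exact: mass_ge0.
have h1 := wst F _ _ (PhiR ^~ b); have h2 := wst F _ _ (PhiI ^~ b).
have -> : \sum_(t <- F) (p t)%:C%C * state_average w Phi (alpha t^-1%g b) =
   ((\sum_(s <- F) p s * w (fun t => complex.Re (Phi (s * t)%g b))) +i*
    (\sum_(s <- F) p s * w (fun t => complex.Im (Phi (s * t)%g b))))%C.
  have reE t z : (p t)%:C%C * z = (p t * complex.Re z +i* (p t * complex.Im z))%C.
    by case: z => x y; apply/eqP; rewrite eq_complex /= !mul0r subr0 addr0 !eqxx.
  elim/big_rec3: _ => [//|t x y z _ ->]; rewrite reE /=.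
  have -> : (fun s => complex.Re (Phi s (alpha t^-1%g b))) =
      (fun s => complex.Re (Phi (t * s)%g b)) by apply/funext => s; rewrite PhiM.
  by have -> : (fun s => complex.Im (Phi s (alpha t^-1%g b))) =
      (fun s => complex.Im (Phi (t * s)%g b)) by apply/funext => s; rewrite PhiM.
rewrite /state_average distrC.
move: h1 h2; set x := \sum_(s <- F) _; set P := \sum_(s <- F) p s.
set y := \sum_(s <- F) _ * w _; set x' := w _; set y' := w _ => h1 h2.
rewrite -/P in massF.
have -> : (x +i* y)%C - (x' +i* y')%C = (x - x')%:C%C + ci R * (y - y')%:C%C.
  by apply/eqP; rewrite eq_complex /= !(mul0r,mulr0,mul1r,subr0,add0r,addr0) !eqxx.
apply: (le_lt_trans (ler_normD _ _)); rewrite normrM.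
have -> : `|ci R| = 1 by rewrite normc_def /= expr0n expr1n /= add0r sqrtr1.
rewrite mul1r !normc_def /= expr0n /= !addr0 !sqrtr_sqr -rmorphD ltcR.
have := ltr_pM2r K0 (1 - P) (e / (2 * rnorm b + 1)).
rewrite divfK ?gt_eqF// => h3; have : (1 - P) * (2 * rnorm b + 1) < e by rewrite h3; lra.
have : 0 <= 1 - P by rewrite subr_ge0 mass_fset_le1.
lra.
Qed.

End StationaryStates.

Theorem theorem5p12 (R : realType) (G : groupType) (B A : cstarType R)
    (alpha : G -> B -> B) (iota : B -> A) (u : G -> A)
    (G_countable : countable [set: G])
    (G_simple : cstar_simple R G)
    (alphaP : action alpha)
    (AP : reduced_crossed_product alpha iota u) :
  [<-> cstar_irreducible (group_subalgebra u);
       forall a : B, cpos a -> a <> 0 ->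
         exists (n : nat) (t : 'I_n -> G),
           cle 1%cstar (\sum_(j < n) alpha (t j)^-1%g a);
       forall phi : B -> R[i]%C, state phi -> group_faithful alpha phi;
       exists mu : probability (discr G) R,
         forall phi : B -> R[i]%C,
           state phi -> stationary alpha mu phi -> faithful phi].
Proof.
have [H [pi [piP rcpN]]] := rcp_norm AP.
tfae.
- exact: (full_of_irreducible alphaP AP).
- exact: group_faithful_of_full.
- move=> gf; have [mu mu0] := full_support R G_countable.
  by exists mu => phi phiP st; apply: (stationary_faithful alphaP mu0) => //; exact: gf.
- move=> [mu /(group_faithful_of_stationary G_countable alphaP)].
  move=> /(full_of_group_faithful alphaP piP) full; split.
  + exact: sub_cstar_smallest.
  + rewrite -(unitary_rep1 (rcp_unitary AP)); exact: group_subalgebra_mem.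
  + move=> D DP CD; apply: (irreducible_of_full alphaP AP piP rcpN) => // t.
    by apply: CD; exact: group_subalgebra_mem.
Qed.
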